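(* Suppose that Assumption B (stated in the context) holds and let $J\subset I$ be a bounded interval. If $G(t,s)$ is compact in $C_b(\mathbb R^d)$ for every $(t,s)\in\Sigma_J$, then $\mathbf G(t,s)$ is compact in $C_b(\mathbb R^d;\mathbb R^m)$ for every $(t,s)\in\Sigma_J$. In particular, if there exist a $C^2$ function $W:\mathbb R^d\to\mathbb R$ such that $\lim_{|x|\to\infty}W(x)=+\infty$, a number $R>0$ and a convex increasing function $g:[0,+\infty)\to\mathbb R$ with $1/g\in L^1((a,+\infty))$ for large $a$ and $\tilde{\mathcal A}W\le-g\circ W$ in $I\times(\mathbb R^d\setminus B_R)$, then $\mathbf G(t,s)$ is compact in $C_b(\mathbb R^d;\mathbb R^m)$ for any $t>s\in I$.
   Context: $I$ is an open right-halfline or $I=\mathbb R$; $d,m\in\mathbb N$; $\alpha\in(0,1)$. For an interval $J$, $\Sigma_J=\{(t,s)\in J\times J:t>s\}$. $B_R$ is the open ball of $\mathbb R^d$ with center $0$ and radius $R$. For smooth $\mathbf w:\mathbb R^d\to\mathbb R^m$ and $t\in I$, $$(\boldsymbol{\mathcal A}(t)\mathbf w)(x)=\sum_{i,j=1}^dQ_{ij}(t,x)D^2_{ij}\mathbf w(x)+\sum_{j=1}^dB_j(t,x)D_j\mathbf w(x)+C(t,x)\mathbf w(x),$$ where $Q_{ij}$ are real-valued and $B_j$, $C$ are $m\times m$ matrix-valued. Standing assumption: $Q_{ij}=Q_{ji}$, $(B_i)_{hk}$, $C_{hk}$ belong to $C^{\alpha/2,\alpha}_{\rm loc}(I\times\mathbb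 R^d)$ (locally parabolic Hölder) and $\lambda_0:=\inf_{I\times\mathbb R^d}\lambda_Q>0$, $\lambda_Q(t,x)$ being the minimum eigenvalue of $Q(t,x)$. Assumption B. (i) There exist $b_i\in C^{\alpha/2,\alpha}_{\rm loc}(I\times\mathbb R^d)$ and $\tilde B_i\in C^{\alpha/2,\alpha}_{\rm loc}(I\times\mathbb R^d;\mathbb R^{m^2})$ such that $B_i=b_iI_m+\tilde B_i$ for $i=1,\dots,d$ and $|(\tilde B_i)_{jk}|\le\xi\lambda_Q^\sigma$ in $I\times\mathbb R^d$ for any $j,k=1,\dots,m$, $i=1,\dots,d$, some locally bounded function $\xi:I\to(0,+\infty)$ and some $\sigma\in(0,1)$. (ii) $H_J:=\sup_{J\times\mathbb R^d}(\Lambda_C+4^{-1}m^2d\,\xi^2\lambda_Q^{2\sigma-1})<+\infty$ for any bounded interval $J\subset I$, where $\Lambda_C(t,x)=\sup_{|\eta|=1}\langle C(t,x)\eta,\eta\rangle$. (iii) For any bounded interval $J\subset I$ there exist $\mu_J\in\mathbb R$ and a positive function $\varphi_J\in C^2(\mathbb R^d)$ blowing up as $|x|\to+\infty$ such that $\sup_{J\times\mathbb R^d}(\tilde{\mathcal A}\varphi_J-\mu_J\varphi_J)<+\infty$, where $\tilde{\mathcal A}={\rm Tr}(QD^2)+\langle\mathbf b,\nabla_x\rangle$ and $\mathbf b=(b_1,\dots,b_d)$. Under Assumption B, for every $s\in I$, $\mathbf f\in C_b(\mathbb R^d;\mathbb R^m)$ there is a unique function $\mathbf u\in C^{1,2}((s,+\infty)\times\mathbb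 R^d;\mathbb R^m)\cap C([s,+\infty)\times\mathbb R^d;\mathbb R^m)$, bounded in each strip $[s,T]\times\mathbb R^d$, with $D_t\mathbf u=\boldsymbol{\mathcal A}\mathbf u$ in $(s,+\infty)\times\mathbb R^d$ and $\mathbf u(s,\cdot)=\mathbf f$; one sets $\mathbf G(t,s)\mathbf f:=\mathbf u(t,\cdot)$, $t\ge s$. Similarly $G(t,s)$ is the scalar evolution operator in $C_b(\mathbb R^d)$ associated with $\tilde{\mathcal A}$: $G(\cdot,s)f$ is the unique classical solution, bounded in each strip $[s,T]\times\mathbb R^d$, of $D_tv=\tilde{\mathcal A}(t)v$ in $(s,+\infty)\times\mathbb R^d$, $v(s,\cdot)=f$. *)

(* Defs.v *)
From HB Require Import structures.
From mathcomp Require Import all_boot all_order all_algebra.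
From mathcomp Require Import all_classical all_reals all_analysis.
Import Order.TTheory GRing.Theory Num.Theory.
Import numFieldNormedType.Exports.

Set Implicit Arguments.
Unset Strict Implicit.
Unset Printing Implicit Defensive.

Local Open Scope classical_set_scope.
Local Open Scope ring_scope.

(* Points of R^d are row vectors, values in R^m are column vectors, so that
   m x m matrices act on the latter by [*m]. The library norm on matrices is
   the sup norm; wherever the Euclidean structure is meant, [dotmx] and
   [enorm] are used instead. *)

Section euclidean.
Context {R : realType}.

Definition dotmx k l (x y : 'M[R]_(k, l)) : R :=
  \sum_i \sum_j x i j * y i j.

Definition enorm k l (x : 'M[R]_(k, l)) : R := Num.sqrt (dotmx x x).

Definition eball d (r : R) : set 'rV[R]_d := [set x | enorm x < r].

Definition blows_up d (phi : 'rV[R]_d -> R) : Prop :=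
  forall M : R, \forall r \near +oo, forall x, r <= enorm x -> M <= phi x.

(* Only used for symmetric matrices of positive size, whose set of eigenvalues
   is finite and nonempty, so that the infimum is a minimum. *)
Definition min_eigenvalue d (A : 'M[R]_d) : R := inf [set a | eigenvalue A a].

Definition sup_quadratic_form m (A : 'M[R]_m) : R :=
  sup [set dotmx (A *m eta) eta | eta in [set eta : 'cV[R]_m | enorm eta = 1]].

End euclidean.

Section regularity.
Context {R : realType} {d : nat}.

Definition parabolic_holder_loc (alpha : R) (I : set R)
    (f : R -> 'rV[R]_d -> R) : Prop :=
  forall K : set (R * 'rV[R]_d), compact K -> K `<=` I `*` setT ->
  exists c : R, forall p q, K p -> K q ->
    `|f p.1 p.2 - f q.1 q.2| <=
      c * (`|p.1 - q.1| `^ (alpha / 2) + enorm (p.2 - q.2) `^ alpha).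

Definition locally_bounded (I : set R) (xi : R -> R) : Prop :=
  forall K, compact K -> K `<=` I -> [bounded xi t | t in K].

Context {V : normedModType R}.
Implicit Types (w : 'rV[R]_d -> V) (u : R -> 'rV[R]_d -> V).

Definition base (j : 'I_d) : 'rV[R]_d := delta_mx 0 j.

Definition partial (j : 'I_d) w : 'rV[R]_d -> V := fun x => 'D_(base j) w x.

Definition C2 w : Prop :=
  [/\ continuous w,
      forall j x, derivable w x (base j),
      forall j, continuous (partial j w),
      forall i j x, derivable (partial j w) x (base i) &
      forall i j, continuous (partial i (partial j w))].

Definition C12_after (s : R) u : Prop :=
  forall p : R * 'rV[R]_d, s < p.1 ->
  [/\ [/\ derivable (u^~ p.2) p.1 1,
          forall j, derivable (u p.1) p.2 (base j) &
          forall i j, derivable (partial j (u p.1)) p.2 (base i)],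
      {for p, continuous (fun q : R * 'rV[R]_d => u q.1 q.2)},
      {for p, continuous (fun q : R * 'rV[R]_d => derive1 (u^~ q.2) q.1)},
      forall j,
        {for p, continuous (fun q : R * 'rV[R]_d => partial j (u q.1) q.2)} &
      forall i j,
        {for p, continuous
          (fun q : R * 'rV[R]_d => partial i (partial j (u q.1)) q.2)}].

Definition Cb : set ('rV[R]_d -> V) :=
  [set w | continuous w /\ bounded_fun w].

End regularity.

Section cauchy.
Context {R : realType} {d : nat} {V : normedModType R}.
Variable A : R -> ('rV[R]_d -> V) -> 'rV[R]_d -> V.

Definition bounded_classical_solution (s : R) (f : 'rV[R]_d -> V)
    (u : R -> 'rV[R]_d -> V) : Prop :=
  [/\ C12_after s u,
      {within [set p : R * 'rV[R]_d | s <= p.1],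
        continuous (fun p : R * 'rV[R]_d => u p.1 p.2)},
      forall T, s < T ->
        [bounded u p.1 p.2 | p in [set p : R * 'rV[R]_d | s <= p.1 <= T]],
      forall t x, s < t -> derive1 (u^~ x) t = A t (u t) x &
      forall x, u s x = f x].

(* [G t s f] is only constrained for s in I, s <= t and f in C_b. *)
Definition evolution_operator (I : set R)
    (G : R -> R -> ('rV[R]_d -> V) -> 'rV[R]_d -> V) : Prop :=
  forall s f, I s -> Cb f -> bounded_classical_solution s f (fun t => G t s f).

End cauchy.

(* C_b is closed in the space of all functions with the topology of uniform
   convergence, which induces on it the topology of the sup norm; hence being
   precompact in that space is the same as being precompact in C_b. *)
Definition compact_operator {R : realType} {d : nat} {V : normedModType R}
    (T : ('rV[R]_d -> V) -> 'rV[R]_d -> V) : Prop :=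
  (forall f, Cb f -> Cb (T f)) /\
  forall F : set ('rV[R]_d -> V), F `<=` Cb ->
    (exists M : R, forall f x, F f -> `|f x| <= M) ->
    precompact (T @` F : set {uniform 'rV[R]_d -> V}).

Section operators.
Context {R : realType} {d m : nat}.
Variables (I : set R) (alpha : R).
Variables (Q : R -> 'rV[R]_d -> 'M[R]_d).
Variables (B : 'I_d -> R -> 'rV[R]_d -> 'M[R]_m).
Variables (C : R -> 'rV[R]_d -> 'M[R]_m).
Variables (b : 'I_d -> R -> 'rV[R]_d -> R).
Variables (Bt : 'I_d -> R -> 'rV[R]_d -> 'M[R]_m).
Variables (xi : R -> R) (sigma : R).

Definition lambdaQ (t : R) (x : 'rV[R]_d) : R := min_eigenvalue (Q t x).

Definition LambdaC (t : R) (x : 'rV[R]_d) : R := sup_quadratic_form (C t x).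

Definition system_operator (t : R) (w : 'rV[R]_d -> 'cV[R]_m)
    (x : 'rV[R]_d) : 'cV[R]_m :=
  \sum_i \sum_j Q t x i j *: partial i (partial j w) x
  + \sum_j B j t x *m partial j w x + C t x *m w x.

Definition scalar_operator (t : R) (w : 'rV[R]_d -> R) (x : 'rV[R]_d) : R :=
  \tr (Q t x *m \matrix_(i, j) partial i (partial j w) x)
  + \sum_j b j t x * partial j w x.

Definition standing_assumption : Prop :=
  [/\ forall t x, I t -> (Q t x)^T = Q t x,
      forall i j, parabolic_holder_loc alpha I (fun t x => Q t x i j),
      forall i h k, parabolic_holder_loc alpha I (fun t x => B i t x h k),
      forall h k, parabolic_holder_loc alpha I (fun t x => C t x h k) &
      (0 < ereal_inf
             [set (lambdaQ p.1 p.2)%:E | p in I `*` [set: 'rV[R]_d]])%E].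

Definition assumptionB_drift : Prop :=
  [/\ forall i, parabolic_holder_loc alpha I (b i),
      forall i j k, parabolic_holder_loc alpha I (fun t x => Bt i t x j k),
      forall i t x, I t -> B i t x = (b i t x)%:M + Bt i t x,
      (forall t, I t -> 0 < xi t) /\ locally_bounded I xi &
      0 < sigma < 1 /\
      forall i j k t x, I t -> `|Bt i t x j k| <= xi t * lambdaQ t x `^ sigma].

Definition assumptionB_potential : Prop :=
  forall J : set R, is_interval J -> bounded_set J -> J `<=` I ->
  (ereal_sup
     [set (LambdaC p.1 p.2
           + 4^-1 * m%:R ^+ 2 * d%:R * xi p.1 ^+ 2
             * lambdaQ p.1 p.2 `^ (2 * sigma - 1))%:E
     | p in J `*` [set: 'rV[R]_d]] < +oo)%E.

Definition assumptionB_lyapunov : Prop :=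
  forall J : set R, is_interval J -> bounded_set J -> J `<=` I ->
  exists (mu : R) (phi : 'rV[R]_d -> R),
    [/\ C2 phi, forall x, 0 < phi x, blows_up phi &
        (ereal_sup
           [set (scalar_operator p.1 phi p.2 - mu * phi p.2)%:E
           | p in J `*` [set: 'rV[R]_d]] < +oo)%E].

Definition assumptionB : Prop :=
  [/\ assumptionB_drift, assumptionB_potential & assumptionB_lyapunov].

(* The condition [g y != 0] is what makes 1/g meaningful: in MathComp
   0^-1 = 0, so that without it g = 0 would be admitted. *)
Definition lyapunov_superlinear (W : 'rV[R]_d -> R) (r : R) (g : R -> R) :
    Prop :=
  [/\ C2 W /\ blows_up W,
      convex_function (E := R^o) `[0, +oo[ g /\
      {in `[0, +oo[ &, {homo g : x y / x <= y}},
      \forall a \near +oo,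
        (forall y, a < y -> g y != 0) /\
        lebesgue_measure.-integrable `]a, +oo[ (fun y => ((g y)^-1)%:E) &
      forall t x, I t -> ~ eball r x -> scalar_operator t W x <= - g (W x)].

End operators.

Definition open_right_halfline_or_line {R : realType} (I : set R) : Prop :=
  (exists a : R, I = `]a, +oo[%classic) \/ I = setT.

(* Main.v *)
Require Import Defs.
From mathcomp Require Import all_boot all_order all_algebra.
From mathcomp Require Import all_classical all_reals all_analysis.
From mathcomp Require Import ring lra.
Import Order.TTheory GRing.Theory Num.Theory.
Import numFieldNormedType.Exports.
(* Again, so that [dotmx] is the Euclidean product of two real matrices. *)
Import Defs.

(** Why the statement holds. Let [u] solve the system. In the equation for
    [|u|^2] the diffusion leaves the term [- 2 \sum_ij Q_ij <D_i u, D_j u>], at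
    most [- 2 lambda_Q |Du|^2]; by Young's inequality it absorbs the coupling
    through [Bt] at the price of the zero order term that Assumption B bounds
    ([coupling_absorbed], [sqnorm_rhs_le]). So [|u|^2] is a subsolution of the
    scalar equation up to exponential growth, and the maximum principle, with
    the Lyapunov function controlling infinity, yields
    [|u(t)|^2 <= e^(2H(t - r)) G(t,r)|u(r)|^2]: [weak_maximum_principle],
    [sqnorm_comparison]. By linearity this applies to differences of solutions.

    Compactness of the scalar evolution acts through tightness ([tight]): the
    images under [G(t,r)] of the cutoffs of the complements of large balls are
    uniformly small. It follows from compactness because these images tend
    to 0 locally uniformly ([compact_tight]). Under the second set of
    hypotheses it is obtained from an explicit supersolution: composing [W]
    with a primitive of [1/g] gives a bounded, arbitrarily small function whose
    image under the elliptic operator is at most -1 far away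
    ([concave_potential], [lyapunov_tight]).

    The local ingredient is that the functions [GG(r,s) f], with [f] bounded by a
    given constant and [r > s], are equicontinuous on balls
    ([interior_modulus], [local_equicontinuity]). This is shown by doubling the
    variables: [|u(t,x) - u(t,x-z)|^2] is compared with [K |z|^(1/2)], and at a
    maximum of the difference the second order condition is tested along
    directions that couple the diffusions at [x] and [x - z] by reflection
    ([coupling_directions], [doubled_hessian_test]). The coupling makes the
    concavity of the barrier count, with a sign that beats all bounded terms,
    and it is coercive enough to absorb the gradients.

    To conclude, choose [r] strictly between [s] and [t]
    ([tight_system_compact]). At time [r] finitely many solutions approximate
    all the others on a large ball; the comparison from [r] to [t] and tightness
    turn this into uniform approximation at time [t]. *)

Set Implicit Arguments.
Unset Strict Implicit.
Unset Printing Implicit Defensive.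

Local Open Scope classical_set_scope.
Local Open Scope ring_scope.

(** * Quadratic forms and Gram factorizations *)

Section quadratic_forms.
Context {R : realType}.

Definition qform n (A : 'I_n -> 'I_n -> R) (v : 'rV[R]_n) : R :=
  \sum_i \sum_j A i j * (v 0 i * v 0 j).

Lemma qformD n (A B : 'I_n -> 'I_n -> R) v :
  qform (fun i j => A i j + B i j) v = qform A v + qform B v.
Proof.
rewrite /qform -big_split; apply: eq_bigr => i _.
by rewrite -big_split; apply: eq_bigr => j _ /=; rewrite mulrDl.
Qed.

Lemma qformZ n c (A : 'I_n -> 'I_n -> R) v :
  qform (fun i j => c * A i j) v = c * qform A v.
Proof.
rewrite /qform mulr_sumr; apply: eq_bigr => i _.
by rewrite mulr_sumr; apply: eq_bigr => j _; rewrite [RHS]mulrA.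
Qed.

Lemma qform_recl n (A : 'I_n.+1 -> 'I_n.+1 -> R) (v : 'rV[R]_n.+1) :
  (forall i j, A i j = A j i) ->
  qform A v = A 0 0 * v 0 0 ^+ 2
    + v 0 0 * (\sum_j A 0 (lift ord0 j) * v 0 (lift ord0 j)) *+ 2
    + qform (fun i j => A (lift ord0 i) (lift ord0 j))
        (\row_j v 0 (lift ord0 j)).
Proof.
move=> Asym; rewrite /qform big_ord_recl big_ord_recl.
under [X in _ + X = _]eq_bigr do rewrite big_ord_recl.
rewrite big_split /= mulr2n mulr_sumr.
have -> : \sum_(i < n) A ord0 (lift ord0 i) * (v 0 ord0 * v 0 (lift ord0 i))
  = \sum_(i < n) v 0 0 * (A 0 (lift ord0 i) * v 0 (lift ord0 i)).
  by apply: eq_bigr => i _; rewrite mulrCA.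
have -> : \sum_(i < n) A (lift ord0 i) ord0 * (v 0 (lift ord0 i) * v 0 ord0)
  = \sum_(i < n) v 0 0 * (A 0 (lift ord0 i) * v 0 (lift ord0 i)).
  by apply: eq_bigr => i _; rewrite Asym mulrA mulrC.
rewrite !addrA expr2; congr (_ + _ + _ + _).
by apply: eq_bigr => i _; apply: eq_bigr => j _; rewrite !mxE.
Qed.

Definition psd n (A : 'I_n -> 'I_n -> R) :=
  (forall i j, A i j = A j i) /\ forall v, 0 <= qform A v.

(** Cholesky factorization by induction on the size: the Schur complement of
    the first diagonal entry is again positive semidefinite. The trace of a
    product [A X] thereby becomes a sum of values of the form [X] along the
    directions [P k], which is how second derivatives at a maximum are
    exploited. *)
Lemma psd_gram n (A : 'I_n -> 'I_n -> R) : psd A ->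
  exists P : 'I_n -> 'rV[R]_n, forall i j, A i j = \sum_k P k 0 i * P k 0 j.
Proof.
elim: n A => [|n IHn] A [Asym Apos].
  by exists (fun _ => 0) => -[].
pose a := A 0 0; pose u j := A 0 (lift ord0 j).
pose A' i j := A (lift ord0 i) (lift ord0 j) : R.
pose ext x (w : 'rV[R]_n) : 'rV[R]_n.+1 :=
  \row_j (if unlift ord0 j is Some k then w 0 k else x).
have ext0 x w : ext x w 0 0 = x by rewrite mxE unlift_none.
have extS x w j : ext x w 0 (lift ord0 j) = w 0 j by rewrite mxE liftK.
have qext x w : qform A (ext x w) =
    a * x ^+ 2 + x * (\sum_j u j * w 0 j) *+ 2 + qform A' w.
  rewrite qform_recl // ext0.
  under eq_bigr do rewrite extS.
  congr (_ + _); apply: eq_bigr => i _; apply: eq_bigr => j _.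
  by rewrite !mxE !liftK.
have a_ge0 : 0 <= a.
  have := Apos (ext 1 0); rewrite qext big1 => [|j _]; last by rewrite mxE mulr0.
  rewrite {1}/qform big1 ?addr0 ?mulr0 ?mul0rn ?addr0 ?expr1n ?mulr1 //.
  by move=> i _; rewrite big1// => j _; rewrite mxE mul0r mulr0.
(* A vanishing pivot has a vanishing row: otherwise the form would equal -1 at
   the point below. With the convention 0^-1 = 0 this case then needs no
   separate treatment in the definition of the factor. *)
have u0 : a = 0 -> forall j, u j = 0.
  move=> a0 j; apply/eqP/negPn/negP => uj0.
  pose w : 'rV[R]_n := delta_mx 0 j.
  have := Apos (ext (- (qform A' w + 1) / (2 * u j)) w).
  rewrite qext a0 mul0r add0r.
  rewrite (bigD1 j)//= big1 => [|k kj]; last by rewrite mxE (negbTE kj) andbF mulr0.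
  rewrite mxE !eqxx mulr1 addr0 -mulr_natr.
  have -> : - (qform A' w + 1) / (2 * u j) * u j * 2 = - (qform A' w + 1) by field.
  lra.
pose B i j := A' i j - u i * u j / a.
(* [qform B w] is the minimum of [qform A (ext x w)] over [x], attained at
   x = - S / a with S = \sum_j u j * w 0 j. *)
have Bpsd : psd B.
  split=> [i j|w]; first by rewrite /B /A' Asym [u i * _]mulrC.
  have qB : qform B w = qform A' w - (\sum_j u j * w 0 j) ^+ 2 / a.
    rewrite (_ : qform B w = qform (fun i j => A' i j + (- a^-1) * (u i * u j)) w).
      rewrite qformD qformZ mulNr; congr (_ - _); rewrite mulrC; congr (_ * _).
      rewrite expr2 mulr_suml; apply: eq_bigr => i _.
      by rewrite mulr_sumr; apply: eq_bigr => j _; ring.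
    by apply: eq_bigr => i _; apply: eq_bigr => j _; rewrite /B; ring.
  rewrite qB; have [a0|a0] := eqVneq a 0.
    rewrite a0 invr0 mulr0 subr0.
    have := Apos (ext 0 w); rewrite qext; lra.
  have := Apos (ext (- (\sum_j u j * w 0 j) / a) w); rewrite qext.
  set S := \sum_j _.
  suff -> : a * (- S / a) ^+ 2 + - S / a * S *+ 2 + qform A' w =
    qform A' w - S ^+ 2 / a by [].
  by rewrite -mulr_natr; field.
have [P PE] := IHn _ Bpsd.
have sa : Num.sqrt a * Num.sqrt a = a by rewrite -expr2 sqr_sqrtr.
pose r0 : 'rV[R]_n.+1 := ext (Num.sqrt a) (\row_j (u j / Num.sqrt a)).
exists (fun k => if unlift ord0 k is Some k' then ext 0 (P k') else r0) => i j.
rewrite big_ord_recl unlift_none.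
under eq_bigr do rewrite liftK.
have uE k : u k / Num.sqrt a * Num.sqrt a = u k.
  have [a0|a0] := eqVneq a 0; first by rewrite u0// !mul0r.
  rewrite divfK// sqrtr_eq0 -ltNge lt_neqAle a_ge0 eq_sym a0//.
case: (unliftP ord0 i) => [i'|] ->; case: (unliftP ord0 j) => [j'|] ->.
- rewrite /r0 !extS !mxE.
  under eq_bigr do rewrite !extS.
  rewrite -PE /B /A'.
  rewrite mulrACA -invfM sa; ring.
- rewrite /r0 extS ext0 mxE uE big1 ?addr0 1?Asym// => k _.
  by rewrite ext0 mulr0.
- rewrite /r0 extS ext0 mxE mulrC uE big1 ?addr0// => k _.
  by rewrite ext0 mul0r.
- by rewrite /r0 ext0 sa big1 ?addr0// => k _; rewrite ext0 mul0r.
Qed.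

Lemma gram_sum n l (A X : 'I_n -> 'I_n -> R) (P : 'I_l -> 'rV[R]_n) :
  (forall i j, A i j = \sum_k P k 0 i * P k 0 j) ->
  \sum_i \sum_j A i j * X i j = \sum_k qform X (P k).
Proof.
move=> AE; rewrite /qform exchange_big /=.
under eq_bigr => i _.
  under eq_bigr => j _ do rewrite AE mulr_suml.
  rewrite exchange_big /=; over.
rewrite exchange_big /=; apply: eq_bigr => k _.
rewrite exchange_big; apply: eq_bigr => i _; apply: eq_bigr => j _.
by rewrite mulrC.
Qed.

Lemma psd_nsd_sum_le0 n (A X : 'I_n -> 'I_n -> R) : psd A ->
  (forall v, qform X v <= 0) -> \sum_i \sum_j A i j * X i j <= 0.
Proof.
move=> /psd_gram[P AE] X0; rewrite (gram_sum _ AE).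
by rewrite -oppr_ge0 -sumrN sumr_ge0// => k _; rewrite oppr_ge0.
Qed.

End quadratic_forms.

(** * Euclidean geometry and extremal eigenvalues *)

Section euclidean_facts.
Context {R : realType}.

Lemma dotmxC k l (x y : 'M[R]_(k, l)) : dotmx x y = dotmx y x.
Proof. by apply: eq_bigr => i _; apply: eq_bigr => j _; rewrite mulrC. Qed.

Lemma dotmxDl k l (x y z : 'M[R]_(k, l)) :
  dotmx (x + y) z = dotmx x z + dotmx y z.
Proof.
rewrite /dotmx -big_split; apply: eq_bigr => i _.
by rewrite -big_split; apply: eq_bigr => j _; rewrite mxE mulrDl.
Qed.

Lemma dotmxZl k l a (x y : 'M[R]_(k, l)) : dotmx (a *: x) y = a * dotmx x y.
Proof.
rewrite /dotmx mulr_sumr; apply: eq_bigr => i _.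
by rewrite mulr_sumr; apply: eq_bigr => j _; rewrite mxE mulrA.
Qed.

Lemma dotmxDr k l (x y z : 'M[R]_(k, l)) :
  dotmx z (x + y) = dotmx z x + dotmx z y.
Proof. by rewrite dotmxC dotmxDl dotmxC [dotmx y z]dotmxC. Qed.

Lemma dotmxZr k l a (x y : 'M[R]_(k, l)) : dotmx y (a *: x) = a * dotmx y x.
Proof. by rewrite dotmxC dotmxZl dotmxC. Qed.

Lemma dotmxNl k l (x y : 'M[R]_(k, l)) : dotmx (- x) y = - dotmx x y.
Proof. by rewrite -scaleN1r dotmxZl mulN1r. Qed.

Lemma dotmxNr k l (x y : 'M[R]_(k, l)) : dotmx x (- y) = - dotmx x y.
Proof. by rewrite dotmxC dotmxNl dotmxC. Qed.

Lemma dotmx_row n (x y : 'rV[R]_n) : dotmx x y = \sum_j x 0 j * y 0 j.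
Proof. by rewrite /dotmx big_ord1. Qed.

Lemma dotmx_col n (x y : 'cV[R]_n) : dotmx x y = \sum_i x i 0 * y i 0.
Proof. by rewrite /dotmx; apply: eq_bigr => i _; rewrite big_ord1. Qed.

Lemma dotmx_ge0 k l (x : 'M[R]_(k, l)) : 0 <= dotmx x x.
Proof.
by apply: sumr_ge0 => i _; apply: sumr_ge0 => j _; rewrite -expr2 sqr_ge0.
Qed.

Lemma enorm_ge0 k l (x : 'M[R]_(k, l)) : 0 <= enorm x.
Proof. exact: sqrtr_ge0. Qed.

Lemma sqr_enorm k l (x : 'M[R]_(k, l)) : enorm x ^+ 2 = dotmx x x.
Proof. by rewrite sqr_sqrtr// dotmx_ge0. Qed.

Lemma enormZ k l a (x : 'M[R]_(k, l)) : enorm (a *: x) = `|a| * enorm x.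
Proof. by rewrite /enorm dotmxZl dotmxZr mulrA -expr2 sqrtrM ?sqr_ge0// sqrtr_sqr. Qed.

Lemma sqr_entry_le k l (x : 'M[R]_(k, l)) i j : x i j ^+ 2 <= dotmx x x.
Proof.
rewrite /dotmx (bigD1 i)//= (bigD1 j)//= -expr2 -addrA lerDl.
rewrite addr_ge0// ?sumr_ge0// => a _; first by rewrite -expr2 sqr_ge0.
by apply: sumr_ge0 => c _; rewrite -expr2 sqr_ge0.
Qed.

Lemma entry_le_enorm k l (x : 'M[R]_(k, l)) i j : `|x i j| <= enorm x.
Proof. by rewrite -sqrtr_sqr ler_wsqrtr// sqr_entry_le. Qed.

Lemma dotmx_eq0 k l (x : 'M[R]_(k, l)) : (dotmx x x == 0) = (x == 0).
Proof.
apply/eqP/eqP => [x0|->]; last first.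
  by rewrite /dotmx big1// => i _; rewrite big1// => j _; rewrite mxE mul0r.
apply/matrixP => i j; rewrite mxE; apply/eqP; rewrite -sqrf_eq0.
by apply/eqP/le_anti; rewrite sqr_ge0 -x0 sqr_entry_le.
Qed.

Lemma mx_norm_le k l (x : 'M[R]_(k, l)) (a : R) : 0 <= a ->
  (forall i j, `|x i j| <= a) -> `|x| <= a.
Proof.
move=> a0 xa; rewrite /Num.Def.normr/= mx_normrE.
by apply: bigmax_le => // -[i j] _; exact: xa.
Qed.

Lemma norm_le_enorm k l (x : 'M[R]_(k, l)) : `|x| <= enorm x.
Proof. by apply: mx_norm_le => [|i j]; [exact: enorm_ge0|exact: entry_le_enorm]. Qed.

Lemma entry_le_norm k l (x : 'M[R]_(k, l)) i j : `|x i j| <= `|x|.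
Proof.
rewrite [leRHS]/Num.Def.normr/= mx_normrE.
exact: (le_bigmax _ (fun i : 'I_k * 'I_l => `|x i.1 i.2|) (i, j)).
Qed.

Lemma dotmx_le_norm k l (x : 'M[R]_(k, l)) :
  dotmx x x <= (k * l)%:R * `|x| ^+ 2.
Proof.
have H i j : x i j * x i j <= `|x| ^+ 2.
  rewrite -expr2 -[leLHS]ger0_norm ?sqr_ge0// normrX.
  by rewrite lerXn2r ?nnegrE// entry_le_norm.
apply: (@le_trans _ _ (\sum_(i < k) \sum_(j < l) `|x| ^+ 2)).
  by apply: ler_sum => i _; apply: ler_sum => j _.
by rewrite !sumr_const !card_ord -mulrnA mulr_natl mulnC.
Qed.

Lemma cvg_sumr (T : Type) (F : set_system T) {FF : Filter F} n
    (f : 'I_n -> T -> R) (l : 'I_n -> R) :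
  (forall i, f i x @[x --> F] --> l i) ->
  \sum_(i < n) f i x @[x --> F] --> \sum_(i < n) l i.
Proof. by move=> fl; apply: cvg_big => //; exact: add_continuous. Qed.

Lemma dotmx00 k l : dotmx (0 : 'M[R]_(k, l)) 0 = 0.
Proof. by apply/eqP; rewrite dotmx_eq0. Qed.

Lemma continuous_dotmx k l : continuous (fun x : 'M[R]_(k, l) => dotmx x x).
Proof.
move=> x; rewrite /dotmx.
apply: (@cvg_sumr _ (nbhs x)) => i.
apply: (@cvg_sumr _ (nbhs x)) => j.
by apply: cvgM; exact: coord_continuous.
Qed.

Lemma continuous_enorm k l : continuous (fun x : 'M[R]_(k, l) => enorm x).
Proof.
by move=> x; apply: (@continuous_comp _ _ _ (fun y : 'M[R]_(k, l) => dotmx y y) Num.sqrt); [exact: continuous_dotmx|exact: sqrt_continuous].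
Qed.

Lemma compact_sphere n : compact [set x : 'rV[R]_n | dotmx x x = 1].
Proof.
apply: bounded_closed_compact.
  exists 1; split=> // M M1 x /= x1; apply: (le_trans (norm_le_enorm x)).
  by rewrite /enorm x1 sqrtr1 ltW.
have := (continuous_closedP _).1 (@continuous_dotmx 1 n) _ (@closed_eq R 1).
by [].
Qed.

Lemma qformE n (A : 'M[R]_n) v : qform A v = dotmx (v *m A) v.
Proof.
rewrite dotmx_row /qform exchange_big; apply: eq_bigr => j _.
by rewrite mxE mulr_suml; apply: eq_bigr => i _; rewrite mulrCA mulrA.
Qed.

Lemma continuous_qform n (A : 'I_n -> 'I_n -> R) : continuous (qform A).
Proof.
move=> x; rewrite /qform.
apply: (@cvg_sumr _ (nbhs x)) => i.
apply: (@cvg_sumr _ (nbhs x)) => j.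
by apply: cvgM; [exact: cvg_cst|apply: cvgM; exact: coord_continuous].
Qed.

Lemma qform_scale n (A : 'I_n -> 'I_n -> R) a v : qform A (a *: v) = a ^+ 2 * qform A v.
Proof.
rewrite /qform mulr_sumr; apply: eq_bigr => i _; rewrite mulr_sumr.
by apply: eq_bigr => j _; rewrite !mxE; ring.
Qed.

(** The Rayleigh quotient attains its minimum on the unit sphere, and a
    minimizer is an eigenvector. *)
Lemma min_eigenvalue_le_qform n (A : 'M[R]_n) v : A^T = A ->
  min_eigenvalue A * dotmx v v <= qform A v.
Proof.
move=> Asym; have [->|v0] := eqVneq v 0.
  by rewrite dotmx00 mulr0 qformE dotmxC mul0mx dotmx00.
have dv (w : 'rV[R]_n) : w != 0 -> 0 < dotmx w w.
  by move=> w0; rewrite lt_neqAle eq_sym dotmx_eq0 w0 dotmx_ge0.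
have nrm (w : 'rV[R]_n) : w != 0 -> dotmx ((enorm w)^-1 *: w) ((enorm w)^-1 *: w) = 1.
  move=> w0; rewrite dotmxZl dotmxZr mulrA -invfM -expr2 sqr_enorm mulVf//.
  by rewrite dotmx_eq0.
have [//||e /set_mem e1 mine] :=
    @EVT_min_rV R n (qform A) _ _ (@compact_sphere n).
- by exists ((enorm v)^-1 *: v); exact: nrm.
- by apply: continuous_subspaceT; exact: continuous_qform.
set l := qform A e in mine.
have lmin w : l * dotmx w w <= qform A w.
  have [->|w0] := eqVneq w 0.
    by rewrite dotmx00 mulr0 qformE mul0mx dotmx00.
  have := mine _ (mem_set (nrm _ w0)).
  rewrite qform_scale exprVn sqr_enorm mulrC.
  by rewrite ler_pdivlMr// dv.
suff -> : min_eigenvalue A = l by [].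
have Ael : e *m A = l *: e.
  apply/eqP; rewrite -subr_eq0 -dotmx_eq0; apply/eqP.
  have [w wE] : exists w, w = e *m A - l *: e by exists (e *m A - l *: e).
  rewrite -wE.
  have symA (x y : 'rV[R]_n) : dotmx (x *m A) y = dotmx (y *m A) x.
    rewrite !dotmx_row; under eq_bigr do rewrite mxE mulr_suml.
    under [RHS]eq_bigr do rewrite mxE mulr_suml.
    rewrite exchange_big; apply: eq_bigr => i _; apply: eq_bigr => j _.
    by rewrite -{1}Asym mxE; ring.
  pose D := qform A w - l * dotmx w w.
  have ww : dotmx w w = dotmx (w *m A) e - l * dotmx w e.
    rewrite {2}wE dotmxDr dotmxNr dotmxZr; congr (_ - _).
    by rewrite dotmxC symA.
  (* [w] is half the gradient at [e] of [qform A v - l |v|^2], which is minimal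
     there; were it nonzero, a short step along [- w] would decrease it. *)
  have quad t : 0 <= t * dotmx w w *+ 2 + t ^+ 2 * D.
    have := lmin (e + t *: w).
    rewrite -subr_ge0 !qformE mulmxDl -scalemxAl !(dotmxDl, dotmxDr, dotmxZl, dotmxZr).
    rewrite e1 (dotmxC e w) (symA e w) -(qformE A w) -(qformE A e) -/l.
    by move=> /le_trans; apply; rewrite /D ww -mulr_natr; lra.
  apply/eqP/negPn/negP => w0.
  have {}w0 : 0 < dotmx w w by rewrite lt_neqAle eq_sym w0 dotmx_ge0.
  pose k := `|D| + 1.
  have k0 : 0 < k by rewrite ltr_wpDl.
  have := quad (- (dotmx w w / k)).
  rewrite leNgt => /negP; apply.
  have -> : - (dotmx w w / k) * dotmx w w *+ 2 + (- (dotmx w w / k)) ^+ 2 * D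
    = (dotmx w w / k) ^+ 2 * (D - 2 * k).
    by rewrite -mulr_natr; field; rewrite gt_eqF.
  rewrite pmulr_rlt0 ?exprn_gt0 ?divr_gt0// /k.
  have := ler_norm D; have := normr_ge0 D; lra.
have en0 : e != 0 by rewrite -dotmx_eq0 e1 oner_eq0.
rewrite /min_eigenvalue; apply/le_anti/andP; split.
  apply: ge_inf => /=.
    exists l => a /eigenvalueP[w wA w0].
    have := lmin w; rewrite qformE wA dotmxZl ler_pM2r// dv//.
  by apply/eigenvalueP; exists e.
apply: lb_le_inf; first by exists l; apply/eigenvalueP; exists e.
move=> a /eigenvalueP[w wA w0].
by have := lmin w; rewrite qformE wA dotmxZl ler_pM2r// dv.
Qed.

(** A supremum bounds the values only if these are bounded; on unit vectors
    they are at most the sum of the absolute values of the entries of [A]. *)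
Lemma sup_quadratic_formP n (A : 'M[R]_n) (v : 'cV[R]_n) :
  dotmx (A *m v) v <= sup_quadratic_form A * dotmx v v.
Proof.
have [->|v0] := eqVneq v 0.
  by rewrite dotmx00 mulr0 mulmx0 dotmx00.
have dv : 0 < dotmx v v by rewrite lt_neqAle eq_sym dotmx_eq0 v0 dotmx_ge0.
have ev : 0 < enorm v by rewrite sqrtr_gt0.
pose e := (enorm v)^-1 *: v.
have e1 : enorm e = 1.
  by rewrite enormZ ger0_norm ?invr_ge0 ?enorm_ge0// mulVf// gt_eqF.
rewrite -ler_pdivrMr//.
have -> : dotmx (A *m v) v / dotmx v v = dotmx (A *m e) e.
  by rewrite -scalemxAr dotmxZl dotmxZr -sqr_enorm; field; rewrite gt_eqF.
apply: ub_le_sup; last by exists e.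
exists (\sum_i \sum_j `|A i j|) => _ [w w1 <-].
rewrite dotmx_col; apply: ler_sum => i _; rewrite mxE mulr_suml; apply: ler_sum => j _.
apply: (le_trans (ler_norm _)); rewrite !normrM -mulrA ler_piMr// -[leRHS](mulr1 1).
by apply: ler_pM => //; rewrite (le_trans (entry_le_enorm _ _ _))// w1.
Qed.

End euclidean_facts.

(** * Second order jets in one variable *)

Section one_variable.
Context {R : realType}.

Lemma is_derive_quotient_lt (f : R -> R) (x c k : R) : is_derive x 1 f c -> c < k ->
  \forall h \near 0^', h^-1 * (f (h + x) - f x) < k.
Proof.
move=> [df dfE] ck.
have : h^-1 *: (f (h + x) - f x) @[h --> 0^'] --> c.
  rewrite -dfE; move: df; rewrite /derivable /derive /=.
  by under eq_fun do rewrite [_%:A]mulr1.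
by move=> /(cvgr_lt c); apply.
Qed.

(** The condition in the time variable at a maximum over a cylinder, which may
    lie on its top, so that only earlier times can be compared. *)
Lemma is_derive_left_max (f : R -> R) (x c : R) : is_derive x 1 f c ->
  (\forall t \near x, t <= x -> f t <= f x) -> 0 <= c.
Proof.
move=> df fmax; rewrite leNgt; apply/negP => c0.
have /nbhs_ballP[e /= e0 He] := is_derive_quotient_lt df c0.
move: fmax => /nbhs_ballP[r /= r0 Hr].
pose h := - (Num.min e r / 2).
have m0 : 0 < Num.min e r by rewrite lt_min e0 r0.
have h0 : h < 0 by rewrite oppr_lt0 divr_gt0.
have nh : `|h| < Num.min e r by rewrite ltr0_norm// opprK; lra.
have := He h; rewrite -ball_normE /= sub0r normrN => /(_ _ (ltr0_neq0 h0)).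
move: nh; rewrite lt_min => /andP[he hr] /(_ he); rewrite nmulr_rlt0 ?invr_lt0//.
rewrite subr_gt0 ltNge => /negP; apply; apply: Hr; rewrite /=; last by lra.
by change (`|x - (h + x)| < r); rewrite opprD addrCA subrr addr0 normrN.
Qed.

(** The derivative of [f] is only asked to exist near 0 and to be
    differentiable at 0: this is what the chain rule delivers for the functions
    below, which may be singular elsewhere. *)
Definition jet2 (f : R -> R) (f1 f2 : R) := exists g : R -> R,
  [/\ \forall t \near (0 : R), is_derive (t : R) 1 f (g t), g 0 = f1 & is_derive (0 : R) 1 g f2].

Lemma jet2_eq f f1 f2 f1' f2' : jet2 f f1 f2 -> f1 = f1' -> f2 = f2' -> jet2 f f1' f2'.
Proof. by move=> + <- <-. Qed.

Lemma jet2_cst c : jet2 (fun _ => c) 0 0.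
Proof.
exists (fun _ => 0); split=> //; last exact: is_derive_cst.
by near=> t; exact: is_derive_cst.
Unshelve. all: by end_near. Qed.

Lemma jet2D f g f1 f2 g1 g2 : jet2 f f1 f2 -> jet2 g g1 g2 ->
  jet2 (fun t => f t + g t) (f1 + g1) (f2 + g2).
Proof.
move=> [f' [f'E f'0 f''E]] [g' [g'E g'0 g''E]]; exists (fun t => f' t + g' t).
split; [|by rewrite f'0 g'0|exact: is_deriveD].
by near=> t; apply: is_deriveD; near: t.
Unshelve. all: by end_near. Qed.

Lemma jet2M f g f1 f2 g1 g2 : jet2 f f1 f2 -> jet2 g g1 g2 ->
  jet2 (fun t => f t * g t) (f 0 * g1 + g 0 * f1)
    (f 0 * g2 + g 0 * f2 + f1 * g1 *+ 2).
Proof.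
move=> [f' [f'E f'0 f''E]] [g' [g'E g'0 g''E]].
exists (fun t => f t * g' t + g t * f' t).
split; [|by rewrite f'0 g'0|].
  by near=> t; apply: is_deriveM; near: t.
have f0 := nbhs_singleton f'E; have g0 := nbhs_singleton g'E.
have := is_deriveD (is_deriveM f0 g''E) (is_deriveM g0 f''E).
move=> H; apply: is_derive_eq H _.
rewrite f'0 g'0 /= !/(_ *: _) /= mulr2n; ring.
Unshelve. all: by end_near. Qed.

Lemma jet2Z c f f1 f2 : jet2 f f1 f2 -> jet2 (fun t => c * f t) (c * f1) (c * f2).
Proof.
by move=> jf; apply: jet2_eq (jet2M (jet2_cst c) jf) _ _;
  rewrite ?mulr0 ?mul0r ?mul0rn ?addr0.
Qed.

Lemma jet2N f f1 f2 : jet2 f f1 f2 -> jet2 (fun t => - f t) (- f1) (- f2).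
Proof.
move=> /(jet2Z (-1)); rewrite !mulN1r => -[g [gE g0 gg]].
exists g; split=> //; apply: filterS gE => t.
by under [X in is_derive _ _ X]eq_fun do rewrite mulN1r.
Qed.

Lemma jet2B f g f1 f2 g1 g2 : jet2 f f1 f2 -> jet2 g g1 g2 ->
  jet2 (fun t => f t - g t) (f1 - g1) (f2 - g2).
Proof. by move=> jf /jet2N; exact: jet2D. Qed.

Lemma jet2_sum n (f : 'I_n -> R -> R) (f1 f2 : 'I_n -> R) :
  (forall i, jet2 (f i) (f1 i) (f2 i)) ->
  jet2 (fun t => \sum_i f i t) (\sum_i f1 i) (\sum_i f2 i).
Proof.
move=> jf; elim: n => [|n IH] in f f1 f2 jf *.
  rewrite !big_ord0; under [X in jet2 X]eq_fun do rewrite big_ord0.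
  exact: jet2_cst.
rewrite !big_ord_recl; under [X in jet2 X]eq_fun do rewrite big_ord_recl.
by apply: jet2D => //; exact: IH.
Qed.

Lemma jet2_affine a b : jet2 (fun t => a + t * b) b 0.
Proof.
exists (fun _ => b); split=> //; last exact: is_derive_cst.
near=> t.
apply: is_derive_eq (is_deriveD (is_derive_cst a t 1) (is_deriveM (is_derive_id t 1) (is_derive_cst b t 1))) _.
by rewrite scaler0 !add0r; exact: mulr1.
Unshelve. all: by end_near. Qed.

Lemma jet2_comp f F F' F2 f1 f2 : jet2 f f1 f2 ->
  (\forall y \near f 0, is_derive (y : R) 1 F (F' y)) -> is_derive (f 0) 1 F' F2 ->
  jet2 (fun t => F (f t)) (F' (f 0) * f1) (F' (f 0) * f2 + F2 * f1 ^+ 2).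
Proof.
move=> [f' [f'E f'0 f''E]] FE FFE.
exists (fun t => F' (f t) * f' t); have f0 := nbhs_singleton f'E.
have cf : {for 0, continuous f}.
  by apply/differentiable_continuous/derivable1_diffP; case: f0.
split; [|by rewrite f'0|].
  have {}FE := cf _ FE.
  near=> t; apply: is_derive1_comp; last by near: t.
  by near: t.
have := is_deriveM (is_derive1_comp FFE f0) f''E.
move=> H; apply: is_derive_eq H _; rewrite f'0 /= !/(_ *: _) /=; ring.
Unshelve. all: by end_near. Qed.

(** If the second derivative were positive, the first one would be positive
    just to the right of 0, against the mean value theorem. *)
Lemma jet2_max f f1 f2 : jet2 f f1 f2 ->
  (\forall t \near (0 : R), f t <= f 0) -> f1 = 0 /\ f2 <= 0.
Proof.
move=> [g [gE g0 gg]] fmax.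
have /nbhs_ballP[e /= e0 He] : nbhs (0 : R) (fun t => is_derive t 1 f (g t) /\ f t <= f 0) by exact: filterI gE fmax.
have Hin t : t \in `](-e), e[ -> is_derive t 1 f (g t) /\ f t <= f 0.
  move=> te; apply: He; rewrite -ball_normE /= sub0r normrN ltr_norml.
  by move: te; rewrite in_itv/=.
have zin : 0 \in `](-e), e[ by rewrite in_itv/= oppr_lt0 e0.
have d0 : is_derive (0 : R) 1 f 0.
  apply: (@derive1_at_max _ f (-e) e 0) => //; first lra.
    by move=> t /Hin[[]].
  by move=> t /Hin[].
have f10 : f1 = 0.
  by rewrite -g0; have [[_ <-] _] := Hin _ zin; case: d0.
split=> //; rewrite leNgt; apply/negP => f2_gt0.
have [_ /is_derive_quotient_lt] : True /\ is_derive (0 : R) 1 (fun t => - g t) (- f2).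
  by split=> //; exact: is_deriveN.
move=> /(_ 0); rewrite oppr_lt0 => /(_ f2_gt0) /nbhs_ballP[r /= r0 Hr].
pose h := Num.min e r / 2.
have m0 : 0 < Num.min e r by rewrite lt_min e0 r0.
have h0 : 0 < h by rewrite divr_gt0.
have nh : h < Num.min e r by rewrite /h; lra.
have hin t : t \in `[0, h] -> t \in `](-e), e[.
  by rewrite !in_itv/= => /andP[t0 th]; move: nh; rewrite lt_min => /andP[? ?]; lra.
have [t th||c + fE] := @MVT _ f g 0 h h0.
- by case: (Hin t) => //; apply: hin; exact: subset_itv_oo_cc.
- apply: derivable_within_continuous => t th.
  by case: (Hin t) => [|[]]//; apply: hin.
rewrite in_itv/= => /andP[c0 ch].
have := (Hin h (hin _ _)).2; rewrite in_itv/= lexx ltW// => /(_ isT).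
rewrite leNgt => /negP; apply; rewrite -subr_gt0 fE subr0 mulr_gt0//.
have := Hr c; rewrite -ball_normE /= sub0r normrN gtr0_norm// => /(_ _ (lt0r_neq0 c0)).
move: nh; rewrite lt_min => /andP[_ hr] /(_ (lt_trans ch hr)).
by rewrite g0 f10 addr0 opprK addr0 mulrN oppr_lt0 pmulr_rgt0// invr_gt0.
Qed.

Lemma is_derive_expR_shift (k s t : R) :
  is_derive (t : R) 1 (fun r => expR (k * (r - s))) (k * expR (k * (t - s))).
Proof.
have dl : is_derive (t : R) 1 (fun r => k * (r - s)) k.
  apply: is_derive_eq (is_deriveZ k (is_deriveB (is_derive_id t 1) (is_derive_cst s t 1))) _.
  by rewrite subr0; exact: mulr1.
have dE : is_derive (t : R) 1 (expR \o (fun r => k * (r - s))) (expR (k * (t - s)) * k).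
  exact: is_derive1_comp.
by apply: is_derive_eq dE _; rewrite mulrC.
Qed.

Lemma continuous_expR_shift (T : topologicalType) (k s : R) (f : T -> R) :
  continuous f -> continuous (fun y => expR (k * (f y - s))).
Proof.
move=> cf y; apply: (@continuous_comp _ _ _ (fun y => k * (f y - s)) expR); last exact: continuous_expR.
apply: cvgM; first exact: cvg_cst.
by apply: cvgB; [exact: cf|exact: cvg_cst].
Qed.

End one_variable.

(** * Second order jets in several variables *)

Section spatial_jets.
Context {R : realType} {n : nat}.
Implicit Types (f g : 'rV[R]_n -> R) (x v : 'rV[R]_n) (p q : 'I_n -> R) (X Y : 'I_n -> 'I_n -> R).

Definition lform p v : R := \sum_i p i * v 0 i.

(** A gradient [p] and a Hessian form [X], tested along lines: maxima are
    examined along one direction at a time, and the calculus of such jets is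
    that of functions of one variable. *)
Definition hasjet f x p X := forall v,
  jet2 (fun t => f (x + t *: v)) (lform p v) (qform X v).

Lemma lformD p q v : lform (fun i => p i + q i) v = lform p v + lform q v.
Proof. by rewrite /lform -big_split; apply: eq_bigr => i _; rewrite mulrDl. Qed.

Lemma lformZ c p v : lform (fun i => c * p i) v = c * lform p v.
Proof. by rewrite /lform mulr_sumr; apply: eq_bigr => i _; rewrite mulrA. Qed.

Lemma qform_lform p q v : qform (fun i j => p i * q j) v = lform p v * lform q v.
Proof.
rewrite /qform /lform mulr_suml; apply: eq_bigr => i _.
by rewrite mulr_sumr; apply: eq_bigr => j _; ring.
Qed.

Lemma hasjet_cst c x : hasjet (fun _ => c) x (fun _ => 0) (fun _ _ => 0).
Proof.
move=> v; apply: jet2_eq (jet2_cst c) _ _.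
  by rewrite /lform big1// => i _; rewrite mul0r.
by rewrite /qform big1// => i _; rewrite big1// => j _; rewrite mul0r.
Qed.

Lemma hasjetD f g x p q X Y : hasjet f x p X -> hasjet g x q Y ->
  hasjet (fun y => f y + g y) x (fun i => p i + q i) (fun i j => X i j + Y i j).
Proof.
by move=> jf jg v; apply: jet2_eq (jet2D (jf v) (jg v)) _ _;
  rewrite ?lformD ?qformD.
Qed.

Lemma hasjetZ c f x p X : hasjet f x p X ->
  hasjet (fun y => c * f y) x (fun i => c * p i) (fun i j => c * X i j).
Proof.
by move=> jf v; apply: jet2_eq (jet2Z c (jf v)) _ _; rewrite ?lformZ ?qformZ.
Qed.

Lemma hasjet_sqr f x p X : hasjet f x p X ->
  hasjet (fun y => f y ^+ 2) x (fun i => 2 * f x * p i)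
    (fun i j => 2 * f x * X i j + 2 * (p i * p j)).
Proof.
move=> jf v; have := jet2M (jf v) (jf v); rewrite !scale0r !addr0.
under eq_fun do rewrite -expr2.
move=> H; apply: jet2_eq H _ _; first by rewrite lformZ; ring.
by rewrite qformD !qformZ qform_lform; ring.
Qed.

Lemma hasjet_sum k (f : 'I_k -> 'rV[R]_n -> R) x (p : 'I_k -> 'I_n -> R)
    (X : 'I_k -> 'I_n -> 'I_n -> R) :
  (forall h, hasjet (f h) x (p h) (X h)) ->
  hasjet (fun y => \sum_h f h y) x (fun i => \sum_h p h i)
    (fun i j => \sum_h X h i j).
Proof.
move=> jf v; apply: jet2_eq (jet2_sum (fun h => jf h v)) _ _.
  rewrite /lform exchange_big; apply: eq_bigr => i _.
  by rewrite mulr_suml.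
rewrite /qform exchange_big; apply: eq_bigr => i _.
by rewrite exchange_big; apply: eq_bigr => j _; rewrite mulr_suml.
Qed.

Lemma hasjet_max f x p X : hasjet f x p X -> (\forall y \near x, f y <= f x) ->
  (forall i, p i = 0) /\ forall v, qform X v <= 0.
Proof.
move=> jf fmax.
have H v : lform p v = 0 /\ qform X v <= 0.
  apply: (jet2_max (jf v)); rewrite scale0r addr0.
  have : (x + t *: v) @[t --> (0 : R)] --> x.
    rewrite -[X in _ --> X]addr0 -(scale0r v).
    by apply: cvgD; [exact: cvg_cst|apply: cvgZr_tmp; exact: cvg_id].
  by move=> cv; exact: cv _ fmax.
split=> [i|v]; last by case: (H v).
have [+ _] := H (delta_mx 0 i); rewrite /lform (bigD1 i)//= mxE !eqxx mulr1.
rewrite big1 ?addr0// => j ji; by rewrite mxE (negbTE ji) andbF mulr0.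
Qed.

Lemma mvt_at (f' k : R -> R) (s : R) : (forall t, is_derive (t : R) 1 k (f' t)) ->
  exists2 c, `|c| <= `|s| & k s - k 0 = f' c * s.
Proof.
move=> dk.
have ck (A : set R) : {within A, continuous k}.
  apply: continuous_subspaceT => t.
  by apply/differentiable_continuous/derivable1_diffP; case: (dk t).
have [s0|s0] := leP 0 s.
  have [//|c + kE] := @MVT_segment _ k f' 0 s s0 (fun t _ => dk t).
  rewrite in_itv/= => /andP[c0 cs]; exists c; first by rewrite !ger0_norm.
  by rewrite kE subr0.
have [//|c + kE] := @MVT_segment _ k f' s 0 (ltW s0) (fun t _ => dk t).
rewrite in_itv/= => /andP[c0 cs]; exists c.
  by rewrite ler0_norm// ltr0_norm// lerN2.
by rewrite -opprB kE sub0r mulrN opprK.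
Qed.

Lemma is_derive_line f x v t a : is_derive (t *: v + x) v f a ->
  is_derive (t : R) 1 (fun s => f (s *: v + x)) a.
Proof.
have shiftE u : f ((u *: 1 + t) *: v + x) = f (u *: v + (t *: v + x)).
  by rewrite scalerDl addrA [u *: 1]mulr1.
move=> [d1 d2]; have {}d1 := (derivable1P _ _ _).1 d1.
split.
  apply/derivable1P; rewrite [X in derivable X](_ : _ = fun u => f (u *: v + (t *: v + x)))//.
  exact/funext.
rewrite -d2 /derive; under eq_fun do rewrite /= shiftE.
by [].
Qed.

(** Moving from [v] to [v + c e_j] costs one mean value estimate in the
    direction [e_j], where only the continuity of that partial derivative is
    used. *)
Lemma is_derive_add_base f x v a c j : is_derive x v f a ->
  (forall y, derivable f y (base j)) -> {for x, continuous (partial j f)} ->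
  is_derive x (v + c *: base j) f (a + c * partial j f x).
Proof.
move=> [df dfE] pf cpf.
suff H : h^-1 *: (f (h *: (v + c *: base j) + x) - f x) @[h --> (0 : R)^']
    --> a + c * partial j f x.
  by split; [apply/cvg_ex; exists (a + c * partial j f x)|exact/cvg_lim].
have H1 : h^-1 *: (f (h *: v + x) - f x) @[h --> (0 : R)^'] --> a.
  by rewrite -dfE; exact: df.
suff H2 : h^-1 *: (f (h *: (v + c *: base j) + x) - f (h *: v + x)) @[h --> (0 : R)^']
    --> c * partial j f x.
  apply: cvg_trans (cvgD H1 H2); apply: near_eq_cvg.
  near=> h; rewrite -[LHS]/(h^-1 *: (f (h *: v + x) - f x) + h^-1 *: (f (h *: (v + c *: base j) + x) - f (h *: v + x))).
  rewrite -scalerDr; congr (_ *: _).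
  by rewrite addrC addrA subrK.
apply/cvgrPdist_lt => e e0.
pose e' := e / (`|c| + 1).
have c1 : 0 < `|c| + 1 by rewrite ltr_wpDl.
have e'0 : 0 < e' by rewrite divr_gt0.
have /cvgrPdist_lt /(_ _ e'0) /nbhs_ballP[r /= r0 Hr] := cpf.
pose B := `|v| + `|c| * `|base j : 'rV[R]_n| + 1.
have B0 : 0 < B by rewrite ltr_wpDl// addr_ge0// mulr_ge0.
near=> h.
have h0 : h != 0 by near: h; exact: nbhs_dnbhs_neq.
have hr : `|h| < r / B.
  by near: h; apply: dnbhs0_lt; rewrite divr_gt0.
pose k t := f (t *: base j + (h *: v + x)).
have dk t : is_derive (t : R) 1 k (partial j f (t *: base j + (h *: v + x))).
  exact: is_derive_line (derivableP (pf _)).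
have [s sh kE] := mvt_at (h * c) dk.
have -> : f (h *: (v + c *: base j) + x) - f (h *: v + x) = k (h * c) - k 0.
  rewrite /k scale0r add0r; congr (f _ - _).
  by rewrite scalerDr scalerA addrAC addrC.
rewrite kE /(_ *: _)/=.
set y := s *: _ + _.
have -> : h^-1 * (partial j f y * (h * c)) = c * partial j f y by field.
rewrite -mulrBr normrM.
apply: (@le_lt_trans _ _ (`|c| * e')).
  rewrite ler_wpM2l// ltW//; apply: Hr; rewrite -ball_normE; change (`|x - y| < r).
  have -> : x - y = - (s *: base j + h *: v).
    by rewrite /y addrA opprD addrCA subrr addr0.
  rewrite normrN (le_lt_trans (ler_normD _ _))// !normrZ.
  apply: (@le_lt_trans _ _ (`|h| * B)); last by rewrite -ltr_pdivlMr.
  rewrite normrM in sh; rewrite /B !mulrDr mulr1 addrC -addrA lerD2l.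
  rewrite mulrA ler_wpDr// ler_wpM2r//.
rewrite /e' mulrCA gtr_pMr//; last by rewrite ltr_pdivrMr// mul1r ltrDl.
Unshelve. all: by end_near. Qed.

(** The coordinates of [v] are added one by one. *)
Lemma is_derive_partials f x v : (forall j y, derivable f y (base j)) ->
  (forall j, continuous (partial j f)) ->
  is_derive x v f (\sum_j v 0 j * partial j f x).
Proof.
move=> pf cpf; rewrite {1}(row_sum_delta v).
elim: (index_enum _) => [|j r IH]; first by rewrite !big_nil; exact: is_derive0.
rewrite !big_cons addrC [X in is_derive _ _ _ X]addrC.
by apply: is_derive_add_base => // y; exact: cpf.
Qed.

Lemma hasjet_C2 f x : C2 f ->
  hasjet f x (fun j => partial j f x) (fun i j => partial i (partial j f) x).
Proof.
move=> [cf df cdf ddf cddf] v.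
have d1 g y : (forall j z, derivable g z (base j)) -> (forall j, continuous (partial j g)) ->
    is_derive (y : R) 1 (fun t => g (x + t *: v)) (\sum_j v 0 j * partial j g (x + y *: v)).
  move=> dg cdg.
  have -> : (fun t => g (x + t *: v)) = (fun t => g (t *: v + x)).
    by apply/funext => t; rewrite addrC.
  by rewrite addrC; apply: is_derive_line; exact: is_derive_partials.
exists (fun t => \sum_j v 0 j * partial j f (x + t *: v)); split.
- by near=> t; exact: d1.
- by rewrite scale0r addr0; apply: eq_bigr => j _; rewrite mulrC.
- have H (j : 'I_n) : is_derive (0 : R) 1 (fun t => v 0 j * partial j f (x + t *: v))
      (v 0 j * \sum_i v 0 i * partial i (partial j f) (x + 0 *: v)).
    have := is_deriveZ (v 0 j) (d1 (partial j f) 0 (ddf ^~ j) (cddf ^~ j)).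
    by [].
  have := is_derive_sum H.
  rewrite scale0r addr0 => H2; apply: is_derive_eq.
    move: H2; congr (is_derive _ _ _ _).
    by apply/funext => t; rewrite fct_sumE.
  rewrite /qform exchange_big; apply: eq_bigr => j _; rewrite mulr_sumr.
  by apply: eq_bigr => i _; ring.
Unshelve. all: by end_near. Qed.

End spatial_jets.

Section coordinates.
Context {R : realType} {d m : nat}.
Implicit Types (w : 'rV[R]_d -> 'cV[R]_m) (u : R -> 'rV[R]_d -> 'cV[R]_m).

Lemma partial_coord w j i x : derivable w x (base j) ->
  partial j (fun y => w y i 0) x = partial j w x i 0.
Proof. by move=> dw; rewrite /partial derive_mx// mxE. Qed.

Lemma C2_coord w i : C2 w ->
  [/\ C2 (fun y => w y i 0),
      forall j x, partial j (fun y => w y i 0) x = partial j w x i 0 &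
      forall j k x, partial j (partial k (fun y => w y i 0)) x = partial j (partial k w) x i 0].
Proof.
move=> [cw dw cdw ddw cddw].
have p1 j x : partial j (fun y => w y i 0) x = partial j w x i 0 by rewrite partial_coord.
have p1f j : partial j (fun y => w y i 0) = (fun x => partial j w x i 0) by apply/funext => x.
have p2 j k x : partial j (partial k (fun y => w y i 0)) x = partial j (partial k w) x i 0.
  by rewrite p1f partial_coord.
have cc (g : 'rV[R]_d -> 'cV[R]_m) : continuous g -> continuous (fun x => g x i 0).
  move=> cg x; apply: (@continuous_comp _ _ _ g (fun y : 'cV[R]_m => y i 0)); first exact: cg.
  exact: coord_continuous.
split=> //; split=> //.
- exact: cc cw.
- by move=> j x; exact: (derivable_mxP _ _ _).1 (dw j x) i 0.
- by move=> j; rewrite p1f; exact: cc (cdw j).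
- by move=> j k x; rewrite p1f; exact: (derivable_mxP _ _ _).1 (ddw j k x) i 0.
- move=> j k; have -> : partial j (partial k (fun y => w y i 0)) = (fun x => partial j (partial k w) x i 0).
    by apply/funext => x.
  exact: cc (cddw j k).
Qed.

End coordinates.

Section slices.
Context {R : realType} {d : nat} {V : normedModType R}.
Implicit Types (u : R -> 'rV[R]_d -> V).

Lemma continuous_slice (g : R * 'rV[R]_d -> V) t x :
  {for (t, x), continuous g} -> {for x, continuous (fun y => g (t, y))}.
Proof.
have tx : (t, y) @[y --> x] --> (t, x).
  by apply: (@cvg_pair _ _ _ (nbhs x) (nbhs t) (nbhs x) _ _ _ (fun=> t) id); [exact: cvg_cst|exact: cvg_id].
by move=> cg; exact: (continuous_comp tx cg).
Qed.

Lemma C12_after_C2 s u t : C12_after s u -> s < t -> C2 (u t).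
Proof.
move=> Cu st; split.
- by move=> x; have [_ c _ _ _] := Cu (t, x) st; exact: continuous_slice c.
- by move=> j x; have [[_ c _] _ _ _ _] := Cu (t, x) st; exact: c.
- by move=> j x; have [_ _ _ c _] := Cu (t, x) st; exact: continuous_slice (c j).
- by move=> i j x; have [[_ _ c] _ _ _ _] := Cu (t, x) st; exact: c.
- by move=> i j x; have [_ _ _ _ c] := Cu (t, x) st; exact: continuous_slice (c i j).
Qed.

Lemma C12_after_time s u t x : C12_after s u -> s < t ->
  is_derive t 1 (u^~ x) (derive1 (u^~ x) t).
Proof.
by move=> Cu st; have [[c _ _] _ _ _ _] := Cu (t, x) st; rewrite derive1E; exact: derivableP.
Qed.

End slices.

(** * The parabolic maximum principle with a Lyapunov function *)

Section maximum_principle.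
Context {R : realType} {d : nat}.
Variables (Q : R -> 'rV[R]_d -> 'M[R]_d) (b : 'I_d -> R -> 'rV[R]_d -> R).

Definition pairing n (A X : 'I_n -> 'I_n -> R) : R := \sum_i \sum_j A i j * X i j.

Lemma pairingD n (A X Y : 'I_n -> 'I_n -> R) :
  pairing A (fun i j => X i j + Y i j) = pairing A X + pairing A Y.
Proof.
rewrite /pairing -big_split; apply: eq_bigr => i _; rewrite -big_split.
by apply: eq_bigr => j _ /=; rewrite mulrDr.
Qed.

Lemma pairingZ n c (A X : 'I_n -> 'I_n -> R) :
  pairing A (fun i j => c * X i j) = c * pairing A X.
Proof.
rewrite /pairing mulr_sumr; apply: eq_bigr => i _; rewrite mulr_sumr.
by apply: eq_bigr => j _; rewrite mulrCA.
Qed.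

Lemma scalar_operatorE t w x : (Q t x)^T = Q t x ->
  scalar_operator Q b t w x =
    pairing (Q t x) (fun i j => partial i (partial j w) x)
    + \sum_j b j t x * partial j w x.
Proof.
move=> Qsym; congr (_ + _); rewrite /mxtrace /pairing exchange_big.
apply: eq_bigr => i _; rewrite mxE; apply: eq_bigr => j _.
by rewrite mxE -{1}Qsym mxE.
Qed.

(** The inequality is strict, so that a maximum of [Theta - k e^(mu (t - s)) phi]
    is contradictory without further perturbation. *)
Definition strict_lyapunov s T mu (phi : 'rV[R]_d -> R) : Prop :=
  [/\ C2 phi, forall x, 0 < phi x, blows_up phi &
      forall t x, s < t <= T -> scalar_operator Q b t phi x < mu * phi x].

(** The inequality between time derivative and elliptic operator, read on test
    functions that touch [Theta] from below, one in time and one in space. A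
    maximum of [Theta - Phi] is then also one for the test functions. The
    supersolution built from a Lyapunov function by a concave change of
    variable with corners is covered by this form. *)
Definition subsolution_at (Theta : R -> 'rV[R]_d -> R) t x : Prop :=
  exists (chit : R -> R) (chix : 'rV[R]_d -> R) (c : R) (p : 'I_d -> R)
    (X : 'I_d -> 'I_d -> R),
  [/\ is_derive (t : R) 1 chit c /\
        (\forall r \near t, r <= t -> chit r - chit t <= Theta r x - Theta t x),
      hasjet chix x p X /\
        (\forall y \near x, chix y - chix x <= Theta t y - Theta t x) &
      c <= pairing (Q t x) X + \sum_j b j t x * p j].

Lemma subsolution_at_touch (Theta : R -> 'rV[R]_d -> R) (t : R) (x : 'rV[R]_d)
    (chit : R -> R) (chix : 'rV[R]_d -> R) c p X :
  is_derive (t : R) 1 chit c ->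
  (\forall r \near t, r <= t -> chit r - chit t <= Theta r x - Theta t x) ->
  hasjet chix x p X ->
  (\forall y \near x, chix y - chix x <= Theta t y - Theta t x) ->
  c <= pairing (Q t x) X + \sum_j b j t x * p j -> subsolution_at Theta t x.
Proof. by move=> dt tt jx xx cle; exists chit, chix, c, p, X. Qed.

Lemma subsolution_at_self (Theta : R -> 'rV[R]_d -> R) t x c p X :
  is_derive (t : R) 1 (Theta^~ x) c -> hasjet (Theta t) x p X ->
  c <= pairing (Q t x) X + \sum_j b j t x * p j -> subsolution_at Theta t x.
Proof.
move=> dt jx; apply: (subsolution_at_touch dt _ jx).
  by near=> r.
by near=> y.
Unshelve. all: by end_near. Qed.

Lemma compact_enorm_ball n rho : compact [set x : 'rV[R]_n | enorm x <= rho].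
Proof.
apply: bounded_closed_compact.
  exists rho; split; first exact: num_real.
  by move=> M M1 x /= x1; apply: (le_trans (norm_le_enorm x)); rewrite (le_trans x1)// ltW.
exact: (continuous_closedP _).1 (@continuous_enorm R 1 n) _ (@closed_le R rho).
Qed.

(** As [phi] blows up and [Theta] is bounded above, the set where
    [Theta] exceeds [k e^(mu (t - s)) phi] lies in a compact cylinder. If it were
    nonempty, the difference would have a maximum there, after the initial
    time, at which the first and second order conditions contradict the strict
    inequality for [phi]. *)
Lemma weak_maximum_principle (s T mu : R) phi (Theta : R -> 'rV[R]_d -> R)
    (M k : R) :
  (forall t x, s < t <= T -> (Q t x)^T = Q t x /\ psd (Q t x)) ->
  strict_lyapunov s T mu phi ->
  {within [set p : R * 'rV[R]_d | s <= p.1], continuous (fun p => Theta p.1 p.2)} ->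
  (forall t x, s <= t <= T -> Theta t x <= M) -> 0 < k ->
  (forall x, Theta s x <= k * phi x) ->
  (forall t x, s < t <= T -> 0 < Theta t x -> subsolution_at Theta t x) ->
  forall t x, s <= t <= T -> Theta t x <= k * expR (mu * (t - s)) * phi x.
Proof.
move=> Qpsd [phiC2 phi0 phioo Aphi] cTheta TM k0 Ts sub t1 x1 t1in.
rewrite leNgt; apply/negP => pos1.
have sT : s <= T by case/andP: t1in => /le_trans; apply.
pose E t := expR (mu * (t - s)).
pose Psi (p : R * 'rV[R]_d) := Theta p.1 p.2 - k * E p.1 * phi p.2.
(* A lower bound of [E] on [s, T], whatever the sign of [mu]. *)
pose c0 := expR (- `|mu| * (T - s)).
have c0E t : s <= t <= T -> c0 <= E t.
  move=> /andP[st tT]; rewrite /c0 /E ler_expR.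
  apply: (@le_trans _ _ (- `|mu| * (t - s))).
    by rewrite !mulNr lerN2 ler_wpM2l// lerB.
  by rewrite ler_wpM2r ?subr_ge0// lerNl ler_normr lexx orbT.
have [rho rhoP] : exists rho, forall x, rho <= enorm x -> M / (k * c0) <= phi x.
  by have /pinfty_ex_gt0[rho _] := phioo (M / (k * c0)); exists rho.
have inball t x : s <= t <= T -> 0 < Psi (t, x) -> enorm x < rho.
  move=> tin Psi0; rewrite ltNge; apply/negP => /rhoP phix; move: Psi0.
  rewrite subr_gt0 ltNge => /negP; apply; rewrite /= (le_trans (TM _ _ tin))//.
  have c00 : 0 < k * c0 by rewrite mulr_gt0// expR_gt0.
  apply: (@le_trans _ _ (k * c0 * phi x)); first by rewrite mulrC -ler_pdivrMr.
  by rewrite (ler_wpM2r (ltW (phi0 x)))// ler_pM2l// c0E.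
pose K := `[s, T]%classic `*` [set x : 'rV[R]_d | enorm x <= rho].
have cK : compact K by apply: compact_setX; [exact: segment_compact|exact: compact_enorm_ball].
have p1K : K (t1, x1).
  split; first by rewrite /= in_itv.
  by rewrite /= ltW// (inball t1)// subr_gt0.
have cPsi : {within K, continuous Psi}.
  have cT : {within K, continuous (fun p => Theta p.1 p.2)}.
    apply: continuous_subspaceW cTheta => -[t x] [] /=.
    by rewrite in_itv/= => /andP[].
  have cE : continuous (fun p : R * 'rV[R]_d => k * E p.1 * phi p.2).
    move=> p; apply: cvgM; last first.
      case: phiC2 => cphi _ _ _ _; apply: (@continuous_comp _ _ _ (@snd R 'rV[R]_d) phi); [exact: cvg_snd|exact: cphi].
    apply: cvgM; first exact: cvg_cst.
    by apply: (@continuous_expR_shift _ _ mu s fst) => q; exact: cvg_fst.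
  have cE' := continuous_subspaceT (A := K) cE.
  by move=> p; apply: cvgB; [exact: cT|exact: cE'].
have [[t x] /set_mem [/= tin xrho] pmax] :=
  compact_EVT_max (ex_intro _ _ p1K) cK cPsi.
rewrite in_itv/= in tin.
have Psi0 : 0 < Psi (t, x).
  apply: lt_le_trans (pmax _ (mem_set p1K)); by rewrite subr_gt0.
have Psi_le r y : s <= r <= T -> Psi (r, y) <= Psi (t, x).
  move=> rin; have [pos|neg] := ltP 0 (Psi (r, y)); last exact: le_trans neg (ltW _).
  apply: pmax; apply/mem_set; split; first by rewrite /= in_itv.
  by rewrite /= ltW// (inball r).
have st : s < t.
  rewrite lt_neqAle; case/andP: tin => -> _; rewrite andbT; apply/eqP => st.
  move: Psi0; rewrite /Psi /E -st /= subrr mulr0 expR0 mulr1 subr_gt0 ltNge.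
  by rewrite Ts.
have tT : t <= T by case/andP: tin.
have kE0 : 0 < k * E t by rewrite mulr_gt0// expR_gt0.
have stT : s < t <= T by rewrite st.
have Theta0 : 0 < Theta t x.
  by apply: lt_trans (_ : k * E t * phi x < _); [rewrite mulr_gt0|rewrite -subr_gt0].
have [chit [chix [c [p [X [[dchit tmax] [jchi xmax] cle]]]]]] := sub _ _ stT Theta0.
have [p0 X0] : (forall i, p i + - (k * E t) * partial i phi x = 0) /\
    forall v, qform (fun i j => X i j + - (k * E t) * partial i (partial j phi) x) v <= 0.
  apply: (hasjet_max (hasjetD jchi (hasjetZ _ (hasjet_C2 x phiC2)))).
  apply: filterS xmax => y xy.
  have := Psi_le t y tin; rewrite /Psi /=; lra.
have [Qsym Qp] := Qpsd t x stT.
have := psd_nsd_sum_le0 Qp X0.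
rewrite -/(pairing _ _) pairingD pairingZ => tr_le0.
have cge : 0 <= c - k * phi x * (mu * E t).
  have dE : is_derive (t : R) 1 (fun r => k * phi x * E r) (k * phi x * (mu * E t)).
    apply: is_derive_eq (is_deriveZ (k * phi x) (is_derive_expR_shift mu s t)) _.
    by [].
  apply: (is_derive_left_max (is_deriveB dchit dE)).
  have near_s : \forall r \near t, s < r by exact: lt_nbhsr.
  near=> r => rt.
  have rin : s <= r <= T by rewrite (le_trans rt tT) andbT ltW//; near: r.
  have := Psi_le r x rin; rewrite /Psi /=.
  have : r <= t -> chit r - chit t <= Theta r x - Theta t x by near: r.
  move=> /(_ rt) H1 H2.
  suff : chit r - k * phi x * E r <= chit t - k * phi x * E t by [].
  lra.
have bp : \sum_j b j t x * p j = k * E t * \sum_j b j t x * partial j phi x.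
  rewrite mulr_sumr; apply: eq_bigr => j _; rewrite mulrCA; congr (_ * _).
  by have := p0 j; lra.
have := Aphi t x stT; rewrite scalar_operatorE//.
rewrite -(ltr_pM2l kE0) mulrDr -bp.
move: cle tr_le0 cge; set S1 := pairing _ _; set S2 := pairing _ _; set S3 := \sum_j _.
set e := E t; lra.
Unshelve. all: by end_near. Qed.

End maximum_principle.

(** * The squared norm of a vector field *)

Section squared_norm.
Context {R : realType}.

Lemma sqr_sum_le n (x : 'I_n -> R) : (\sum_i x i) ^+ 2 <= n%:R * \sum_i x i ^+ 2.
Proof.
rewrite expr2 mulr_suml.
apply: (@le_trans _ _ (\sum_i \sum_j (x i ^+ 2 + x j ^+ 2) / 2)).
  apply: ler_sum => i _; rewrite mulr_sumr; apply: ler_sum => j _.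
  by have := sqr_ge0 (x i - x j); rewrite sqrrB; lra.
rewrite le_eqVlt; apply/orP; left; apply/eqP.
under eq_bigr do rewrite -mulr_suml big_split/= sumr_const card_ord.
rewrite -mulr_suml big_split /= sumr_const card_ord sumrMnl -mulr_natl.
by rewrite -[(\sum_j _) *+ n]mulr_natl; field.
Qed.

(** Young's inequality, the weights being chosen so that the first order
    coupling costs exactly the ellipticity [lam]. *)
Lemma coupling_absorbed n m (u : 'cV[R]_m) (D : 'I_n -> 'cV[R]_m)
    (N : 'I_n -> 'M[R]_m) (a lam : R) : (0 < n)%N -> (0 < m)%N -> 0 < lam ->
  0 <= a -> (forall j h k, `|N j h k| <= a) ->
  dotmx u (\sum_j N j *m D j) <=
    lam * (\sum_j dotmx (D j) (D j))
    + (4^-1 * m%:R ^+ 2 * n%:R * (a ^+ 2 / lam)) * dotmx u u.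
Proof.
move=> n0 m0 lam0 a0 Na.
pose x := \sum_h `|u h 0|; pose y := \sum_j \sum_k `|D j k 0|.
have H1 : dotmx u (\sum_j N j *m D j) <= a * x * y.
  rewrite dotmx_col /x [a * _]mulrC -mulrA mulr_suml; apply: ler_sum => h _.
  apply: (le_trans (ler_norm _)); rewrite normrM ler_wpM2l// summxE.
  apply: (le_trans (ler_norm_sum _ _ _)); rewrite mulr_sumr; apply: ler_sum => j _.
  rewrite mxE (le_trans (ler_norm_sum _ _ _))// mulr_sumr; apply: ler_sum => k _.
  by rewrite normrM ler_wpM2r.
have x2 : x ^+ 2 <= m%:R * dotmx u u.
  apply: (le_trans (sqr_sum_le _)); rewrite dotmx_col; under eq_bigr do rewrite real_normK ?num_real//.
  by under [in leRHS]eq_bigr do rewrite -expr2.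
have y2 : y ^+ 2 <= n%:R * m%:R * \sum_j dotmx (D j) (D j).
  apply: (le_trans (sqr_sum_le _)); rewrite -mulrA ler_wpM2l// mulr_sumr.
  apply: ler_sum => j _; apply: (le_trans (sqr_sum_le _)); rewrite dotmx_col.
  under eq_bigr do rewrite real_normK ?num_real//.
  by under [in leRHS]eq_bigr do rewrite -expr2.
apply: (le_trans H1).
set S := \sum_j _ in y2 *; set U := dotmx u u in x2 *.
have n1 : 0 < (n%:R : R) by rewrite ltr0n.
have m1 : 0 < (m%:R : R) by rewrite ltr0n.
have nm : 0 < (n%:R * m%:R : R) by rewrite mulr_gt0.
apply: (@le_trans _ _ (lam * (y ^+ 2 / (n%:R * m%:R)) + 4^-1 * m%:R * n%:R * (a ^+ 2 / lam) * x ^+ 2)).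
  rewrite -subr_ge0.
  have -> : lam * (y ^+ 2 / (n%:R * m%:R)) + 4^-1 * m%:R * n%:R * (a ^+ 2 / lam) * x ^+ 2 - a * x * y
    = lam / (n%:R * m%:R) * (y - a * x * (n%:R * m%:R) / (2 * lam)) ^+ 2.
    by field; rewrite !gt_eqF.
  by rewrite mulr_ge0 ?sqr_ge0// divr_ge0// ltW.
apply: lerD.
  by rewrite ler_pM2l// ler_pdivrMr// [S * _]mulrC.
have -> : 4^-1 * m%:R ^+ 2 * n%:R * (a ^+ 2 / lam) * U
  = 4^-1 * m%:R * n%:R * (a ^+ 2 / lam) * (m%:R * U) by ring.
rewrite ler_wpM2l// mulr_ge0//.
by rewrite divr_ge0 ?sqr_ge0 ?ltW.
Qed.

Context {d m : nat}.

(** Entrywise, so that jets of squared norms follow from the scalar calculus. *)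
Definition vjet (w : 'rV[R]_d -> 'cV[R]_m) x (D : 'I_d -> 'cV[R]_m)
    (X : 'I_d -> 'I_d -> 'cV[R]_m) : Prop :=
  forall h, hasjet (fun y => w y h 0) x (fun j => D j h 0) (fun i j => X i j h 0).

Lemma vjet_C2 w x : C2 w ->
  vjet w x (fun j => partial j w x) (fun i j => partial i (partial j w) x).
Proof.
move=> Cw h; have [Cwh p1 p2] := C2_coord h Cw; have := hasjet_C2 x Cwh.
congr (hasjet _ _ _ _); first by apply/funext => j.
by apply/funext => i; apply/funext => j.
Qed.

Lemma vjetB w1 w2 x D1 D2 X1 X2 : vjet w1 x D1 X1 -> vjet w2 x D2 X2 ->
  vjet (fun y => w1 y - w2 y) x (fun j => D1 j - D2 j) (fun i j => X1 i j - X2 i j).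
Proof.
move=> j1 j2 h; have := hasjetD (j1 h) (hasjetZ (-1) (j2 h)).
congr (hasjet _ _ _ _).
- by apply/funext => y; rewrite !mxE mulN1r.
- by apply/funext => j; rewrite !mxE mulN1r.
- by apply/funext => i; apply/funext => j; rewrite !mxE mulN1r.
Qed.

Lemma dotmx_suml k (x : 'I_k -> 'cV[R]_m) y : dotmx (\sum_i x i) y = \sum_i dotmx (x i) y.
Proof.
elim: k x => [|k IH] x; last by rewrite !big_ord_recl dotmxDl IH.
by rewrite !big_ord0 dotmx_col big1// => i _; rewrite mxE mul0r.
Qed.

Lemma dotmx_sumr k (x : 'I_k -> 'cV[R]_m) y : dotmx y (\sum_i x i) = \sum_i dotmx y (x i).
Proof. by rewrite dotmxC dotmx_suml; apply: eq_bigr => i _; rewrite dotmxC. Qed.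

Lemma vjet_sqnorm w x D X : vjet w x D X ->
  hasjet (fun y => dotmx (w y) (w y)) x (fun j => 2 * dotmx (w x) (D j))
    (fun i j => 2 * dotmx (w x) (X i j) + 2 * dotmx (D i) (D j)).
Proof.
move=> jw; have := hasjet_sum (fun h => hasjet_sqr (jw h)).
congr (hasjet _ _ _ _).
- by apply/funext => y; rewrite dotmx_col; apply: eq_bigr => h _; rewrite expr2.
- by apply/funext => j; rewrite dotmx_col mulr_sumr; apply: eq_bigr => h _; rewrite mulrA.
- apply/funext => i; apply/funext => j.
  rewrite !dotmx_col !mulr_sumr -big_split; apply: eq_bigr => h _.
  by rewrite /=; ring.
Qed.

Lemma is_derive_sqnorm (w : R -> 'cV[R]_m) t (w' : 'cV[R]_m) :
  (forall h, is_derive (t : R) 1 (fun r => w r h 0) (w' h 0)) ->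
  is_derive (t : R) 1 (fun r => dotmx (w r) (w r)) (2 * dotmx (w t) w').
Proof.
move=> dw; have H h := is_deriveM (dw h) (dw h).
have := is_derive_sum H.
move=> H2; apply: is_derive_eq.
  move: H2; congr (is_derive _ _ _ _).
  by apply/funext => r; rewrite fct_sumE dotmx_col.
by rewrite dotmx_col mulr_sumr; apply: eq_bigr => h _; rewrite /(_ *: _)/=; ring.
Qed.

Lemma pairing_gram (A : 'I_d -> 'I_d -> R) (D : 'I_d -> 'cV[R]_m) :
  pairing A (fun i j => dotmx (D i) (D j)) = \sum_h qform A (\row_j D j h 0).
Proof.
rewrite /qform [RHS]exchange_big; apply: eq_bigr => i _.
rewrite [RHS]exchange_big; apply: eq_bigr => j _.
by rewrite dotmx_col mulr_sumr; apply: eq_bigr => h _; rewrite !mxE.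
Qed.

Lemma pairing_gram_ge (A : 'I_d -> 'I_d -> R) (D : 'I_d -> 'cV[R]_m) lam :
  (forall v, lam * dotmx v v <= qform A v) ->
  lam * \sum_j dotmx (D j) (D j) <= pairing A (fun i j => dotmx (D i) (D j)).
Proof.
move=> Alam; rewrite pairing_gram.
have -> : lam * \sum_j dotmx (D j) (D j) =
    \sum_h lam * dotmx (\row_j D j h 0) (\row_j D j h 0).
  rewrite -mulr_sumr; congr (_ * _); under [RHS]eq_bigr do rewrite dotmx_row.
  rewrite [RHS]exchange_big; apply: eq_bigr => j _; rewrite dotmx_col.
  by apply: eq_bigr => h _; rewrite !mxE.
by apply: ler_sum => h _; exact: Alam.
Qed.

End squared_norm.

(** * Comparison of the system with the scalar equation *)

Section comparison.
Context {R : realType} {d m : nat}.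
Variables (Q : R -> 'rV[R]_d -> 'M[R]_d).
Variables (B : 'I_d -> R -> 'rV[R]_d -> 'M[R]_m).
Variables (C : R -> 'rV[R]_d -> 'M[R]_m).
Variables (b : 'I_d -> R -> 'rV[R]_d -> R).

Definition system_rhs t x (U : 'cV[R]_m) (D : 'I_d -> 'cV[R]_m)
    (X : 'I_d -> 'I_d -> 'cV[R]_m) : 'cV[R]_m :=
  \sum_i \sum_j Q t x i j *: X i j + \sum_j B j t x *m D j + C t x *m U.

(** The system read on jets, which keeps what the comparison and the doubling
    argument use of a classical solution and passes to differences. *)
Definition jet_solution s T (w : R -> 'rV[R]_d -> 'cV[R]_m) : Prop :=
  forall t x, s < t <= T -> exists D X, vjet (w t) x D X /\
    forall h, is_derive (t : R) 1 (fun r => w r x h 0)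
      (system_rhs t x (w t x) D X h 0).

Lemma jet_solution_classical s T f u :
  bounded_classical_solution (system_operator Q B C) s f u -> jet_solution s T u.
Proof.
move=> [Cu _ _ eqn _] t x /andP[st _].
exists (fun j => partial j (u t) x), (fun i j => partial i (partial j (u t)) x).
split; first exact: vjet_C2 (C12_after_C2 Cu st).
move=> h; rewrite -[system_rhs _ _ _ _ _]/(system_operator Q B C t (u t) x) -eqn//.
have [du duE] := C12_after_time x Cu st.
split; first exact: (derivable_mxP _ _ _).1 du h 0.
by rewrite -duE derive_mx// mxE.
Qed.

Lemma jet_solutionB s T u1 u2 : jet_solution s T u1 -> jet_solution s T u2 ->
  jet_solution s T (fun t x => u1 t x - u2 t x).
Proof.
move=> j1 j2 t x tT; have [D1 [X1 [v1 d1]]] := j1 t x tT.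
have [D2 [X2 [v2 d2]]] := j2 t x tT.
exists (fun j => D1 j - D2 j), (fun i j => X1 i j - X2 i j).
split; first exact: vjetB.
move=> h; have := is_deriveB (d1 h) (d2 h) => H.
have -> : (fun r => (u1 r x - u2 r x) h 0) = (fun r => u1 r x h 0) - (fun r => u2 r x h 0).
  by apply/funext => r; rewrite !mxE.
apply: is_derive_eq H _; rewrite -[_ - _]/(_ + _).
have -> : system_rhs t x (u1 t x - u2 t x) (fun j => D1 j - D2 j) (fun i j => X1 i j - X2 i j)
    = system_rhs t x (u1 t x) D1 X1 - system_rhs t x (u2 t x) D2 X2.
  rewrite /system_rhs mulmxBr.
  under eq_bigr => i _.
    under eq_bigr do rewrite scalerBr.
    rewrite sumrB; over.
  rewrite sumrB; under [X in _ + X + _]eq_bigr do rewrite mulmxBr.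
  rewrite sumrB.
  have zid (V : zmodType) (a1 a2 a3 c1 c2 c3 : V) :
    (a1 - c1) + (a2 - c2) + (a3 - c3) = (a1 + a2 + a3) - (c1 + c2 + c3).
    have -> : a1 - c1 + (a2 - c2) = (a1 + a2) - (c1 + c2) by rewrite opprD addrACA.
    by rewrite addrACA -opprD.
  exact: zid.
by rewrite !mxE.
Qed.

(** The hypotheses on the coefficients at one point, in the form consumed by
    the computation of the equation for [|u|^2]: ellipticity [lam], bound [a]
    on the part of the drift that couples components, and the resulting growth
    rate. *)
Definition dissipative_at H t x : Prop := exists (lam a : R) (N : 'I_d -> 'M[R]_m),
  [/\ 0 < lam /\ 0 <= a,
      (Q t x)^T = Q t x /\ (forall v, lam * dotmx v v <= qform (Q t x) v),
      forall j, B j t x = (b j t x)%:M + N j,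
      forall j h k, `|N j h k| <= a &
      sup_quadratic_form (C t x) + 4^-1 * m%:R ^+ 2 * d%:R * (a ^+ 2 / lam) <= H].

Lemma dissipative_psd H t x : dissipative_at H t x -> (Q t x)^T = Q t x /\ psd (Q t x).
Proof.
move=> [lam [a [N [[lam0 _] [Qs Ql] _ _ _]]]]; split=> //; split=> [i j|v].
  by rewrite -{1}Qs mxE.
by apply: le_trans (Ql v); rewrite mulr_ge0 ?dotmx_ge0 ?ltW.
Qed.

(** The half of the argument that is algebra: the gradient square coming from
    the diffusion of [|u|^2] swallows the coupling in the drift. *)
Lemma sqnorm_rhs_le H t x U D X : (0 < d)%N -> (0 < m)%N -> dissipative_at H t x ->
  2 * dotmx U (system_rhs t x U D X) <=
    pairing (Q t x) (fun i j => 2 * dotmx U (X i j) + 2 * dotmx (D i) (D j))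
    + \sum_j b j t x * (2 * dotmx U (D j)) + 2 * H * dotmx U U.
Proof.
move=> d0 m0 [lam [a [N [[lam0 a0] [Qs Ql] BE Na Hle]]]].
rewrite /system_rhs !dotmxDr pairingD !pairingZ.
have -> : dotmx U (\sum_i \sum_j Q t x i j *: X i j) =
    pairing (Q t x) (fun i j => dotmx U (X i j)).
  rewrite dotmx_sumr; apply: eq_bigr => i _; rewrite dotmx_sumr.
  by apply: eq_bigr => j _; rewrite dotmxZr.
have -> : dotmx U (\sum_j B j t x *m D j) =
    \sum_j b j t x * dotmx U (D j) + dotmx U (\sum_j N j *m D j).
  rewrite !dotmx_sumr -big_split; apply: eq_bigr => j _.
  by rewrite BE mulmxDl mul_scalar_mx dotmxDr dotmxZr.
have -> : \sum_j b j t x * (2 * dotmx U (D j)) = 2 * \sum_j b j t x * dotmx U (D j).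
  by rewrite mulr_sumr; apply: eq_bigr => j _; ring.
have A1 := coupling_absorbed U D d0 m0 lam0 a0 Na.
have A2 := pairing_gram_ge D Ql.
have A3 := sup_quadratic_formP (C t x) U; rewrite dotmxC in A3.
have A4 := ler_wpM2r (dotmx_ge0 U) Hle.
rewrite mulrDl in A4; lra.
Qed.

(** The previous principle for every [k > 0], as [k] tends to 0. *)
Lemma weak_maximum_principle0 s T mu phi (Theta : R -> 'rV[R]_d -> R) M :
  (forall t x, s < t <= T -> (Q t x)^T = Q t x /\ psd (Q t x)) ->
  strict_lyapunov Q b s T mu phi ->
  {within [set p : R * 'rV[R]_d | s <= p.1], continuous (fun p => Theta p.1 p.2)} ->
  (forall t x, s <= t <= T -> Theta t x <= M) ->
  (forall x, Theta s x <= 0) ->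
  (forall t x, s < t <= T -> 0 < Theta t x -> subsolution_at Q b Theta t x) ->
  forall t x, s <= t <= T -> Theta t x <= 0.
Proof.
move=> Qp lyap cT TM Ts sub t x tin; have [_ phi0 _ _] := lyap.
rewrite leNgt; apply/negP => Th0.
have ep : 0 < expR (mu * (t - s)) * phi x by rewrite mulr_gt0// expR_gt0.
pose k := Theta t x / (2 * (expR (mu * (t - s)) * phi x)).
have k0 : 0 < k by rewrite divr_gt0// mulr_gt0.
have := weak_maximum_principle Qp lyap cT TM k0 _ sub x tin.
move=> /(_ (fun y => le_trans (Ts y) (ltW (mulr_gt0 k0 (phi0 y))))).
rewrite -mulrA /k.
have -> : Theta t x / (2 * (expR (mu * (t - s)) * phi x)) * (expR (mu * (t - s)) * phi x) = Theta t x / 2.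
  by field; rewrite !gt_eqF// expR_gt0.
lra.
Qed.

(** [e^(-2H (t - s)) |w|^2] is a subsolution of the scalar equation by
    [sqnorm_rhs_le], while [dl + M psi] is a solution, constants being
    annihilated by the scalar operator. *)
Lemma sqnorm_comparison (s T mu H : R) phi w (M0 dl M : R) f psi :
  (0 < d)%N -> (0 < m)%N -> s < T ->
  (forall t x, s < t <= T -> dissipative_at H t x) ->
  strict_lyapunov Q b s T mu phi ->
  jet_solution s T w ->
  {within [set p : R * 'rV[R]_d | s <= p.1], continuous (fun p => w p.1 p.2)} ->
  (forall t x, s <= t <= T -> dotmx (w t x) (w t x) <= M0) ->
  bounded_classical_solution (scalar_operator Q b) s f psi -> 0 <= M ->
  (forall x, dotmx (w s x) (w s x) <= dl + M * f x) ->
  forall t x, s <= t <= T ->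
    dotmx (w t x) (w t x) <= expR (2 * H * (t - s)) * (dl + M * psi t x).
Proof.
move=> d0 m0 sT diss lyap jw cw wM0 [Cpsi cpsi bpsi psieq psi_s] M_ge0 ws t1 x1 t1in.
pose E t := expR (- (2 * H) * (t - s)).
pose Theta t x := E t * dotmx (w t x) (w t x) + (- dl + (- M) * psi t x).
have [P psiP] : exists P, forall t x, s <= t <= T -> `|psi t x| <= P.
  have [P [_ HP]] := bpsi T sT; exists (P + 1) => t x tin.
  by apply: (HP (P + 1) _ (t, x)); rewrite ?ltrDl.
suff : Theta t1 x1 <= 0.
  rewrite /Theta /E mulNr expRN mulrC => H1.
  rewrite [leRHS]mulrC -ler_pdivrMr ?expR_gt0//; lra.
have E0 t : 0 < E t by rewrite expR_gt0.
have Emax t : s <= t <= T -> E t <= expR (`|2 * H| * (T - s)).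
  move=> /andP[st tT]; rewrite ler_expR.
  apply: (@le_trans _ _ (`|2 * H| * (t - s))).
    by rewrite ler_wpM2r ?subr_ge0// -normrN ler_norm.
  by rewrite ler_wpM2l// lerB.
have M00 : 0 <= M0 by apply: le_trans (wM0 s x1 _); rewrite ?dotmx_ge0// lexx ltW.
apply: (@weak_maximum_principle0 s T mu phi Theta
  (expR (`|2 * H| * (T - s)) * M0 + (- dl + M * P))) => //.
- by move=> t x tin; exact: dissipative_psd (diss t x tin).
- have cE : {within [set p : R * 'rV[R]_d | s <= p.1], continuous (fun p => E p.1)}.
    apply: continuous_subspaceT => p.
    by apply: (@continuous_expR_shift _ _ _ s fst) => q; exact: cvg_fst.
  have cw2 : {within [set p : R * 'rV[R]_d | s <= p.1], continuous (fun p => dotmx (w p.1 p.2) (w p.1 p.2))}.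
    move=> p; apply: (@continuous_comp _ _ _ _ (fun y : 'cV[R]_m => dotmx y y)); first exact: cw.
    exact: continuous_dotmx.
  move=> p; apply: cvgD; first by apply: cvgM; [exact: cE|exact: cw2].
  by apply: cvgD; [exact: cvg_cst|apply: cvgM; [exact: cvg_cst|exact: cpsi]].
- move=> t x tin; apply: lerD.
    by apply: ler_pM => //; rewrite ?dotmx_ge0 ?wM0 ?Emax// ltW.
  rewrite lerD2l mulNr -mulrN ler_wpM2l//; apply: le_trans (psiP t x tin).
  by rewrite -normrN ler_norm.
- by move=> x; rewrite /Theta /E subrr mulr0 expR0 mul1r psi_s; have := ws x; lra.
- move=> t x tin _; have [D [X [jv dv]]] := jw t x tin.
  have /andP[st tT] := tin.
  have Cpt := C12_after_C2 Cpsi st.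
  have dpsi := C12_after_time x Cpsi st; rewrite psieq// in dpsi.
  have Qs := (dissipative_psd (diss t x tin)).1.
  have jx := hasjetD (hasjetZ (E t) (vjet_sqnorm jv))
    (hasjetD (hasjet_cst (- dl) x) (hasjetZ (- M) (hasjet_C2 x Cpt))).
  have dt := is_deriveD (is_deriveM (is_derive_expR_shift (- (2 * H)) s t)
    (is_derive_sqnorm dv)) (is_deriveD (is_derive_cst (- dl) t 1) (is_deriveZ (- M) dpsi)).
  apply: (subsolution_at_self dt jx).
  rewrite scalar_operatorE//.
  have := sqnorm_rhs_le (w t x) D X d0 m0 (diss t x tin).
  rewrite -(ler_pM2l (E0 t)).
  under [X in _ -> _ <= _ + X]eq_bigr do rewrite add0r mulrDr mulrCA [b _ t x * (- M * _)]mulrCA.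
  rewrite big_split/= -!mulr_sumr [pairing _ (fun i j => _ + (0 + _))]pairingD.
  rewrite pairingZ [pairing _ (fun i j => 0 + _)]pairingD pairingZ.
  have -> : pairing (Q t x) (fun _ _ => 0) = 0.
    by rewrite /pairing big1// => i _; rewrite big1// => j _; rewrite mulr0.
  rewrite -/(E t) !/(_ *: _) /=.
  set a1 := pairing _ _; set a2 := pairing _ _; set a3 := \sum_j _; set a4 := \sum_j _.
  set a5 := dotmx _ _; set a6 := dotmx _ _; set e := E t; lra.
Qed.

End comparison.

(** * Coupling two diffusions by reflection *)

Section coupling.
Context {R : realType} {d : nat}.

Lemma dotmx_row_mx k (p q : 'rV[R]_d) (a b : 'rV[R]_k) :
  dotmx (row_mx p a) (row_mx q b) = dotmx p q + dotmx a b.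
Proof.
rewrite !dotmx_row big_split_ord /=; congr (_ + _); apply: eq_bigr => i _.
  by rewrite !row_mxEl.
by rewrite !row_mxEr.
Qed.

Lemma qform_gram n (A : 'I_n -> 'I_n -> R) k (P : 'I_k -> 'rV[R]_n) v :
  (forall i j, A i j = \sum_k P k 0 i * P k 0 j) ->
  qform A v = \sum_k dotmx v (P k) ^+ 2.
Proof.
move=> AE; under [RHS]eq_bigr do rewrite dotmx_row expr2 mulr_suml.
rewrite [RHS]exchange_big; apply: eq_bigr => i _.
under [RHS]eq_bigr do rewrite mulr_sumr.
rewrite [RHS]exchange_big; apply: eq_bigr => j _; rewrite AE mulr_suml.
by apply: eq_bigr => l _; ring.
Qed.

Lemma qform_small (E : 'I_d -> 'I_d -> R) eps v : 0 <= eps ->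
  (forall i j, `|E i j| <= eps) -> `|qform E v| <= eps * d%:R * dotmx v v.
Proof.
move=> e0 Ee; apply: (@le_trans _ _ (eps * (\sum_i `|v 0 i|) ^+ 2)).
  apply: (le_trans (ler_norm_sum _ _ _)); rewrite expr2 mulr_suml mulr_sumr.
  apply: ler_sum => i _; apply: (le_trans (ler_norm_sum _ _ _)).
  rewrite !mulr_sumr; apply: ler_sum => j _; rewrite normrM normrM.
  by rewrite ler_wpM2r ?mulr_ge0.
rewrite -mulrA ler_wpM2l// (le_trans (sqr_sum_le _))// dotmx_row.
under eq_bigr do rewrite real_normK ?num_real//.
by under [in leRHS]eq_bigr do rewrite -expr2.
Qed.

Lemma sqr_dotmx_unit (v e : 'rV[R]_d) : dotmx e e = 1 -> dotmx v e ^+ 2 <= dotmx v v.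
Proof.
move=> e1; have := dotmx_ge0 (v - dotmx v e *: e).
rewrite !(dotmxDl, dotmxDr, dotmxNl, dotmxNr, dotmxZl, dotmxZr) e1 (dotmxC e v).
by rewrite expr2; lra.
Qed.

(** Coupling by reflection: the diffusions at two nearby points are driven by
    common directions [a k], [b k]. Their difference fluctuates essentially
    along [z] only, so that its trace is beaten by its component along [z]
    (last item), while a small independent part keeps the coupled form
    coercive. *)
Lemma coupling_directions (Qx Qy : 'M[R]_d) (lam Lam kap eps : R) (z : 'rV[R]_d) :
  Qx^T = Qx -> Qy^T = Qy -> 0 < lam ->
  (forall v, lam * dotmx v v <= qform Qx v) -> \tr Qx <= Lam ->
  0 < kap <= 8^-1 -> 8 * kap * Lam <= lam -> 0 <= eps ->
  12 * d%:R * eps <= kap * lam ->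
  (forall i j, `|Qx i j - Qy i j| <= eps) -> z != 0 ->
  exists n (a b : 'I_n -> 'rV[R]_d),
  [/\ forall i j, Qx i j = \sum_k a k 0 i * a k 0 j,
      forall i j, Qy i j = \sum_k b k 0 i * b k 0 j,
      forall p q, kap * lam / 2 * (dotmx p p + dotmx q q) <=
        \sum_k (dotmx p (a k) - dotmx q (b k)) ^+ 2 &
      2 * (\sum_k dotmx (a k - b k) (a k - b k))
        - 3 * (\sum_k dotmx z (a k - b k) ^+ 2) / dotmx z z <= - (2 * lam)].
Proof.
move=> Qxs Qys lam0 Qxl trQ /andP[kap0 kap1] kapL eps0 epsd Qxy z0.
have zz0 : 0 < dotmx z z by rewrite lt_neqAle eq_sym dotmx_eq0 z0 dotmx_ge0.
have ez0 : 0 < enorm z by rewrite sqrtr_gt0.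
have [e [e1 ze]] : exists e, dotmx e e = 1 /\ dotmx z e ^+ 2 = dotmx z z.
  exists ((enorm z)^-1 *: z); split.
    by rewrite dotmxZl dotmxZr mulrA -invfM -expr2 sqr_enorm mulVf// gt_eqF.
  by rewrite dotmxZr exprMn exprVn sqr_enorm expr2 mulrA mulVf ?mul1r// gt_eqF.
(* With full coupling the cross block would be [Qx], and both diffusions would
   move in parallel. Subtracting twice [lam] times the projection onto [z]
   reflects a noise of intensity [lam] in that direction; the factor
   [1 - kap] leaves a fraction [kap] of independent noise. *)
pose M : 'M[R]_d := Qx - (2 * lam) *: (e^T *m e).
pose c := (1 - kap) *: M.
have eeE (v : 'rV[R]_d) : v *m (e^T *m e) = dotmx v e *: e.
  rewrite mulmxA [v *m e^T]mx11_scalar mul_scalar_mx; congr (_ *: _).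
  by rewrite mxE dotmx_row; apply: eq_bigr => i _; rewrite mxE.
have cs : c^T = c.
  apply/matrixP => i j; rewrite !mxE !big_ord1 !mxE.
  have -> : Qx j i = Qx i j by rewrite -{1}Qxs mxE.
  ring.
pose N (v : 'rV[R]_d) := dotmx (v *m Qx) v.
have symQ (u v : 'rV[R]_d) : dotmx (u *m Qx) v = dotmx (v *m Qx) u.
  have -> : dotmx (u *m Qx) v = (u *m Qx *m v^T) 0 0.
    by rewrite dotmx_row mxE; apply: eq_bigr => i _; rewrite [v^T _ _]mxE.
  have -> : dotmx (v *m Qx) u = (v *m Qx *m u^T) 0 0.
    by rewrite dotmx_row mxE; apply: eq_bigr => i _; rewrite [u^T _ _]mxE.
  have <- : (v *m Qx *m u^T)^T = u *m Qx *m v^T by rewrite !trmx_mul trmxK Qxs mulmxA.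
  by rewrite mxE.
have dM (u v : 'rV[R]_d) : dotmx (u *m M) v = dotmx (u *m Qx) v - 2 * lam * (dotmx u e * dotmx v e).
  by rewrite mulmxBr -scalemxAr eeE dotmxDl dotmxNl !dotmxZl (dotmxC e v).
have Nl v : lam * dotmx v v <= N v by rewrite /N -qformE.
have Ny v : `|dotmx (v *m Qy) v - N v| <= eps * d%:R * dotmx v v.
  rewrite -normrN opprB /N -!qformE.
  have -> : qform Qx v - qform Qy v = qform (fun i j => Qx i j - Qy i j) v.
    rewrite (_ : qform (fun i j => Qx i j - Qy i j) v = qform (fun i j => Qx i j + (-1) * Qy i j) v).
      by rewrite qformD qformZ mulN1r.
    by apply: eq_bigr => i _; apply: eq_bigr => j _; rewrite mulN1r.
  exact: qform_small.
pose A : 'M[R]_(d + d) := block_mx Qx c c^T Qy.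
have qA (p q : 'rV[R]_d) : qform A (row_mx p q) =
    N p + dotmx (q *m Qy) q + 2 * (1 - kap) * (dotmx (p *m Qx) q - 2 * lam * (dotmx p e * dotmx q e)).
  rewrite qformE mul_row_block dotmx_row_mx !dotmxDl cs -!scalemxAr !dotmxZl !dM.
  by rewrite (symQ q p) /N; ring.
have coer (p q : 'rV[R]_d) : kap * lam / 2 * (dotmx p p + dotmx q q) <= qform A (row_mx p q).
  rewrite qA.
  have D1 := sqr_dotmx_unit (p + q) e1; have D2 := sqr_dotmx_unit (p - q) e1.
  have N1 := Nl (p + q); have N2 := Nl (p - q).
  have NE1 : N (p + q) = N p + N q + 2 * dotmx (p *m Qx) q.
    by rewrite /N mulmxDl !(dotmxDl, dotmxDr) (symQ q p); ring.
  have NE2 : N (p - q) = N p + N q - 2 * dotmx (p *m Qx) q.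
    by rewrite /N mulmxBl !(dotmxDl, dotmxDr, dotmxNl, dotmxNr) (symQ q p); ring.
  have Y : - (eps * d%:R * dotmx q q) <= dotmx (q *m Qy) q - N q.
    by have := Ny q; rewrite ler_norml => /andP[].
  have pp := Nl p; have qq := Nl q; have p0 := dotmx_ge0 p; have q0 := dotmx_ge0 q.
  move: D1 D2 N1 N2; rewrite NE1 NE2 !dotmxDl !dotmxNl.
  set P := dotmx p p in pp p0 *; set Q' := dotmx q q in qq q0 Y *.
  set pe := dotmx p e; set qe := dotmx q e; set pq := dotmx (p *m Qx) q.
  move=> D1 D2 N1 N2.
  have key : - (N p + N q) <= 2 * (pq - 2 * lam * (pe * qe)).
    have E1 := le_trans (ler_wpM2l (ltW lam0) D1) N1.
    have E2 := le_trans (ler_wpM2l (ltW lam0) D2) N2.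
    have : lam * ((pe + qe) ^+ 2 - (pe - qe) ^+ 2) <= N p + N q + 2 * pq + (lam * 0).
      have := mulr_ge0 (ltW lam0) (sqr_ge0 (pe - qe)); lra.
    have -> : (pe + qe) ^+ 2 - (pe - qe) ^+ 2 = 4 * (pe * qe) by ring.
    lra.
  have kap1' : 0 <= 1 - kap by lra.
  have := ler_wpM2l kap1' key.
  have := ler_wpM2l (ltW kap0) (lerD pp qq).
  have := ler_wpM2r q0 epsd.
  have := mulr_ge0 (mulr_ge0 (ltW kap0) (ltW lam0)) p0.
  have := mulr_ge0 (mulr_ge0 (ltW kap0) (ltW lam0)) q0.
  lra.
have Apsd : psd A.
  split=> [i j|v].
    have As : A^T = A by rewrite tr_block_mx trmxK Qxs Qys.
    by rewrite -{1}As mxE.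
  rewrite -(hsubmxK v); apply: le_trans (coer _ _).
  by rewrite mulr_ge0 ?addr_ge0 ?dotmx_ge0// divr_ge0 ?mulr_ge0// ltW.
have [P PE] := psd_gram Apsd.
pose a k : 'rV[R]_d := lsubmx (P k); pose b k : 'rV[R]_d := rsubmx (P k).
have Pdot (p q : 'rV[R]_d) : \sum_k (dotmx p (a k) - dotmx q (b k)) ^+ 2 = qform A (row_mx p (- q)).
  rewrite (qform_gram _ PE); apply: eq_bigr => k _.
  by rewrite -(hsubmxK (P k)) dotmx_row_mx dotmxNl.
have aE i j : Qx i j = \sum_k a k 0 i * a k 0 j.
  rewrite -(block_mxEul Qx c c^T Qy) PE; apply: eq_bigr => k _.
  by rewrite !mxE.
have bE i j : Qy i j = \sum_k b k 0 i * b k 0 j.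
  rewrite -(block_mxEdr Qx c c^T Qy) PE; apply: eq_bigr => k _.
  by rewrite !mxE.
have abE i j : c i j = \sum_k a k 0 i * b k 0 j.
  rewrite -(block_mxEur Qx c c^T Qy) PE; apply: eq_bigr => k _.
  by rewrite !mxE.
exists (d + d)%N, a, b; split=> //.
  by move=> p q; rewrite Pdot -[dotmx q q]opprK -dotmxNl -dotmxNr; exact: coer.
have S2 : \sum_k dotmx z (a k - b k) ^+ 2 = qform A (row_mx z (- z)).
  by rewrite -Pdot; apply: eq_bigr => k _; rewrite dotmxDr dotmxNr.
have S1 : \sum_k dotmx (a k - b k) (a k - b k) = \sum_i (Qy i i - Qx i i) + 2 * kap * \tr Qx + 4 * (1 - kap) * lam.
  under eq_bigr do rewrite dotmx_row.
  rewrite exchange_big /=.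
  transitivity (\sum_i (Qx i i + Qy i i - 2 * c i i)).
    apply: eq_bigr => i _; rewrite (aE i i) (bE i i) (abE i i) mulr_sumr -big_split -sumrB.
    by apply: eq_bigr => k _; rewrite !mxE /=; ring.
  transitivity (\sum_i ((Qy i i - Qx i i) + 2 * kap * Qx i i + 4 * (1 - kap) * lam * (e 0 i * e 0 i))).
    apply: eq_bigr => i _; rewrite /c /M !mxE big_ord1 !mxE; ring.
  by rewrite !big_split /= -!mulr_sumr -dotmx_row e1 mulr1.
have trE : \sum_i (Qy i i - Qx i i) <= eps * d%:R.
  apply: (@le_trans _ _ (\sum_(i < d) eps)); last by rewrite sumr_const card_ord mulr_natr.
  by apply: ler_sum => i _; have := Qxy i i; rewrite ler_norml => /andP[]; lra.
rewrite S2 qA S1 mulNmx !dotmxNl !dotmxNr opprK.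
have -> : dotmx z e * - dotmx z e = - dotmx z z by rewrite mulrN -expr2 ze.
rewrite -/(N z).
have Y : - (eps * d%:R * dotmx z z) <= dotmx (z *m Qy) z - N z.
  by have := Ny z; rewrite ler_norml => /andP[].
have Nz : 0 <= N z by apply: le_trans (Nl z); rewrite mulr_ge0 ?ltW.
set T := N z + _ + _.
have T0 : (4 * (1 - kap) * lam - eps * d%:R) * dotmx z z <= T.
  have := mulr_ge0 (ltW kap0) Nz; rewrite /T; lra.
have {}T0 : 4 * (1 - kap) * lam - eps * d%:R <= T / dotmx z z by rewrite ler_pdivlMr.
rewrite -mulrA.
have := ler_wpM2l (ltW kap0) trQ.
have := ler_wpM2r (ltW lam0) kap1.
have := mulr_ge0 eps0 (ler0n R d).
lra.
Qed.

End coupling.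

(** * The second order test in doubled variables *)

Section doubling.
Context {R : realType} {d m : nat}.

Lemma continuous_within_comp (X Y Z : topologicalType) (A : set Y) (D : set X)
    (f : Y -> Z) (g : X -> Y) :
  {within A, continuous f} -> continuous g -> (forall x, D x -> A (g x)) ->
  {within D, continuous (fun x => f (g x))}.
Proof.
move=> /subspace_continuousP cf cg DA; apply/subspace_continuousP => x Dx.
move=> P /(cf _ (DA _ Dx)); rewrite /nbhs/= => AP.
have := cg x _ AP; rewrite !/nbhs/=; apply: filterS => y /= yP Dy.
by apply: yP; exact: DA.
Qed.

Lemma jet2_quadratic (z v : 'rV[R]_d) :
  jet2 (fun t => dotmx (z + t *: v) (z + t *: v)) (2 * dotmx z v) (2 * dotmx v v).
Proof.
have -> : (fun t => dotmx (z + t *: v) (z + t *: v)) =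
    fun t => (dotmx z z + t * (2 * dotmx z v)) + dotmx v v * ((0 + t * 1) * (0 + t * 1)).
  apply/funext => t; rewrite !(dotmxDl, dotmxDr, dotmxZl, dotmxZr) (dotmxC v z); ring.
apply: jet2_eq (jet2D (jet2_affine _ _) (jet2Z _ (jet2M (jet2_affine 0 1) (jet2_affine 0 1)))) _ _.
  by ring.
by ring.
Qed.

(** The barrier is [|z|^(1/2)], written through [q = |z|^2]. Its concavity in
    the radial direction is the source of the negative last term. *)
Lemma jet2_barrier (z v : 'rV[R]_d) : z != 0 ->
  jet2 (fun t => dotmx (z + t *: v) (z + t *: v) `^ 4^-1)
    (4^-1 * dotmx z z `^ (4^-1 - 1) * (2 * dotmx z v))
    (4^-1 * dotmx z z `^ (4^-1 - 1) *
      (2 * dotmx v v - 3 * dotmx z v ^+ 2 / dotmx z z)).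
Proof.
move=> z0; have q0 : 0 < dotmx z z by rewrite lt_neqAle eq_sym dotmx_eq0 z0 dotmx_ge0.
have F1 (y : R) : 0 < y -> is_derive y 1 (fun y : R => y `^ 4^-1) (4^-1 * y `^ (4^-1 - 1)).
  by move=> y0; exact: is_derive1_powR.
have F2 : is_derive (dotmx z z) 1 (fun y : R => 4^-1 * y `^ (4^-1 - 1))
    (4^-1 * ((4^-1 - 1) * dotmx z z `^ (4^-1 - 1 - 1))).
  have P : is_derive (dotmx z z) 1 (fun y : R => y `^ (4^-1 - 1))
      ((4^-1 - 1) * dotmx z z `^ (4^-1 - 1 - 1)) by exact: is_derive1_powR.
  exact: (is_deriveZ 4^-1 P).
have z0v : z + 0 *: v = z by rewrite scale0r addr0.
have := @jet2_comp R (fun t => dotmx (z + t *: v) (z + t *: v)) (fun y : R => y `^ 4^-1)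
  (fun y : R => 4^-1 * y `^ (4^-1 - 1)) (4^-1 * ((4^-1 - 1) * dotmx z z `^ (4^-1 - 1 - 1)))
  _ _ (jet2_quadratic z v).
rewrite z0v => H; apply: jet2_eq (H _ F2) _ _ => //.
  have : \forall y \near dotmx z z, 0 < y by exact: lt_nbhsr.
  by apply: filterS => y; exact: F1.
rewrite [dotmx z z `^ (4^-1 - 1 - 1)]powRB; last by rewrite (@gt_eqF _ _ (dotmx z z))//; apply: implybT.
rewrite powRr1 ?ltW//; field; by rewrite gt_eqF.
Qed.

Lemma sum_dotmx_rows (D : 'I_d -> 'cV[R]_m) :
  \sum_h dotmx (\row_j D j h 0) (\row_j D j h 0) = \sum_j dotmx (D j) (D j).
Proof.
under eq_bigr do rewrite dotmx_row.
rewrite exchange_big; apply: eq_bigr => j _; rewrite dotmx_col.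
by apply: eq_bigr => h _; rewrite !mxE.
Qed.

Lemma compact_enorm_ball_at (x0 : 'rV[R]_d) rho : compact [set x | enorm (x - x0) <= rho].
Proof.
have -> : [set x | enorm (x - x0) <= rho] = (fun x : 'rV[R]_d => x + x0) @` [set x | enorm x <= rho].
  apply/seteqP; split => [x /= xr|_ [x /= xr <-]]; last by rewrite addrK.
  by exists (x - x0) => //; rewrite subrK.
apply: continuous_compact; last exact: compact_enorm_ball.
apply: continuous_subspaceT => x.
by apply: continuousD => [P|]; [|exact: cst_continuous].
Qed.

(** The second order condition at a maximum of
    [|fx x - fy (x - z)|^2 - K |z|^(1/2) - L |x - x0|^2] along each direction
    [(a k, b k)] of the pair of points, summed over [k]. The sums of second
    derivatives reproduce the two elliptic operators, the coercivity of the
    coupling keeps a multiple of both gradients squared, and the barrier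
    contributes the large constant [K lam / 2]. *)
Lemma doubled_hessian_test (Qx Qy : 'M[R]_d) n (a b : 'I_n -> 'rV[R]_d) (dlt lam Lam K L : R)
    (fx fy : 'rV[R]_d -> 'cV[R]_m) (x z x0 : 'rV[R]_d) Dx Xx Dy Xy : z != 0 ->
  dotmx z z <= 1 -> 0 <= lam -> 0 <= K -> 0 <= L -> \tr Qx <= Lam ->
  (forall i j, Qx i j = \sum_k a k 0 i * a k 0 j) ->
  (forall i j, Qy i j = \sum_k b k 0 i * b k 0 j) ->
  (forall p q, dlt * (dotmx p p + dotmx q q) <=
        \sum_k (dotmx p (a k) - dotmx q (b k)) ^+ 2) ->
  2 * (\sum_k dotmx (a k - b k) (a k - b k))
        - 3 * (\sum_k dotmx z (a k - b k) ^+ 2) / dotmx z z <= - (2 * lam) ->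
  vjet fx x Dx Xx -> vjet fy (x - z) Dy Xy ->
  (forall k, \forall t \near (0 : R),
     dotmx (fx (x + t *: a k) - fy (x - z + t *: b k)) (fx (x + t *: a k) - fy (x - z + t *: b k))
     - K * dotmx (z + t *: (a k - b k)) (z + t *: (a k - b k)) `^ 4^-1
     - L * dotmx (x - x0 + t *: a k) (x - x0 + t *: a k)
     <= dotmx (fx x - fy (x - z)) (fx x - fy (x - z)) - K * dotmx z z `^ 4^-1
     - L * dotmx (x - x0) (x - x0)) ->
  2 * dotmx (fx x - fy (x - z)) (\sum_i \sum_j Qx i j *: Xx i j - \sum_i \sum_j Qy i j *: Xy i j)
  + 2 * dlt * (\sum_j dotmx (Dx j) (Dx j) + \sum_j dotmx (Dy j) (Dy j))
  + K * lam / 2 - 2 * L * Lam <= 0.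
Proof.
move=> z0 z1 lam0 K0 L0 trQ aE bE coer barr jx jy kmax.
set U := fx x - fy (x - z).
pose Xh (X : 'I_d -> 'I_d -> 'cV[R]_m) h i j : R := X i j h 0.
pose Dh (D : 'I_d -> 'cV[R]_m) h : 'rV[R]_d := \row_j D j h 0.
pose H1 k h : R := 2 * U h 0 * (qform (Xh Xx h) (a k) - qform (Xh Xy h) (b k))
  + 2 * (dotmx (Dh Dx h) (a k) - dotmx (Dh Dy h) (b k)) ^+ 2.
pose H2 k := 4^-1 * dotmx z z `^ (4^-1 - 1) *
   (2 * dotmx (a k - b k) (a k - b k) - 3 * dotmx z (a k - b k) ^+ 2 / dotmx z z).
have test k : \sum_h H1 k h - K * H2 k - L * (2 * dotmx (a k) (a k)) <= 0.
  pose g h t := fx (x + t *: a k) h 0 - fy (x - z + t *: b k) h 0.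
  have jg h : jet2 (g h) (dotmx (Dh Dx h) (a k) - dotmx (Dh Dy h) (b k))
      (qform (Xh Xx h) (a k) - qform (Xh Xy h) (b k)).
    apply: jet2_eq (jet2B (jx h (a k)) (jy h (b k))) _ _ => //.
    by rewrite /lform !dotmx_row; congr (_ - _); apply: eq_bigr => j _; rewrite mxE.
  have jF := jet2B (jet2B (jet2_sum (fun h => jet2M (jg h) (jg h)))
    (jet2Z K (jet2_barrier (a k - b k) z0))) (jet2Z L (jet2_quadratic (x - x0) (a k))).
  have [|_] := jet2_max jF; last first.
    apply: le_trans; rewrite le_eqVlt; apply/orP; left; apply/eqP.
    congr (_ - _ - _); apply: eq_bigr => h _.
    by rewrite /H1 /g !scale0r !addr0 /U !mxE; ring.
  have gE t : \sum_h g h t * g h t = dotmx (fx (x + t *: a k) - fy (x - z + t *: b k)) (fx (x + t *: a k) - fy (x - z + t *: b k)).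
    by rewrite dotmx_col; apply: eq_bigr => h _; rewrite /g !mxE.
  have := kmax k; apply: filterS => t; rewrite !gE !scale0r !addr0.
  by [].
have H2le : \sum_k H2 k <= - (lam / 2).
  rewrite -mulr_sumr sumrB -!mulr_sumr -mulr_suml -mulr_sumr.
  have q0 : 0 < dotmx z z by rewrite lt_neqAle eq_sym dotmx_eq0 z0 dotmx_ge0.
  have q1 : 1 <= dotmx z z `^ (4^-1 - 1).
    have -> : 4^-1 - 1 = - (3 / 4) :> R by field.
    rewrite powRN -[leLHS]invr1 lef_pV2 ?posrE ?powR_gt0//.
    have one : (1 : R) `^ (3 / 4) = 1 by rewrite powR1.
    by rewrite -[leRHS]one ge0_ler_powR// ?nnegrE// ltW.
  apply: (@le_trans _ _ (4^-1 * dotmx z z `^ (4^-1 - 1) * - (2 * lam))).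
    by rewrite ler_wpM2l// mulr_ge0// powR_ge0.
  have := ler_wpM2r lam0 q1; lra.
have H1ge : 2 * dotmx U (\sum_i \sum_j Qx i j *: Xx i j - \sum_i \sum_j Qy i j *: Xy i j)
  + 2 * dlt * (\sum_j dotmx (Dx j) (Dx j) + \sum_j dotmx (Dy j) (Dy j)) <= \sum_k \sum_h H1 k h.
  rewrite [leRHS]exchange_big /=.
  have pE (A : 'M[R]_d) (v : 'I_n -> 'rV[R]_d) X : (forall i j, A i j = \sum_k v k 0 i * v k 0 j) ->
      dotmx U (\sum_i \sum_j A i j *: X i j) = \sum_h U h 0 * \sum_k qform (Xh X h) (v k).
    move=> AE; rewrite dotmx_col; apply: eq_bigr => h _; congr (_ * _).
    rewrite -(gram_sum (Xh X h) AE) summxE; apply: eq_bigr => i _.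
    by rewrite summxE; apply: eq_bigr => j _; rewrite mxE.
  rewrite dotmxDr dotmxNr (pE _ _ Xx aE) (pE _ _ Xy bE) -sumrB mulr_sumr.
  rewrite -!sum_dotmx_rows -big_split mulr_sumr -big_split; apply: ler_sum => h _.
  rewrite /H1 big_split /= -!mulr_sumr sumrB.
  have := coer (Dh Dx h) (Dh Dy h).
  rewrite /Dh; lra.
clearbody H1 H2.
have : \sum_k (\sum_h H1 k h - K * H2 k - L * (2 * dotmx (a k) (a k))) <= 0.
  by rewrite -oppr_ge0 -sumrN; apply: sumr_ge0 => k _; rewrite oppr_ge0.
rewrite !sumrB -!mulr_sumr.
have -> : \sum_k dotmx (a k) (a k) = \tr Qx.
  rewrite /mxtrace; under [RHS]eq_bigr do rewrite aE.
  by rewrite [RHS]exchange_big; apply: eq_bigr => k _; rewrite dotmx_row.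
have := ler_wpM2l K0 H2le; have := ler_wpM2l L0 trQ.
lra.
Qed.

End doubling.

(** * A modulus of continuity at positive times *)

Section interior_modulus.
Context {R : realType} {d m : nat}.
Variables (Q : R -> 'rV[R]_d -> 'M[R]_d).
Variables (B : 'I_d -> R -> 'rV[R]_d -> 'M[R]_m).
Variables (C : R -> 'rV[R]_d -> 'M[R]_m).

(** The case of a single direction and unit weight of the drift estimate. *)
Lemma matrix_growth (A : 'M[R]_m) (U w : 'cV[R]_m) beta : (0 < m)%N -> 0 <= beta ->
  (forall h k, `|A h k| <= beta) ->
  dotmx U (A *m w) <= dotmx w w + 4^-1 * m%:R ^+ 2 * beta ^+ 2 * dotmx U U.
Proof.
move=> m0 b0 Ab.
have := @coupling_absorbed R 1 m U (fun _ => w) (fun _ => A) beta 1 isT m0 ltr01 b0 (fun _ => Ab).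
by rewrite !big_ord1 mul1r divr1 mulr1.
Qed.

Lemma sqnormB_le (u v : 'cV[R]_m) :
  dotmx (u - v) (u - v) <= 2 * dotmx u u + 2 * dotmx v v.
Proof.
have := dotmx_ge0 (u + v).
rewrite !(dotmxDl, dotmxDr, dotmxNl, dotmxNr) (dotmxC v u); lra.
Qed.

Lemma powR_quarter (q : R) : 0 <= q -> q `^ 4^-1 = Num.sqrt (Num.sqrt q).
Proof.
move=> q0; have -> : 4^-1 = 2^-1 * 2^-1 :> R by field.
by rewrite powRrM !powR12_sqrt ?sqrtr_ge0.
Qed.

Lemma near_line_enorm_lt (x v : 'rV[R]_d) a : enorm x < a ->
  \forall t \near (0 : R), enorm (x + t *: v) < a.
Proof.
move=> xa; have cv : (x + t *: v) @[t --> (0 : R)] --> x.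
  rewrite -[X in _ --> X]addr0 -(scale0r v).
  by apply: cvgD; [exact: cvg_cst|apply: cvgZr_tmp; exact: cvg_id].
have /= := cvg_comp _ _ cv (@continuous_enorm R 1 d x).
by move=> /cvgr_lt /(_ _ xa).
Qed.

(** Suppose that [|w(r, x0) - w(r, y0)|^2] exceeds the barrier. Then
    [|w(t, x) - w(t, x - z)|^2 - K |z|^(1/2) - L |x - x0|^2 - L (r - t) / (r - s)]
    has a positive maximum over a compact set. As the first term is at most
    [L = 4 M0], the maximum lies neither at the initial time, nor at
    [|x - x0| = 1], nor, if [K] is large, at [|z| = r0]; and not at [z = 0].
    The first and second order conditions there contradict the system: the
    terms in the gradients are absorbed by the coercive part of the coupling
    and the bounded remainder [cst] is beaten by [K lam / 2]. The constant [K]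
    depends on [w] through the bound [M0] alone, hence equicontinuity. *)
Lemma interior_modulus (s r rho lam Lam beta kap eps r0 M0 : R) :
  (0 < d)%N -> (0 < m)%N -> s < r -> 0 < lam -> 0 <= Lam -> 0 <= beta ->
  0 < kap <= 8^-1 -> 8 * kap * Lam <= lam -> 0 <= eps ->
  12 * d%:R * eps <= kap * lam -> 0 < r0 <= 1 -> 0 <= M0 ->
  (forall t x, s < t <= r -> `|x| <= rho + 2 ->
    [/\ (Q t x)^T = Q t x, forall v, lam * dotmx v v <= qform (Q t x) v,
        \tr (Q t x) <= Lam, forall j h k, `|B j t x h k| <= beta &
        forall h k, `|C t x h k| <= beta]) ->
  (forall t x y, s < t <= r -> `|x| <= rho + 2 -> `|y| <= rho + 2 ->
    enorm (x - y) <= r0 -> forall i j, `|Q t x i j - Q t y i j| <= eps) ->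
  exists2 K, 0 <= K & forall w, jet_solution Q B C s r w ->
    {within [set p : R * 'rV[R]_d | s <= p.1], continuous (fun p => w p.1 p.2)} ->
    (forall t x, s <= t <= r -> dotmx (w t x) (w t x) <= M0) ->
    forall x0 y0, `|x0| <= rho -> enorm (x0 - y0) <= r0 ->
    dotmx (w r x0 - w r y0) (w r x0 - w r y0) <=
      K * dotmx (x0 - y0) (x0 - y0) `^ 4^-1.
Proof.
move=> d0 m0 sr lam0 Lam0 beta0 kapb kapL eps0 epsd /andP[r00 r01] M00 coef Qeps.
have kap0 : 0 < kap by case/andP: kapb.
pose L := 4 * M0; pose dlt := kap * lam / 2.
have dlt0 : 0 < dlt by rewrite /dlt divr_gt0// mulr_gt0.
pose c0 := 4^-1 * m%:R ^+ 2 * d%:R * (beta ^+ 2 / dlt).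
have c00 : 0 <= c0.
  by rewrite /c0 mulr_ge0// divr_ge0 ?sqr_ge0// ltW.
pose cst := 4 * c0 * L + 4 * M0 + m%:R ^+ 2 * beta ^+ 2 * L + L / (r - s) + 2 * L * Lam.
have L0 : 0 <= L by rewrite /L mulr_ge0.
have sr0 : 0 < r - s by rewrite subr_gt0.
have cst0 : 0 <= cst.
  have h1 : 0 <= L / (r - s) by rewrite divr_ge0// ltW.
  have h2 : 0 <= 4 * c0 * L by apply: mulr_ge0 L0; exact: mulr_ge0 c00.
  have h3 : 0 <= m%:R ^+ 2 * beta ^+ 2 * L.
    by apply: mulr_ge0 L0; rewrite mulr_ge0 ?exprn_ge0.
  have h4 : 0 <= 2 * L * Lam by apply: mulr_ge0 => //; exact: mulr_ge0.
  by rewrite /cst; lra.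
pose g0 := (r0 ^+ 2) `^ 4^-1.
have g00 : 0 < g0 by rewrite /g0 powR_gt0// exprn_gt0.
(* The first summand gives [cst < K lam / 2], the second excludes [|z| = r0]. *)
pose K := 2 * (cst + 1) / lam + L / g0.
have K1 : 0 <= 2 * (cst + 1) / lam.
  by apply: divr_ge0 (ltW lam0); apply: mulr_ge0 => //; exact: addr_ge0.
have K2 : 0 <= L / g0 by exact: divr_ge0 L0 (ltW g00).
have K0 : 0 <= K by exact: addr_ge0.
have Klam : cst < K * lam / 2.
  have -> : K * lam / 2 = cst + 1 + (L / g0) * lam / 2 by rewrite /K; field; rewrite !gt_eqF.
  have : 0 <= L / g0 * lam / 2 by apply: divr_ge0 => //; exact: mulr_ge0 (ltW lam0).
  lra.
have KL : L <= K * g0.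
  rewrite /K mulrDl divfK ?gt_eqF// lerDr.
  exact: mulr_ge0 (ltW g00).
exists K => // w jw cw wM0 x0 y0 x0rho xy0.
rewrite leNgt; apply/negP => bad.
pose y_ (p : R * ('rV[R]_d * 'rV[R]_d)) := p.2.1 - p.2.2.
pose Z (p : R * ('rV[R]_d * 'rV[R]_d)) :=
  dotmx (w p.1 p.2.1 - w p.1 (y_ p)) (w p.1 p.2.1 - w p.1 (y_ p)).
pose Phi (p : R * ('rV[R]_d * 'rV[R]_d)) :=
  K * dotmx p.2.2 p.2.2 `^ 4^-1 + (L * dotmx (p.2.1 - x0) (p.2.1 - x0)
   + L / (r - s) * (r - p.1)).
pose Dom := `[s, r]%classic `*` ([set x : 'rV[R]_d | enorm (x - x0) <= 1] `*`
   [set z : 'rV[R]_d | enorm z <= r0]).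
have cDom : compact Dom.
  apply: compact_setX; first exact: segment_compact.
  by apply: compact_setX; [exact: compact_enorm_ball_at|exact: compact_enorm_ball].
have badP : 0 < Z (r, (x0, x0 - y0)) - Phi (r, (x0, x0 - y0)).
  rewrite /Z /Phi /y_ /= !subrr mulr0 subKr.
  rewrite dotmx00 mulr0 !addr0 subr_gt0//.
have inDom : Dom (r, (x0, x0 - y0)).
  split; first by rewrite /= in_itv/= lexx ltW.
  by split => //=; rewrite subrr /enorm dotmx00 sqrtr0.
have cZ : {within Dom, continuous (fun p => Z p - Phi p)}.
  have c1 : continuous (fun p : R * ('rV[R]_d * 'rV[R]_d) => p.1) by move=> p; exact: cvg_fst.
  have c2 : continuous (fun p : R * ('rV[R]_d * 'rV[R]_d) => p.2.1).
    by move=> p; apply: (@cvg_comp _ _ _ snd fst _ (nbhs p.2)); [exact: cvg_snd|exact: cvg_fst].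
  have c3 : continuous (fun p : R * ('rV[R]_d * 'rV[R]_d) => p.2.2).
    by move=> p; apply: (@cvg_comp _ _ _ snd snd _ (nbhs p.2)); [exact: cvg_snd|exact: cvg_snd].
  have cpair (h : R * ('rV[R]_d * 'rV[R]_d) -> 'rV[R]_d) : continuous h ->
      {within Dom, continuous (fun p => w p.1 (h p))}.
    move=> ch; pose g (p : R * ('rV[R]_d * 'rV[R]_d)) : R * 'rV[R]_d := (p.1, h p).
    have cg : continuous g.
      by move=> p; apply: (@cvg_pair _ _ _ (nbhs p) (nbhs p.1) (nbhs (h p))); [exact: c1|exact: ch].
    have Dg p : Dom p -> [set q : R * 'rV[R]_d | s <= q.1] (g p).
      by move=> [/= ]; rewrite in_itv/= => /andP[].
    exact: (@continuous_within_comp _ _ _ _ _ _ _ cw cg Dg).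
  have cy : continuous y_ by move=> p; exact: (continuousB (c2 p) (c3 p)).
  have cw1 := cpair _ c2; have cw2 := cpair _ cy.
  have c4 : continuous (fun p : R * ('rV[R]_d * 'rV[R]_d) => dotmx (p.2.1 - x0) (p.2.1 - x0)).
    move=> p; have c : {for p, continuous (fun q : R * ('rV[R]_d * 'rV[R]_d) => q.2.1 - x0)}.
      exact: (continuousB (c2 p) (@cst_continuous _ _ x0 p)).
    exact: (continuous_comp c (@continuous_dotmx R 1 d _)).
  have c5 : continuous (fun p : R * ('rV[R]_d * 'rV[R]_d) => dotmx p.2.2 p.2.2 `^ 4^-1).
    have -> : (fun p : R * ('rV[R]_d * 'rV[R]_d) => dotmx p.2.2 p.2.2 `^ 4^-1) =
        (fun p => Num.sqrt (enorm p.2.2)).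
      by apply/funext => q; rewrite powR_quarter ?dotmx_ge0.
    move=> p; exact: (continuous_comp (continuous_comp (c3 p) (@continuous_enorm R 1 d _)) (@sqrt_continuous R _)).
  have cPhi : continuous Phi.
    move=> p; apply: cvgD; first by apply: cvgM; [exact: cvg_cst|exact: c5].
    apply: cvgD; first by apply: cvgM; [exact: cvg_cst|exact: c4].
    apply: cvgM; first exact: cvg_cst.
    by apply: cvgB; [exact: cvg_cst|exact: c1].
  have cPhi' := continuous_subspaceT (A := Dom) cPhi.
  have cU : {within Dom, continuous (fun p => w p.1 p.2.1 - w p.1 (y_ p))}.
    by move=> p; apply: cvgB; [exact: cw1|exact: cw2].
  have cZ : {within Dom, continuous Z}.
    by move=> p; exact: (continuous_comp (cU p) (@continuous_dotmx R m 1 _)).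
  by move=> p; apply: cvgB; [exact: cZ|exact: cPhi'].
have [[t [x z]] /set_mem [/= tin [/= xin zin]] pmax] :=
  compact_EVT_max (ex_intro _ _ inDom) cDom cZ.
rewrite in_itv/= in tin; have /andP[st tr] := tin.
have pos : 0 < Z (t, (x, z)) - Phi (t, (x, z)).
  by apply: lt_le_trans badP (pmax _ (mem_set inDom)).
have wle t' x' : s <= t' <= r -> dotmx (w t' x') (w t' x') <= M0 by exact: wM0.
have ZL : Z (t, (x, z)) <= L.
  rewrite /Z /L /y_ /= (le_trans (sqnormB_le _ _))//.
  by have := wle _ x tin; have := wle _ (x - z) tin; clear; lra.
have q_ge0 : 0 <= dotmx z z `^ 4^-1 by exact: powR_ge0.
have a1 : 0 <= K * dotmx z z `^ 4^-1 by rewrite mulr_ge0.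
have a2 : 0 <= L * dotmx (x - x0) (x - x0) by rewrite mulr_ge0 ?dotmx_ge0.
have a3 : 0 <= L / (r - s) * (r - t) by rewrite mulr_ge0 ?divr_ge0 ?subr_ge0// ltW.
have posE : K * dotmx z z `^ 4^-1 + (L * dotmx (x - x0) (x - x0) + L / (r - s) * (r - t)) < Z (t, (x, z)).
  by move: pos; rewrite subr_gt0.
have z0 : z != 0.
  apply/eqP => z0; move: posE; rewrite /Z /y_ z0 /= subr0 subrr.
  rewrite !dotmx00; move: a1; rewrite z0 dotmx00; move: a2 a3; clear; lra.
have {}st : s < t.
  rewrite lt_neqAle st andbT; apply/eqP => st'; move: posE; rewrite -st' divfK ?gt_eqF//.
  rewrite -st' in ZL; move: a1 a2 ZL; clear; lra.
have x1 : enorm (x - x0) < 1.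
  rewrite lt_neqAle xin andbT; apply/eqP => e1; move: posE.
  have -> : dotmx (x - x0) (x - x0) = 1 by rewrite -sqr_enorm e1 expr1n.
  move: a1 a3 ZL; clear; lra.
have z1 : enorm z < r0.
  rewrite lt_neqAle zin andbT; apply/eqP => e1; move: posE.
  have -> : dotmx z z `^ 4^-1 = g0 by rewrite -sqr_enorm e1.
  move: a2 a3 ZL KL; clear; lra.
have str : s < t <= r by rewrite st.
have xrho : `|x| <= rho + 2.
  rewrite -(subrK x0 x) (le_trans (ler_normD _ _))//.
  have := le_trans (norm_le_enorm (x - x0)) xin; move: x0rho; clear; lra.
have yrho : `|x - z| <= rho + 2.
  rewrite -(subrK x0 x) -addrA (le_trans (ler_normD _ _))//.
  have := le_trans (norm_le_enorm (x - x0)) xin.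
  have := le_trans (norm_le_enorm z) zin.
  have := ler_normB x0 z; move: x0rho r01; clear; lra.
have [Qxs Qxl Qxt Bx Cx] := coef t x str xrho.
have [Qys Qyl Qyt By Cy] := coef t (x - z) str yrho.
have Qxy : forall i j, `|Q t x i j - Q t (x - z) i j| <= eps.
  by apply: Qeps => //; rewrite subKr.
have [n [a [b [aE bE coer barr]]]] :=
  coupling_directions Qxs Qys lam0 Qxl Qxt kapb kapL eps0 epsd Qxy z0.
have [Dx [Xx [jx dx]]] := jw t x str.
have [Dy [Xy [jy dy]]] := jw t (x - z) str.
have z2 : dotmx z z <= 1.
  by rewrite -sqr_enorm expr_le1 ?enorm_ge0// (le_trans zin).
have hmax k : \forall u \near (0 : R),
     dotmx (w t (x + u *: a k) - w t (x - z + u *: b k)) (w t (x + u *: a k) - w t (x - z + u *: b k))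
     - K * dotmx (z + u *: (a k - b k)) (z + u *: (a k - b k)) `^ 4^-1
     - L * dotmx (x - x0 + u *: a k) (x - x0 + u *: a k)
     <= dotmx (w t x - w t (x - z)) (w t x - w t (x - z)) - K * dotmx z z `^ 4^-1
     - L * dotmx (x - x0) (x - x0).
  near=> u.
  have in1 : enorm (x - x0 + u *: a k) < 1 by near: u; exact: near_line_enorm_lt.
  have in2 : enorm (z + u *: (a k - b k)) < r0 by near: u; exact: near_line_enorm_lt.
  have := pmax (t, (x + u *: a k, z + u *: (a k - b k))).
  rewrite /Z /Phi /y_ /=.
  have -> : x + u *: a k - (z + u *: (a k - b k)) = x - z + u *: b k.
    by rewrite scalerBr opprD addrACA opprB [u *: a k + _]addrC subrK.
  rewrite [x + u *: a k - x0]addrAC.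
  move=> pm.
  have dom : (t, (x + u *: a k, z + u *: (a k - b k))) \in Dom.
    apply/mem_set; split; first by rewrite /= in_itv/= (ltW st).
    by split; rewrite /= ?ltW// addrAC.
  have := pm dom; clear; lra.
have hess := doubled_hessian_test (dlt := dlt) z0 z2 (ltW lam0) K0 L0 Qxt aE bE coer barr jx jy hmax.
set U := w t x - w t (x - z) in hess.
have time : 0 <= 2 * dotmx U (system_rhs Q B C t x (w t x) Dx Xx
     - system_rhs Q B C t (x - z) (w t (x - z)) Dy Xy) + L / (r - s).
  have dU := is_derive_sqnorm (w := fun t' => w t' x - w t' (x - z))
    (w' := system_rhs Q B C t x (w t x) Dx Xx - system_rhs Q B C t (x - z) (w t (x - z)) Dy Xy) (t := t).
  have dU1 : is_derive (t : R) 1 (fun t' => dotmx (w t' x - w t' (x - z)) (w t' x - w t' (x - z)))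
      (2 * dotmx U (system_rhs Q B C t x (w t x) Dx Xx - system_rhs Q B C t (x - z) (w t (x - z)) Dy Xy)).
    apply: dU => h; have -> : (fun t' => (w t' x - w t' (x - z)) h 0) = (fun t' => w t' x h 0) - (fun t' => w t' (x - z) h 0).
      by apply/funext => t'; rewrite !mxE.
    by apply: is_derive_eq (is_deriveB (dx h) (dy h)) _; rewrite !mxE.
  have dL : is_derive (t : R) 1 (fun t' => L / (r - s) * (r - t')) (- (L / (r - s))).
    apply: is_derive_eq (is_deriveZ (L / (r - s)) (is_deriveB (is_derive_cst r t 1) (is_derive_id t 1))) _.
    by rewrite sub0r scalerN; congr (- _); exact: mulr1.
  rewrite -[L / (r - s)]opprK.
  apply: (is_derive_left_max (is_deriveB dU1 dL)).
  have near_s : \forall t' \near t, s < t' by exact: lt_nbhsr.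
  near=> t' => tt'.
  have dom : (t', (x, z)) \in Dom.
    apply/mem_set; split; last by [].
    by rewrite /= in_itv/= (le_trans tt' tr) andbT ltW//; near: t'.
  have := pmax _ dom; rewrite /Z /Phi /y_ /= => pm.
  suff : dotmx (w t' x - w t' (x - z)) (w t' x - w t' (x - z)) - L / (r - s) * (r - t') <=
    dotmx (w t x - w t (x - z)) (w t x - w t (x - z)) - L / (r - s) * (r - t) by [].
  move: pm; clear; lra.
have UL : dotmx U U <= L by [].
have Bx1 := coupling_absorbed U Dx d0 m0 dlt0 beta0 Bx.
have By1 : dotmx U (- \sum_j B j t (x - z) *m Dy j) <= dlt * (\sum_j dotmx (Dy j) (Dy j)) + c0 * dotmx U U.
  rewrite dotmxNr -dotmxNl -[X in _ + c0 * X]opprK -dotmxNl -dotmxNr.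
  exact: (coupling_absorbed (- U) Dy d0 m0 dlt0 beta0 By).
have Cx1 := matrix_growth U (w t x) m0 beta0 Cx.
have Cy1 : dotmx U (- (C t (x - z) *m w t (x - z))) <= dotmx (w t (x - z)) (w t (x - z)) + 4^-1 * m%:R ^+ 2 * beta ^+ 2 * dotmx U U.
  rewrite dotmxNr -dotmxNl -[X in _ + _ * X]opprK -dotmxNl -dotmxNr.
  exact: (matrix_growth (- U) (w t (x - z)) m0 beta0 Cy).
move: time; rewrite /system_rhs !opprD.
have zid (V : zmodType) (u1 u2 u3 v1 v2 v3 : V) :
    (u1 + u2 + u3) + (- v1 - v2 - v3) = (u1 - v1) + (u2 - v2) + (u3 - v3).
  by rewrite addrACA [X in X + _ = _]addrACA.
rewrite zid !dotmxDr; move: hess; rewrite dotmxDr.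
have w1 := wle t x (andb_true_intro (conj (ltW st) tr)).
have w2 := wle t (x - z) (andb_true_intro (conj (ltW st) tr)).
have cU : c0 * dotmx U U <= c0 * L by rewrite ler_wpM2l.
have mU : m%:R ^+ 2 * beta ^+ 2 * dotmx U U <= m%:R ^+ 2 * beta ^+ 2 * L.
  by rewrite ler_wpM2l// mulr_ge0 ?sqr_ge0.
rewrite -/c0 in Bx1; move: Klam; rewrite /cst.
move: Bx1 By1 Cx1 Cy1 w1 w2 cU mU UL; rewrite /dlt; clear; lra.
Unshelve. all: by end_near. Qed.

End interior_modulus.

(** * Bounds on compact cylinders *)

Section assumptions.
Context {R : realType}.

Lemma ereal_sup_lty_bound (T : Type) (f : T -> R) (A : set T) :
  (ereal_sup [set (f p)%:E | p in A] < +oo)%E -> exists K, forall p, A p -> f p <= K.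
Proof.
move=> supoo; have ub p : A p -> ((f p)%:E <= ereal_sup [set (f p)%:E | p in A])%E.
  by move=> Ap; apply: ereal_sup_ubound; exists p.
case: (ereal_sup _) supoo ub => [r _ ub|//|_ ub].
  by exists r => p /ub; rewrite lee_fin.
by exists 0 => p /ub; rewrite leeNy_eq.
Qed.

Lemma ereal_inf_gt0_bound (T : Type) (f : T -> R) (A : set T) :
  (0 < ereal_inf [set (f p)%:E | p in A])%E -> exists2 l, 0 < l & forall p, A p -> l <= f p.
Proof.
move=> inf0; have lb p : A p -> (ereal_inf [set (f p)%:E | p in A] <= (f p)%:E)%E.
  by move=> Ap; apply: ereal_inf_lbound; exists p.
case: (ereal_inf _) inf0 lb => [r r0 lb|_ lb|//].
  by exists r => [|p /lb]; rewrite -?lte_fin// lee_fin.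
by exists 1 => // p /lb; rewrite leye_eq.
Qed.

(** Merges the bounds obtained entry by entry into one. *)
Lemma uniform_bound (T : finType) (P : T -> R -> Prop) :
  (forall i a b, a <= b -> P i a -> P i b) ->
  (forall i, exists2 M, 0 <= M & P i M) -> exists2 M, 0 <= M & forall i, P i M.
Proof.
move=> mono ex.
have ex' i : exists M, 0 <= M /\ P i M by have [M] := ex i; exists M.
have [M HM] := choice ex'.
exists (\sum_i M i) => [|i]; first by apply: sumr_ge0 => i _; case: (HM i).
apply: mono (HM i).2; rewrite (bigD1 i)//= lerDl.
by apply: sumr_ge0 => j _; case: (HM j).
Qed.

Context {d : nat}.

Lemma blows_up_min (phi : 'rV[R]_d -> R) : continuous phi -> (forall x, 0 < phi x) ->
  blows_up phi -> exists2 c, 0 < c & forall x, c <= phi x.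
Proof.
move=> cphi phi0 phioo.
have /pinfty_ex_gt0[rho rho0 H] := phioo 1.
have [||x0 _ xmin] := @EVT_min_rV R d phi [set x | enorm x <= rho] _ (@compact_enorm_ball R d rho).
- by exists 0; rewrite /= /enorm dotmx00 sqrtr0 ltW.
- exact: continuous_subspaceT.
exists (Num.min 1 (phi x0)) => [|x]; first by rewrite lt_min ltr01 phi0.
have [xr|/ltW/H x1] := leP (enorm x) rho; last by rewrite ge_min x1.
by rewrite ge_min (xmin x) ?orbT//; apply/mem_set.
Qed.

Lemma segment_sub (I : set R) (s T : R) : open_right_halfline_or_line I ->
  I s -> I T -> `[s, T]%classic `<=` I.
Proof.
move=> [[a ->]|->]//= sI TI t /=; rewrite !in_itv/= !andbT in sI TI * => /andP[st _].
exact: lt_le_trans st.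
Qed.

Lemma segment_bounded (s T : R) : bounded_set `[s, T]%classic.
Proof. exact: compact_bounded (@segment_compact _ s T). Qed.

Lemma segment_is_interval (s T : R) : is_interval `[s, T]%classic.
Proof. exact: interval_is_interval. Qed.

Lemma compact_norm_ball rho : compact [set x : 'rV[R]_d | `|x| <= rho].
Proof.
apply: bounded_closed_compact.
  exists rho; split; first exact: num_real.
  by move=> M M1 x /= x1; rewrite (le_trans x1)// ltW.
exact: (continuous_closedP _).1 (@norm_continuous _ _) _ (@closed_le R rho).
Qed.

Section holder.
Variables (alpha : R) (I : set R) (s T : R).
Hypotheses (alpha0 : 0 < alpha) (sT : s <= T) (IJ : `[s, T]%classic `<=` I).

Lemma holder_cylinder (f : R -> 'rV[R]_d -> R) rho : parabolic_holder_loc alpha I f ->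
  exists2 c, 0 <= c & forall t u x y, s <= t <= T -> s <= u <= T -> `|x| <= rho -> `|y| <= rho ->
    `|f t x - f u y| <= c * (`|t - u| `^ (alpha / 2) + enorm (x - y) `^ alpha).
Proof.
move=> hf; pose K := `[s, T]%classic `*` [set x : 'rV[R]_d | `|x| <= rho].
have [||c Hc] := hf K.
- by apply: compact_setX; [exact: segment_compact|exact: compact_norm_ball].
- by move=> [t x] [/= tin _]; split => //; exact: IJ.
exists `|c| => // t u x y tin uin xr yr.
apply: (le_trans (Hc (t, x) (u, y) _ _)); rewrite /K ?/=; try by split; rewrite //= in_itv.
by rewrite ler_wpM2r ?ler_norm// addr_ge0 ?powR_ge0.
Qed.

Lemma holder_space (f : R -> 'rV[R]_d -> R) rho : parabolic_holder_loc alpha I f ->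
  exists2 c, 0 <= c & forall t x y, s <= t <= T -> `|x| <= rho -> `|y| <= rho ->
    `|f t x - f t y| <= c * enorm (x - y) `^ alpha.
Proof.
move=> /(holder_cylinder rho)[c c0 Hc]; exists c => // t x y tin xr yr.
have := Hc t t x y tin tin xr yr; rewrite subrr normr0 powR0 ?add0r//.
by rewrite gt_eqF// divr_gt0.
Qed.

Lemma holder_bounded (f : R -> 'rV[R]_d -> R) rho : parabolic_holder_loc alpha I f ->
  exists2 M, 0 <= M & forall t x, s <= t <= T -> `|x| <= rho -> `|f t x| <= M.
Proof.
move=> /(holder_cylinder rho)[c c0 Hc].
have [rho0|rho0] := ltP rho 0.
  exists 0 => // t x _ xr; have := lt_le_trans rho0 (normr_ge0 x).
  by rewrite ltNge xr.
pose e := Num.sqrt (d%:R * rho ^+ 2).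
exists (`|f s 0| + c * ((T - s) `^ (alpha / 2) + e `^ alpha)).
  by rewrite addr_ge0// mulr_ge0// addr_ge0 ?powR_ge0.
move=> t x tin xr; rewrite -[f t x](subrK (f s 0)) addrC.
apply: (le_trans (ler_normD _ _)); rewrite lerD2l.
have sin : s <= s <= T by rewrite lexx.
have z0 : `|0 : 'rV[R]_d| <= rho by rewrite normr0.
apply: (le_trans (Hc t s x 0 tin sin xr z0)).
rewrite ler_wpM2l// lerD//.
  rewrite ge0_ler_powR ?nnegrE// ?divr_ge0 ?subr_ge0//; first exact: ltW.
  by rewrite ger0_norm ?subr_ge0 ?lerB//; case/andP: tin.
rewrite ge0_ler_powR ?nnegrE ?enorm_ge0 ?sqrtr_ge0//; first exact: ltW.
rewrite subr0 ler_wsqrtr// (le_trans (dotmx_le_norm _))// mul1n ler_wpM2l//.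
by rewrite lerXn2r ?nnegrE.
Qed.

End holder.

End assumptions.

(** * Consequences of the assumptions on bounded time intervals *)

Section consequences.
Context {R : realType} {d m : nat}.
Variables (I : set R) (alpha : R).
Variables (Q : R -> 'rV[R]_d -> 'M[R]_d).
Variables (B : 'I_d -> R -> 'rV[R]_d -> 'M[R]_m).
Variables (C : R -> 'rV[R]_d -> 'M[R]_m).
Variables (b : 'I_d -> R -> 'rV[R]_d -> R).
Variables (Bt : 'I_d -> R -> 'rV[R]_d -> 'M[R]_m).
Variables (xi : R -> R) (sigma : R).
Hypotheses (d0 : (0 < d)%N) (m0 : (0 < m)%N) (alpha01 : 0 < alpha < 1).
Hypothesis hI : open_right_halfline_or_line I.
Hypothesis hstanding : standing_assumption I alpha Q B C.
Hypothesis hB : assumptionB I alpha Q B C b Bt xi sigma.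

(** A bound on [A phi - mu phi] is turned into a strict inequality by raising
    [mu], since [phi] is bounded away from 0. *)
Lemma strict_lyapunov_exists (s T : R) : I s -> I T ->
  exists mu phi, strict_lyapunov Q b s T mu phi.
Proof.
move=> sI TI; case: hB => _ _ hL.
have sub := segment_sub hI sI TI.
have [mu0 [phi [phiC2 phi0 phioo /ereal_sup_lty_bound[K HK]]]] :=
  hL _ (@segment_is_interval _ s T) (@segment_bounded _ s T) sub.
have cphi : continuous phi by case: phiC2.
have [c c0 phic] := blows_up_min cphi phi0 phioo.
pose K' := `|K| + 1.
have K'0 : 0 < K' by rewrite ltr_wpDl.
exists (mu0 + K' / c), phi; split=> // t x /andP[st tT].
have tin : (`[s, T]%classic `*` [set: 'rV[R]_d]) (t, x).
  by split; rewrite //= in_itv/= (ltW st) tT.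
have := HK _ tin; rewrite /= lerBlDr => /le_lt_trans; apply.
rewrite mulrDl addrC ltrD2l.
apply: (@lt_le_trans _ _ K').
  by rewrite /K'; have := ler_norm K; lra.
by rewrite -mulrA (ler_peMr (ltW K'0))// mulrC ler_pdivlMr// mul1r.
Qed.

Lemma ellipticity : exists2 lam, 0 < lam & forall t x, I t -> lam <= lambdaQ Q t x.
Proof.
case: hstanding => _ _ _ _ /ereal_inf_gt0_bound[lam lam0 H].
by exists lam => // t x tI; have := H (t, x); apply.
Qed.

Lemma dissipative (s T : R) : I s -> I T ->
  exists H, forall t x, s <= t <= T -> dissipative_at Q B C b H t x.
Proof.
move=> sI TI; case: hB => -[_ _ Bsplit [xi0 _] [_ Btle]] hP _.
have sub := segment_sub hI sI TI.
have [H HH] := ereal_sup_lty_bound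
  (hP _ (@segment_is_interval _ s T) (@segment_bounded _ s T) sub).
exists H => t x tin.
have tJ : `[s, T]%classic t by rewrite /= in_itv.
have tI := sub _ tJ.
have [lam0 lam00 Hlam] := ellipticity.
have lam_gt0 : 0 < lambdaQ Q t x := lt_le_trans lam00 (Hlam t x tI).
have Qs : (Q t x)^T = Q t x by case: hstanding => + _ _ _ _; apply.
exists (lambdaQ Q t x), (xi t * lambdaQ Q t x `^ sigma), (fun j => Bt j t x).
split=> //.
- by split=> //; rewrite mulr_ge0 ?powR_ge0// ltW// xi0.
- by split=> // v; exact: min_eigenvalue_le_qform.
- by move=> j; exact: Bsplit.
- by move=> j h k; exact: Btle.
have -> : (xi t * lambdaQ Q t x `^ sigma) ^+ 2 / lambdaQ Q t x =
    xi t ^+ 2 * lambdaQ Q t x `^ (2 * sigma - 1).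
  rewrite exprMn -mulrA; congr (_ * _).
  rewrite powRB; last by rewrite (@gt_eqF _ _ (lambdaQ Q t x))//; apply: implybT.
  by rewrite powRr1 ?(ltW lam_gt0)// [2 * sigma]mulrC powRrM powR_mulrn ?powR_ge0.
by have := HH (t, x); rewrite /LambdaC !mulrA; apply.
Qed.

(** The constants of the modulus of continuity are uniform on a cylinder. The
    fraction [kap] of independent noise is fixed by the ellipticity ratio, the
    admissible oscillation [e1] of the diffusion matrix by [kap], and the
    distance [r0] by its Hoelder continuity. *)
Lemma local_equicontinuity (s r rho M0 eps : R) : I s -> I r -> s < r ->
  0 <= M0 -> 0 < eps -> exists2 del, 0 < del & forall w, jet_solution Q B C s r w ->
    {within [set p : R * 'rV[R]_d | s <= p.1], continuous (fun p => w p.1 p.2)} ->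
    (forall t x, s <= t <= r -> dotmx (w t x) (w t x) <= M0) ->
    forall x0 y0, `|x0| <= rho -> enorm (x0 - y0) <= del ->
    dotmx (w r x0 - w r y0) (w r x0 - w r y0) <= eps.
Proof.
move=> sI rI sr M00 eps0.
have sub := segment_sub hI sI rI.
have alpha0 : 0 < alpha by case/andP: alpha01.
have sler := ltW sr.
case: hstanding => Qs Qh Bh Ch _.
have [lam lam0 Hlam] := ellipticity.
have [qM qM0 HqM] : exists2 M, 0 <= M & forall i : 'I_d, forall t x, s <= t <= r ->
    `|x| <= rho + 2 -> `|Q t x i i| <= M.
  apply: (@uniform_bound _ 'I_d (fun i M => forall t x, s <= t <= r ->
    `|x| <= rho + 2 -> `|Q t x i i| <= M)).
    by move=> i a1 a2 a12 H t x tin xr; apply: le_trans a12; exact: H.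
  move=> i; exact: (holder_bounded alpha0 sler sub (rho + 2) (Qh i i)).
have [bM bM0 HbM] : exists2 M, 0 <= M & forall i : 'I_d * 'I_m * 'I_m, forall t x, s <= t <= r ->
    `|x| <= rho + 2 -> `|B i.1.1 t x i.1.2 i.2| <= M.
  apply: (@uniform_bound _ ('I_d * 'I_m * 'I_m)%type (fun i M => forall t x, s <= t <= r ->
    `|x| <= rho + 2 -> `|B i.1.1 t x i.1.2 i.2| <= M)).
    by move=> i a1 a2 a12 H t x tin xr; apply: le_trans a12; exact: H.
  move=> i; exact: (holder_bounded alpha0 sler sub (rho + 2) (Bh i.1.1 i.1.2 i.2)).
have [cM cM0 HcM] : exists2 M, 0 <= M & forall i : 'I_m * 'I_m, forall t x, s <= t <= r ->
    `|x| <= rho + 2 -> `|C t x i.1 i.2| <= M.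
  apply: (@uniform_bound _ ('I_m * 'I_m)%type (fun i M => forall t x, s <= t <= r ->
    `|x| <= rho + 2 -> `|C t x i.1 i.2| <= M)).
    by move=> i a1 a2 a12 H t x tin xr; apply: le_trans a12; exact: H.
  move=> i; exact: (holder_bounded alpha0 sler sub (rho + 2) (Ch i.1 i.2)).
have [qc qc0 Hqc] : exists2 c, 0 <= c & forall i : 'I_d * 'I_d, forall t x y, s <= t <= r ->
    `|x| <= rho + 2 -> `|y| <= rho + 2 ->
    `|Q t x i.1 i.2 - Q t y i.1 i.2| <= c * enorm (x - y) `^ alpha.
  apply: (@uniform_bound _ ('I_d * 'I_d)%type (fun i c => forall t x y, s <= t <= r ->
    `|x| <= rho + 2 -> `|y| <= rho + 2 ->
    `|Q t x i.1 i.2 - Q t y i.1 i.2| <= c * enorm (x - y) `^ alpha)).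
    move=> i a1 a2 a12 H t x y tin xr yr; apply: le_trans (H _ _ _ tin xr yr) _.
    by rewrite ler_wpM2r ?powR_ge0.
  move=> i; exact: (holder_space alpha0 sub (rho + 2) (Qh i.1 i.2)).
pose Lam := d%:R * qM; have Lam0 : 0 <= Lam by rewrite mulr_ge0.
pose beta := bM + cM; have beta0 : 0 <= beta by rewrite addr_ge0.
pose kap := lam / (8 * (Lam + lam)).
have Ll0 : 0 < Lam + lam by rewrite ltr_wpDl.
have kap0 : 0 < kap by rewrite divr_gt0// mulr_gt0.
have kapE : 8 * kap * (Lam + lam) = lam by rewrite /kap; field; rewrite gt_eqF.
have kap1 : kap <= 8^-1.
  rewrite -(ler_pM2l (_ : 0 < 8 * (Lam + lam))) ?mulr_gt0//.
  have -> : 8 * (Lam + lam) * kap = lam by rewrite -[RHS]kapE; ring.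
  have -> : 8 * (Lam + lam) * 8^-1 = Lam + lam by field.
  lra.
have kapL : 8 * kap * Lam <= lam.
  have k8 : 0 < 8 * kap by exact: mulr_gt0.
  by rewrite -[leRHS]kapE ler_pM2l//; lra.
have d1 : 0 < (d%:R : R) by rewrite ltr0n.
pose e1 := kap * lam / (12 * d%:R).
have kl : 0 < kap * lam by exact: mulr_gt0.
have d12 : 0 < 12 * d%:R :> R by rewrite mulr_gt0.
have e10 : 0 < e1 by exact: divr_gt0.
have e1E : 12 * d%:R * e1 <= kap * lam.
  by rewrite /e1 mulrC divfK// gt_eqF.
pose r0 := Num.min 1 ((e1 / (qc + 1)) `^ alpha^-1).
have qc1 : 0 < qc + 1 by rewrite ltr_wpDl.
have eq0 : 0 < e1 / (qc + 1) by rewrite divr_gt0.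
have r00 : 0 < r0 by rewrite lt_min ltr01 powR_gt0.
have r01 : r0 <= 1 by rewrite ge_min lexx.
have r0a y : 0 <= y -> y <= r0 -> qc * y `^ alpha <= e1.
  move=> y0 yr; apply: (@le_trans _ _ ((qc + 1) * (e1 / (qc + 1)))); last first.
    by rewrite mulrC divfK// gt_eqF.
  apply: ler_pM => //; rewrite ?powR_ge0//; first by lra.
  have -> : e1 / (qc + 1) = ((e1 / (qc + 1)) `^ alpha^-1) `^ alpha.
    by rewrite -powRrM mulVf ?gt_eqF// powRr1 ?ltW.
  rewrite ge0_ler_powR ?nnegrE ?powR_ge0 ?(ltW alpha0)//.
  by apply: le_trans yr _; rewrite ge_min lexx orbT.
have [||||K K0 HK] := @interior_modulus R d m Q B C s r rho lam Lam beta kap e1 r0 M0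
  d0 m0 sr lam0 Lam0 beta0 _ kapL (ltW e10) e1E _ M00.
- by rewrite kap0.
- by rewrite r00.
- move=> t x /andP[st tr] xr; have tin : s <= t <= r by rewrite ltW.
  have tI : I t by apply: sub; rewrite /= in_itv.
  have Qst := Qs t x tI.
  split=> //.
  + move=> v; apply: le_trans (min_eigenvalue_le_qform v Qst).
    by rewrite ler_wpM2r ?dotmx_ge0// Hlam.
  + apply: (@le_trans _ _ (\sum_(i < d) qM)).
      by apply: ler_sum => i _; apply: le_trans (ler_norm _) _; exact: HqM.
    by rewrite sumr_const card_ord /Lam mulr_natl.
  + move=> j h k; apply: (le_trans (HbM (j, h, k) t x tin xr)); rewrite /beta; lra.
  + move=> h k; apply: (le_trans (HcM (h, k) t x tin xr)); rewrite /beta; lra.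
- move=> t x y /andP[st tr] xr yr xy i j; have tin : s <= t <= r by rewrite ltW.
  apply: (le_trans (Hqc (i, j) t x y tin xr yr)).
  by apply: r0a => //; exact: enorm_ge0.
have K1 : 0 < K + 1 by rewrite ltr_wpDl.
have eK : 0 < eps / (K + 1) by rewrite divr_gt0.
exists (Num.min r0 ((eps / (K + 1)) ^+ 2)).
  by rewrite lt_min r00 exprn_gt0.
move=> w jw cw wM x0 y0 x0r; rewrite le_min => /andP[xy1 xy2].
apply: (le_trans (HK w jw cw wM x0 y0 x0r xy1)).
rewrite powR_quarter ?dotmx_ge0// -/(enorm _).
apply: (@le_trans _ _ ((K + 1) * (eps / (K + 1)))); last first.
  by rewrite mulrC divfK// gt_eqF.
apply: ler_pM => //; rewrite ?sqrtr_ge0//; first by lra.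
by rewrite -[leRHS](ger0_norm (ltW eK)) -sqrtr_sqr ler_wsqrtr.
Qed.

End consequences.

(** * A bounded primitive of the inverse of a monotone function *)

Section concave_potential.
Context {R : realType}.
Let mu := @lebesgue_measure R.

Lemma integrable_cst_itv (a b c : R) : mu.-integrable `]a, b] (EFin \o (fun _ => c)).
Proof.
apply/integrableP; split; first exact: measurable_cst.
rewrite /= integral_cst//= lebesgue_measure_itv/=.
by case: ifPn => _; rewrite ?mule0 ?ltry// -EFinB -EFinM ltry.
Qed.

Lemma Rintegral_itv_bounds (f : R -> R) (w w' lo hi : R) : w <= w' ->
  mu.-integrable `]w, w'] (EFin \o f) ->
  (forall y, w < y <= w' -> lo <= f y <= hi) ->
  lo * (w' - w) <= \int[mu]_(y in `]w, w']) f y <= hi * (w' - w).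
Proof.
move=> ww' fi fb.
have cE c : \int[mu]_(y in `]w, w']) c = c * (w' - w).
  rewrite Rintegral_cst//= lebesgue_measure_itv/= lte_fin.
  by move: ww'; rewrite le_eqVlt => /predU1P[->|->]; rewrite ?ltxx ?subrr//= mulr0.
by rewrite -!cE; apply/andP; split; apply: le_Rintegral => //;
  [exact: integrable_cst_itv| | exact: integrable_cst_itv|] => y /=;
  rewrite in_itv/= => /fb/andP[].
Qed.

Variable (g : R -> R).
Hypothesis g_mono : {in `[0, +oo[ &, {homo g : x y / x <= y}}.

Let f y := (g y)^-1.

Lemma integrable_sub_itv (a w w' : R) : a <= w ->
  mu.-integrable `]a, +oo[ (fun y => (f y)%:E) -> mu.-integrable `]w, w'] (EFin \o f).
Proof.
move=> aw; apply: integrableS => // y /=; rewrite !in_itv/= andbT => /andP[wy _].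
exact: le_lt_trans wy.
Qed.

Lemma Rintegral_le_total (a w w' : R) (k : R -> R) : a <= w -> (forall y, 0 <= k y) ->
  mu.-integrable `]a, +oo[ (EFin \o k) ->
  \int[mu]_(y in `]w, w']) k y <= \int[mu]_(y in `]a, +oo[) k y.
Proof.
move=> aw k0 ki.
have sub : `]w, w'] `<=` (`]a, +oo[ : set R).
  move=> y /=; rewrite !in_itv/= andbT => /andP[wy _]; exact: le_lt_trans wy.
have ki' : mu.-integrable `]w, w'] (EFin \o k) by apply: integrableS ki.
rewrite /Rintegral; apply: fine_le.
- exact: integrable_fin_num.
- exact: integrable_fin_num.
- apply: ge0_subset_integral => //; first exact: measurable_int ki.
  by move=> y _; rewrite lee_fin.
Qed.

(** Otherwise [g] is negative on [a, +oo[ and, being monotone, takes its values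
    between [g (a + 1)] and 0 beyond [a + 1]: there [|1 / g|] is bounded below,
    which contradicts integrability. *)
Lemma eventually_positive (a : R) : 0 <= a -> (forall y, a < y -> g y != 0) ->
  mu.-integrable `]a, +oo[ (fun y => (f y)%:E) -> exists2 w, a < w & 0 < g w.
Proof.
move=> a0 gn0 fi; apply: contrapT => neg.
have gneg y : a < y -> g y < 0.
  move=> ay; rewrite lt_neqAle gn0//= leNgt; apply/negP => gy.
  by apply: neg; exists y.
pose c := `|f (a + 1)|.
have a1 : a < a + 1 by rewrite ltrDl.
have c0 : 0 < c by rewrite normr_gt0 invr_eq0 gn0.
have fabs : mu.-integrable `]a, +oo[ (EFin \o (fun y => `|f y|)).
  exact: (integrable_norm fi).
pose J := \int[mu]_(y in `]a, +oo[) `|f y|.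
have cJ n : 0 <= n -> c * n <= J.
  move=> n0; have sub : mu.-integrable `](a + 1), (a + 1 + n)] (EFin \o (fun y => `|f y|)).
    apply: integrableS fabs => // y /=; rewrite !in_itv/= andbT => /andP[wy _].
    exact: lt_trans wy.
  have le1 : c * n <= \int[mu]_(y in `](a + 1), (a + 1 + n)]) `|f y|.
    have -> : c * n = \int[mu]_(y in `](a + 1), (a + 1 + n)]) c.
      rewrite Rintegral_cst//= lebesgue_measure_itv/= lte_fin.
      move: n0; rewrite le_eqVlt => /predU1P[<-|n0]; first by rewrite addr0 ltxx !mulr0.
      by rewrite ltrDl n0 /= addrAC subrr add0r.
    apply: le_Rintegral => //; first exact: integrable_cst_itv.
    move=> y /=; rewrite in_itv/= => /andP[ay _].
    rewrite /c /f !normfV lef_pV2 ?posrE ?normr_gt0 ?gn0//; last exact: lt_trans ay.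
    rewrite !ltr0_norm ?gneg//; last exact: lt_trans ay.
    by rewrite lerN2; apply: g_mono; rewrite ?in_itv/= ?andbT; lra.
  apply: le_trans le1 _; apply: Rintegral_le_total => //; exact: ltW.
have J0 : 0 <= J by have := cJ 0 (lexx 0); rewrite mulr0.
have := cJ ((J + 1) / c).
have -> : c * ((J + 1) / c) = J + 1 by field; rewrite gt_eqF.
have J1 : 0 <= (J + 1) / c by rewrite divr_ge0 ?addr_ge0// ltW.
by move=> /(_ J1); lra.
Qed.

(** [h] is the primitive of [1 / g] from [w0] on, extended by 0 below. Taking
    [w0] far out makes it as small as desired, because [1 / g] is integrable.
    As [1 / g] decreases, [h] is concave beyond [w0]; the last conclusion says
    that its graph lies below the line of slope [1 / g w] through the point of
    abscissa [w]. *)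
Lemma concave_potential (W0 eta : R) :
  (\forall a \near +oo, (forall y, a < y -> g y != 0) /\
        mu.-integrable `]a, +oo[ (fun y => (f y)%:E)) -> 0 < eta ->
  exists (w0 : R) (h : R -> R),
    [/\ W0 <= w0 /\ 0 <= w0, forall w, w0 <= w -> 0 < g w,
        forall w, w <= w0 -> h w = 0,
        forall w, 0 <= h w <= eta &
        continuous h /\ forall w w', w0 < w -> w0 < w' -> h w' - h w <= (w' - w) / g w].
Proof.
move=> [a [_ Ha]] eta0.
pose a1 := Num.max (Num.max 0 W0) (a + 1).
have a1a : a < a1 by rewrite /a1 lt_max ltrDl ltr01 orbT.
have a10 : 0 <= a1 by rewrite /a1 !le_max lexx.
have [gn0 fi1] := Ha _ a1a.
have [a2 a12 ga2] := eventually_positive a10 gn0 fi1.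
have a20 : 0 <= a2 by apply: le_trans a10 (ltW a12).
have gpos w : a2 <= w -> 0 < g w.
  move=> aw; apply: lt_le_trans ga2 (g_mono _ _ aw); rewrite in_itv/= andbT//.
  exact: le_trans aw.
have fi : mu.-integrable `]a2, +oo[ (fun y => (f y)%:E).
  apply: integrableS fi1 => // y /=; rewrite !in_itv/= !andbT; exact: lt_trans.
have fmono w w' : a2 <= w -> w <= w' -> f w' <= f w.
  move=> aw ww'; have aw' := le_trans aw ww'.
  rewrite lef_pV2 ?posrE ?gpos// g_mono// in_itv/= andbT.
    exact: le_trans aw.
  exact: le_trans aw'.
pose H w := \int[mu]_(y in `]a2, w]) f y.
have HB w w' : a2 <= w -> w <= w' -> f w' * (w' - w) <= H w' - H w <= f w * (w' - w).
  move=> aw ww'; rewrite /H Rintegral_itvB; last 3 first.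
  - exact: integrable_sub_itv fi.
  - by rewrite bnd_simp.
  - by rewrite bnd_simp.
  apply: Rintegral_itv_bounds => //; first exact: integrable_sub_itv fi.
  move=> y /andP[wy yw']; rewrite !fmono//; first exact: ltW.
  exact: le_trans (ltW wy).
have f0 w : a2 <= w -> 0 <= f w by move=> aw; rewrite invr_ge0 ltW// gpos.
have Hmono w w' : a2 <= w -> w <= w' -> H w <= H w'.
  move=> aw ww'; have /andP[+ _] := HB _ _ aw ww'; rewrite -subr_ge0; apply: le_trans.
  by rewrite mulr_ge0 ?subr_ge0// f0// (le_trans aw).
pose S := [set H w | w in `[a2, +oo[%classic].
have Sne : S !=set0 by exists (H a2), a2 => //=; rewrite in_itv/= lexx.
have Sub : has_ubound S.
  exists (\int[mu]_(y in `]a2, +oo[) `|f y|) => _ [w /= + <-].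
  rewrite in_itv/= andbT => aw.
  have fabs : mu.-integrable `]a2, +oo[ (EFin \o (fun y => `|f y|)) by exact: (integrable_norm fi).
  apply: (@le_trans _ _ (\int[mu]_(y in `]a2, w]) `|f y|)); last exact: Rintegral_le_total.
  apply: le_Rintegral => //; first exact: integrable_sub_itv fi.
    apply: integrableS fabs => // y /=; rewrite !in_itv/= andbT => /andP[wy _] //.
  by move=> y _; exact: ler_norm.
(* Beyond [w0] the primitive [H] gains less than [eta]. *)
have [_ [w0 /= + <-] Hw0] := sup_adherent eta0 (conj Sne Sub).
rewrite in_itv/= andbT => aw0.
pose h w := H (Num.max w w0) - H w0.
have mw w : w0 <= Num.max w w0 by rewrite le_max lexx orbT.
have amw w : a2 <= Num.max w w0 by exact: le_trans (mw w).
have hmax w : w0 <= w -> h w = H w - H w0 by move=> w0w; rewrite /h max_l.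
have lip x y : x <= y -> 0 <= h y - h x <= f w0 * (y - x).
  move=> xy.
  have mxy : Num.max x w0 <= Num.max y w0 by rewrite ge_max !le_max xy lexx orbT.
  have -> : h y - h x = H (Num.max y w0) - H (Num.max x w0) by rewrite /h; ring.
  have /andP[h1 h2] := HB _ _ (amw x) mxy.
  apply/andP; split; first by rewrite subr_ge0 Hmono.
  apply: (le_trans h2); apply: ler_pM.
  - exact: f0.
  - by rewrite subr_ge0.
  - exact: fmono.
  - by rewrite /Num.max; case: ltP => ?; case: ltP => ?; lra.
exists w0, h; split.
- by split; [apply: le_trans aw0; apply: le_trans (ltW a12); rewrite /a1 !le_max lexx !orbT|exact: le_trans aw0].
- by move=> w ww; apply: gpos; exact: le_trans ww.
- by move=> w ww; rewrite /h max_r// subrr.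
- move=> w; rewrite /h subr_ge0 Hmono//=.
  have : H (Num.max w w0) <= sup S.
    by apply: ub_le_sup => //; exists (Num.max w w0) => //=; rewrite in_itv/= amw.
  by lra.
split.
  move=> x; apply/cvgrPdist_lt => e e0.
  have fw0 : 0 <= f w0 by exact: f0.
  have f1 : 0 < f w0 + 1 by rewrite ltr_wpDl.
  have e'0 : 0 < e / (f w0 + 1) by exact: divr_gt0.
  near=> y.
  have : `|x - y| < e / (f w0 + 1) by near: y; exact: (nbhsx_ballx x _ e'0).
  rewrite ltr_pdivlMr// => H1.
  apply: le_lt_trans H1.
  have [xy|/ltW yx] := leP x y.
    have /andP[l1 l2] := lip _ _ xy.
    rewrite distrC ger0_norm// distrC ger0_norm ?subr_ge0//; apply: (le_trans l2).
    by rewrite mulrC ler_wpM2l ?subr_ge0//; lra.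
  have /andP[l1 l2] := lip _ _ yx.
  rewrite ger0_norm// ger0_norm ?subr_ge0//; apply: (le_trans l2).
  by rewrite mulrC ler_wpM2l ?subr_ge0//; lra.
move=> w w' w0w w0w'.
rewrite (hmax w (ltW w0w)) (hmax w' (ltW w0w')).
have -> : H w' - H w0 - (H w - H w0) = H w' - H w by ring.
rewrite [leRHS]mulrC.
have [ww'|/ltW w'w] := leP w w'.
  by have /andP[_ h2] := HB _ _ (le_trans aw0 (ltW w0w)) ww'; exact: h2.
have /andP[+ _] := HB _ _ (le_trans aw0 (ltW w0w')) w'w; rewrite /f => h1.
lra.
Unshelve. all: by end_near. Qed.

End concave_potential.

(** * Tightness of a compact scalar evolution *)

Section cutoffs.
Context {R : realType} {d : nat}.

Definition cutoff (r : R) (x : 'rV[R]_d) : R := Num.min 1 (Num.max 0 (enorm x - r)).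

Lemma cutoff_bounds r x : 0 <= cutoff r x <= 1.
Proof. by rewrite /cutoff le_min ler01 le_max lexx/= ge_min lexx. Qed.

Lemma cutoff0 r x : enorm x <= r -> cutoff r x = 0.
Proof.
by move=> xr; rewrite /cutoff max_l ?subr_le0// min_r.
Qed.

Lemma cutoff1 r x : r + 1 <= enorm x -> cutoff r x = 1.
Proof. by move=> xr; rewrite /cutoff min_l// le_max lerBrDl xr orbT. Qed.

Lemma Cb_cutoff r : Cb (cutoff r).
Proof.
split; last first.
  exists 1; split=> // M M1 x _; have /andP[c0 c1] := cutoff_bounds r x.
  by rewrite /= ger0_norm// (le_trans c1)// ltW.
move=> x.
have c1 : {for x, continuous (fun y : 'rV[R]_d => enorm y - r)}.
  exact: (continuousB (@continuous_enorm R 1 d x) (@cst_continuous _ _ (r : R) x)).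
have c2 := continuous_max (@cst_continuous _ _ (0 : R) x) c1.
exact: continuous_min (@cst_continuous _ _ (1 : R) x) c2.
Qed.

Lemma classical_bounded (V : normedModType R) A s T f (u : R -> 'rV[R]_d -> V) :
  bounded_classical_solution A s f u -> s < T ->
  exists2 P, 0 <= P & forall t x, s <= t <= T -> `|u t x| <= P.
Proof.
move=> [_ _ bu _ _] sT; have [P [_ HP]] := bu T sT.
exists (`|P| + 1) => [|t x tin]; first by rewrite addr_ge0.
apply: (HP (`|P| + 1) _ (t, x)) => //.
by rewrite (le_lt_trans (ler_norm P))// ltrDl.
Qed.

(** In terms of the transition kernel of [G], the measures with index [x] at
    time [t] are tight, uniformly in [x]. *)
Definition tight (G : R -> R -> ('rV[R]_d -> R) -> 'rV[R]_d -> R) t s : Prop :=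
  forall eps : R, 0 < eps -> exists r, forall x, G t s (cutoff r) x <= eps.

End cutoffs.

Section tightness.
Context {R : realType} {d m : nat}.
Variables (I : set R) (alpha : R).
Variables (Q : R -> 'rV[R]_d -> 'M[R]_d).
Variables (B : 'I_d -> R -> 'rV[R]_d -> 'M[R]_m).
Variables (C : R -> 'rV[R]_d -> 'M[R]_m).
Variables (b : 'I_d -> R -> 'rV[R]_d -> R).
Variables (Bt : 'I_d -> R -> 'rV[R]_d -> 'M[R]_m).
Variables (xi : R -> R) (sigma : R).
Variable (G : R -> R -> ('rV[R]_d -> R) -> 'rV[R]_d -> R).
Hypothesis hI : open_right_halfline_or_line I.
Hypothesis hstanding : standing_assumption I alpha Q B C.
Hypothesis hB : assumptionB I alpha Q B C b Bt xi sigma.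
Hypothesis hG : evolution_operator (scalar_operator Q b) I G.

Lemma segment_elliptic (s T t : R) x : I s -> I T -> s <= t <= T ->
  (Q t x)^T = Q t x /\ psd (Q t x).
Proof.
move=> sI TI tin; have [H HH] := dissipative hI hstanding hB sI TI.
exact: dissipative_psd (HH t x tin).
Qed.

(** Far cutoffs are dominated by a small multiple of the Lyapunov function, a
    relation that the evolution preserves. Hence their evolutions tend to 0
    locally uniformly. *)
Lemma cutoff_solution_le (s T mu k : R) phi : I s -> I T -> s < T ->
  strict_lyapunov Q b s T mu phi -> 0 < k ->
  exists r0, forall r, r0 <= r -> forall t x, s <= t <= T ->
    G t s (cutoff r) x <= k * expR (mu * (t - s)) * phi x.
Proof.
move=> sI TI sT lyap k0; have [phiC2 phi0 phioo Aphi] := lyap.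
have /pinfty_ex_gt0[r0 _ Hr0] := phioo k^-1.
exists r0 => r r0r t1 x1 t1in.
have sol := hG sI (Cb_cutoff r).
have [P P0 HP] := classical_bounded sol sT.
have [Cv cv bv veq v0] := sol.
apply: (@weak_maximum_principle R d Q b s T mu phi (fun t x => G t s (cutoff r) x) P k) => //.
- by move=> t x /andP[st tT]; apply: (@segment_elliptic s T) => //; rewrite ltW.
- by move=> t x tin; apply: le_trans (ler_norm _) _; exact: HP.
- move=> x; rewrite v0; have [xr|/ltW xr] := leP (enorm x) r.
    by rewrite cutoff0// mulr_ge0 ?ltW.
  have /andP[_ c1] := cutoff_bounds r x; apply: (le_trans c1).
  by rewrite -ler_pdivrMl// mulr1; apply: Hr0; exact: le_trans r0r xr.
move=> t x /andP[st tT] _.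
have [Qs _] := @segment_elliptic s T t x sI TI (introT andP (conj (ltW st) tT)).
have dv := C12_after_time x Cv st; rewrite veq// scalar_operatorE// in dv.
exact: (subsolution_at_self dv (hasjet_C2 x (C12_after_C2 Cv st))).
Qed.

(** The images of the cutoffs have a cluster point for uniform convergence. It
    vanishes, because these images tend to 0 pointwise; so one of them is
    uniformly small. *)
Lemma compact_tight (s t : R) : I s -> I t -> s < t ->
  compact_operator (G t s) -> tight G t s.
Proof.
move=> sI tI st [_ cG] eps eps0.
have [mu [phi lyap]] := strict_lyapunov_exists hI hB sI tI.
have [phiC2 phi0 _ _] := lyap.
pose F := [set (cutoff n%:R : 'rV[R]_d -> R) | n in [set: nat]].
have FCb : F `<=` Cb by move=> _ [n _ <-]; exact: Cb_cutoff.
have Fb : exists M : R, forall f x, F f -> `|f x| <= M.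
  exists 1 => _ x [n _ <-]; have /andP[c0 c1] := cutoff_bounds n%:R x.
  by rewrite ger0_norm.
have := cG F FCb Fb; rewrite precompactE => cpt.
pose v n : {uniform 'rV[R]_d -> R} := G t s (cutoff n%:R).
have vin : (v @ \oo) (closure (G t s @` F : set {uniform 'rV[R]_d -> R})).
  exists 0%N => // n _ /=; apply: subset_closure.
  by exists (cutoff n%:R) => //; exists n.
have [g [_ gcl]] := cpt _ _ vin.
pose U := [set h : {uniform 'rV[R]_d -> R} | forall x, `|g x - h x| < eps / 3].
have e3 : 0 < eps / 3 by rewrite divr_gt0.
have gU : nbhs g U.
  apply/uniform_nbhs; exists [set p | ball p.1 (eps / 3) p.2]; split.
    by rewrite -entourage_ballE; exists (eps / 3).
  by move=> h /= H x; exact: (H x Logic.I).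
have often N : exists2 n, (N <= n)%N & U (v n).
  have tail : (v @ \oo) [set h | exists2 n, (N <= n)%N & h = v n].
    by exists N => // n /= Nn; exists n.
  by have [h [[n Nn ->] Uh]] := gcl _ _ tail gU; exists n.
have gle x : g x <= 2 * (eps / 3).
  pose k := eps / 3 / (expR (mu * (t - s)) * phi x).
  have ep0 : 0 < expR (mu * (t - s)) * phi x by rewrite mulr_gt0// expR_gt0.
  have k0 : 0 < k by rewrite divr_gt0.
  have [r0 Hr0] := cutoff_solution_le sI tI st lyap k0.
  have [n nr Un] := often (Num.truncn `|r0|).+1.
  have r0n : r0 <= n%:R.
    apply: (le_trans (ler_norm _)); apply: ltW.
    by apply: lt_le_trans (truncnS_gt `|r0|) _; rewrite ler_nat.
  have tin : s <= t <= t by rewrite lexx andbT ltW.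
  have := Hr0 _ r0n t x tin; rewrite -mulrA /k divfK ?gt_eqF// => H1.
  have := Un x; rewrite ltr_norml => /andP[_ H2]; rewrite /v in H2; lra.
have [n _ Un] := often 0%N.
exists n%:R => x; have := Un x; have := gle x; rewrite ltr_norml => H1 /andP[H2 _].
rewrite /v in H2; lra.
Qed.

End tightness.

(** * Tightness from a superlinear Lyapunov function *)

Section lyapunov_tightness.
Context {R : realType} {d m : nat}.
Variables (I : set R) (alpha : R).
Variables (Q : R -> 'rV[R]_d -> 'M[R]_d).
Variables (B : 'I_d -> R -> 'rV[R]_d -> 'M[R]_m).
Variables (C : R -> 'rV[R]_d -> 'M[R]_m).
Variables (b : 'I_d -> R -> 'rV[R]_d -> R).
Variables (Bt : 'I_d -> R -> 'rV[R]_d -> 'M[R]_m).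
Variables (xi : R -> R) (sigma : R).
Variable (G : R -> R -> ('rV[R]_d -> R) -> 'rV[R]_d -> R).
Hypothesis hI : open_right_halfline_or_line I.
Hypothesis hstanding : standing_assumption I alpha Q B C.
Hypothesis hB : assumptionB I alpha Q B C b Bt xi sigma.
Hypothesis hG : evolution_operator (scalar_operator Q b) I G.

Lemma bounded_on_enorm_ball (f : 'rV[R]_d -> R) (rho : R) : continuous f ->
  exists2 P, 0 < P & forall x, enorm x <= rho -> f x <= P.
Proof.
move=> cf; have [rho0|rho0] := ltP rho 0.
  exists 1 => // x; have := enorm_ge0 x; lra.
have [||x0 _ xmax] := @EVT_max_rV R d f [set x | enorm x <= rho] _ (@compact_enorm_ball R d rho).
- by exists 0; rewrite /= /enorm dotmx00 sqrtr0.
- exact: continuous_subspaceT.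
exists (`|f x0| + 1) => [|x xr]; first by rewrite ltr_wpDl.
have := xmax x (mem_set xr); have := ler_norm (f x0); lra.
Qed.

(** With [h] the small primitive of [1 / g], the function [h o W] lies in
    [0, eps / (2 A)] and its image under the elliptic operator is at most -1
    where [W > w0], in the sense of test functions. Hence
    [eps / 2 + A h(W) + 1 - A (u - s)] is a supersolution there, dominates the
    cutoff at [u = s], and where [W <= w0], a bounded region, it dominates the
    evolution of a far cutoff by [cutoff_solution_le]. The choice
    [A = 1 / (t - s)] makes it at most [eps] at [u = t]. *)
Lemma lyapunov_tight (W : 'rV[R]_d -> R) (r : R) (g : R -> R) (s t : R) :
  lyapunov_superlinear I Q b W r g -> I s -> I t -> s < t -> tight G t s.
Proof.
have gain (p1 p2 s1 s2 c a : R) : c * p2 + c * s2 <= - a ->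
    p1 + s1 + a <= p1 + - c * p2 + (s1 + - c * s2) by lra.
move=> [[WC2 Woo] [_ gmono] gint AW] sI tI st eps eps0.
have [mu [phi lyap]] := strict_lyapunov_exists hI hB sI tI.
have [phiC2 phi0 phioo _] := lyap.
have cW : continuous W by case: WC2.
have cphi : continuous phi by case: phiC2.
have [W0 _ HW0] := bounded_on_enorm_ball r cW.
pose A := (t - s)^-1.
have ts0 : 0 < t - s by rewrite subr_gt0.
have A0 : 0 < A by rewrite invr_gt0.
have eta0 : 0 < eps / 2 / A by rewrite divr_gt0// divr_gt0.
have [w0 [h [[W0w0 w00] gpos h0 hb [ch hchord]]]] := concave_potential gmono W0 gint eta0.
have [rho rhoP] : exists rho, forall x, rho <= enorm x -> w0 + 1 <= W x.
  by have /pinfty_ex_gt0[rho _] := Woo (w0 + 1); exists rho.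
have lowball x : W x <= w0 -> enorm x <= rho.
  by move=> Wx; rewrite leNgt; apply/negP => /ltW/rhoP; lra.
have [P P0 HP] := bounded_on_enorm_ball rho cphi.
pose em := expR (`|mu| * (t - s)).
have em0 : 0 < em by exact: expR_gt0.
have emP : 0 < em * P by rewrite mulr_gt0.
pose k := eps / 2 / (em * P).
have k0 : 0 < k by rewrite divr_gt0// divr_gt0.
have [r0 Hr0] := cutoff_solution_le hI hstanding hB hG sI tI st lyap k0.
exists r0 => x1.
have low u x : s <= u <= t -> W x <= w0 -> G u s (cutoff r0) x <= eps / 2.
  move=> uin Wx; apply: (le_trans (Hr0 r0 (lexx _) u x uin)).
  have -> : eps / 2 = k * em * P by rewrite /k -mulrA divfK// gt_eqF.
  have /andP[su ut] := uin.
  apply: ler_pM; [|exact: ltW| |exact: HP (lowball _ Wx)].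
    by rewrite mulr_ge0// ?ltW// expR_gt0.
  rewrite ler_pM2l// ler_expR.
  apply: (@le_trans _ _ (`|mu| * (u - s))).
    by rewrite ler_wpM2r ?subr_ge0// ler_norm.
  by rewrite ler_wpM2l// lerB.
have sol := hG sI (Cb_cutoff r0).
have [Pv Pv0 HPv] := classical_bounded sol st.
have [Cv cv bv veq v0] := sol.
pose Theta u x := G u s (cutoff r0) x + (- (eps / 2 + A * h (W x) + 1 - (u - s) * A)).
suff : Theta t x1 <= 0.
  rewrite /Theta mulfV ?gt_eqF// => H1.
  have /andP[_ h2] := hb (W x1).
  have : A * h (W x1) <= eps / 2.
    by rewrite mulrC -ler_pdivlMr.
  lra.
have hW0 x : 0 <= A * h (W x) by rewrite mulr_ge0 ?(ltW A0)//; have /andP[] := hb (W x).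
have time01 u : s <= u <= t -> 0 <= (u - s) * A <= 1.
  move=> /andP[su ut]; rewrite mulr_ge0 ?subr_ge0 ?(ltW A0)//=.
  by rewrite ler_pdivrMr// mul1r lerB.
apply: (@weak_maximum_principle0 R d Q b s t mu phi Theta Pv) => //; last by rewrite lexx andbT ltW.
- by move=> u x /andP[su ut]; apply: (segment_elliptic hI hstanding hB x sI tI); rewrite ltW.
- have chW : {within [set p : R * 'rV[R]_d | s <= p.1],
      continuous (fun p => - (eps / 2 + A * h (W p.2) + 1 - (p.1 - s) * A))}.
    apply: continuous_subspaceT => p.
    have c1 : {for p, continuous (fun q : R * 'rV[R]_d => h (W q.2))}.
      have c0 : {for p, continuous (@snd R 'rV[R]_d)} by exact: cvg_snd.
      exact: (continuous_comp (continuous_comp c0 (cW _)) (ch _)).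
    apply: cvgN; apply: cvgB.
      apply: cvgD; last exact: cvg_cst.
      by apply: cvgD; [exact: cvg_cst|apply: cvgM; [exact: cvg_cst|exact: c1]].
    apply: cvgM; last exact: cvg_cst.
    by apply: cvgB; [exact: cvg_fst|exact: cvg_cst].
  by move=> p; apply: cvgD; [exact: cv|exact: chW].
- move=> u x uin; rewrite /Theta; have := hW0 x; have /andP[_ u1] := time01 u uin.
  have := ler_norm (G u s (cutoff r0) x); have := HPv u x uin.
  have : 0 < eps / 2 by rewrite divr_gt0.
  lra.
- move=> x; rewrite /Theta v0 subrr mul0r subr0.
  have /andP[_ c1] := cutoff_bounds r0 x; have := hW0 x.
  have : 0 < eps / 2 by rewrite divr_gt0.
  lra.
move=> u x /andP[su ut] Theta0.
have uin : s <= u <= t by rewrite ltW.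
have uI : I u by apply: (segment_sub hI sI tI); rewrite /= in_itv.
have [Wlow|Whigh] := leP (W x) w0.
  move: Theta0; rewrite /Theta ltNge => /negP; case.
  have := low u x uin Wlow; have /andP[_ u1] := time01 u uin; have := hW0 x; lra.
have [Qs _] := segment_elliptic hI hstanding hB x sI tI uin.
have g0 : 0 < g (W x) by apply: gpos; exact: ltW.
have AWx : scalar_operator Q b u W x <= - g (W x).
  apply: AW => // xr; have := HW0 x (ltW xr); lra.
have dv := C12_after_time x Cv su; rewrite veq// in dv.
have dt : is_derive (u : R) 1 (fun q => G q s (cutoff r0) x + (q - s) * A)
    (scalar_operator Q b u (G u s (cutoff r0)) x + A).
  have dl : is_derive (u : R) 1 (fun q => (q - s) * A) A.
    apply: is_derive_eq (is_deriveM (is_deriveB (is_derive_id u 1) (is_derive_cst s u 1)) (is_derive_cst A u 1)) _.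
    by rewrite scaler0 add0r subr0; exact: mulr1.
  exact: is_deriveD.
have jx := hasjetD (hasjet_C2 x (C12_after_C2 Cv su)) (hasjetZ (- (A / g (W x))) (hasjet_C2 x WC2)).
apply: (subsolution_at_touch dt _ jx).
- by near=> q => qu; rewrite /Theta /=; lra.
(* In space the test function replaces [h o W] by the multiple
   [W / g (W x)] of [W]: by concavity the difference is maximal at [x]. *)
- have near_high : \forall y \near x, w0 < W y.
    exact: (cW x _ (lt_nbhsr Whigh)).
  near=> y.
  have Wy : w0 < W y by near: y.
  have := ler_wpM2l (ltW A0) (hchord _ _ Whigh Wy).
  by rewrite /Theta /=; lra.
rewrite !scalar_operatorE// in AWx *.
under [X in _ <= _ + X]eq_bigr do rewrite mulrDr [b _ u x * (- _ * _)]mulrCA.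
rewrite big_split/= -mulr_sumr pairingD pairingZ.
have Ag0 : 0 < A / g (W x) by rewrite divr_gt0.
have := ler_wpM2l (ltW Ag0) AWx.
rewrite mulrN divfK ?gt_eqF// mulrDr.
exact: gain.
Unshelve. all: by end_near. Qed.

End lyapunov_tightness.

(** * Total boundedness and compactness of the system evolution *)

Section total_boundedness.
Context {R : realType}.

Lemma rV_ball_net n (rho del : R) : 0 < del ->
  exists k (c : 'I_k -> 'rV[R]_n), forall x : 'rV[R]_n, `|x| <= rho -> exists i, `|x - c i| < del.
Proof.
move=> del0; have := @compact_norm_ball R n rho; rewrite compact_cover.
move=> /(_ 'rV[R]_n setT (fun c => ball c del))[].
- by move=> c _; exact: ball_open.
- by move=> x _; exists x => //; exact: ballxx.
move=> D _ cov; pose s : seq 'rV[R]_n := finmap.enum_fset D.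
exists (size s), (fun i => nth 0 s i) => x /cov[c /= cD xc].
have cs : (index c s < size s)%N by rewrite index_mem.
exists (Ordinal cs); rewrite /= nth_index//.
by move: xc; rewrite -ball_normE /= distrC.
Qed.

(** An ultrafilter on the closure of [A] concentrates, for each [eps], on the
    functions close to one member of a finite net. So it is pointwise Cauchy,
    and its pointwise limit is uniform. *)
Lemma totally_bounded_precompact (T : choiceType) (V : normedModType R)
    (A : set (T -> V)) :
  (forall F : set_system V, ProperFilter F -> cauchy F -> cvg F) ->
  (forall eps : R, 0 < eps -> exists n (g : 'I_n -> (T -> V)),
     forall h, A h -> exists i, forall x, `|h x - g i x| <= eps) ->
  precompact (A : set {uniform T -> V}).
Proof.
move=> Vcomplete tb; rewrite precompactE compact_ultra => F UF FA.
have PF : ProperFilter F by exact: ultra_proper.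
have small eps : 0 < eps -> exists g : T -> V, F [set h : {uniform T -> V} | forall x, `|h x - g x| <= eps].
  move=> eps0; have e2 : 0 < eps / 2 by rewrite divr_gt0.
  have [n [g Hg]] := tb _ e2.
  apply: contrapT => none.
  have Fc i : F (~` [set h : {uniform T -> V} | forall x, `|h x - g i x| <= eps]).
    have [Fi|//] := in_ultra_setVsetC [set h : {uniform T -> V} | forall x, `|h x - g i x| <= eps] UF.
    by exfalso; apply: none; exists (g i).
  have Fall : F [set h : {uniform T -> V} | forall i, ~ (forall x, `|h x - g i x| <= eps)].
    exact: filter_forall.
  have [h [/= hcl hno]] := filter_ex (filterI FA Fall).
  have nb : nbhs (h : {uniform T -> V}) [set h' : {uniform T -> V} | forall x, `|h x - h' x| < eps / 2].
    apply/uniform_nbhs; exists [set p | ball p.1 (eps / 2) p.2]; split.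
      by rewrite -entourage_ballE; exists (eps / 2).
    by move=> h' /= H x; have := H x Logic.I; rewrite -ball_normE.
  have [h' [Ah' /= hh']] := hcl _ nb.
  have [i Hi] := Hg _ Ah'.
  apply: (hno i) => x; rewrite -[h x](subrK (h' x)) -addrA (splitr eps).
  by apply: le_trans (ler_normD _ _) _; rewrite lerD// ltW.
have cv x : cvg ((fun h : {uniform T -> V} => h x) @ F).
  apply: Vcomplete; apply: cauchy_exP => e e0.
  have e2 : 0 < e / 2 by rewrite divr_gt0.
  have [g Fg] := small _ e2; exists (g x).
  suff : F [set h : {uniform T -> V} | ball (g x) e (h x)] by [].
  apply: (@filterS _ F _ _ _ _ Fg) => h /= Hh.
  rewrite -ball_normE /= distrC; apply: le_lt_trans (Hh x) _; lra.
pose l x := lim ((fun h : {uniform T -> V} => h x) @ F).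
have Fl : F --> (l : {uniform T -> V}).
  move=> U /uniform_nbhs[E [entE EU]]; change (F U); apply: (filterS EU).
  have [e /= e0 He] : exists2 e : R, 0 < e & [set p : V * V | ball p.1 e p.2] `<=` E.
    by move: entE; rewrite -entourage_ballE => -[e e0 ?]; exists e.
  have e3 : 0 < e / 3 by rewrite divr_gt0.
  have [g Fg] := small _ e3.
  have lg x : `|l x - g x| <= e / 3.
    have c1 : (fun h : {uniform T -> V} => `|h x - g x|) @ F --> `|l x - g x|.
      by apply: cvg_norm; apply: cvgB; [exact: cv|exact: cvg_cst].
    rewrite -(cvg_lim _ c1)//; apply: limr_le; first exact: cvgP c1.
    by apply: (filterS _ Fg) => h; exact.
  apply: (filterS _ Fg) => h /= Hh x _.
  apply: He => /=; rewrite -ball_normE /=.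
  rewrite -[l x](subrK (g x)) -addrA; apply: le_lt_trans (ler_normD _ _) _.
  have := Hh x; have := lg x; rewrite [`|g x - h x|]distrC; lra.
exists l; split => //.
exact: (@closed_cvg _ _ F _ id _ (@closed_closure _ _) FA l Fl).
Qed.

End total_boundedness.

Section main.
Context {R : realType} {d m : nat}.
Variables (I : set R) (alpha : R).
Variables (Q : R -> 'rV[R]_d -> 'M[R]_d).
Variables (B : 'I_d -> R -> 'rV[R]_d -> 'M[R]_m).
Variables (C : R -> 'rV[R]_d -> 'M[R]_m).
Variables (b : 'I_d -> R -> 'rV[R]_d -> R).
Variables (Bt : 'I_d -> R -> 'rV[R]_d -> 'M[R]_m).
Variables (xi : R -> R) (sigma : R).
Variable (GG : R -> R -> ('rV[R]_d -> 'cV[R]_m) -> 'rV[R]_d -> 'cV[R]_m).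
Variable (G : R -> R -> ('rV[R]_d -> R) -> 'rV[R]_d -> R).
Hypotheses (d0 : (0 < d)%N) (m0 : (0 < m)%N) (alpha01 : 0 < alpha < 1).
Hypothesis hI : open_right_halfline_or_line I.
Hypothesis hstanding : standing_assumption I alpha Q B C.
Hypothesis hB : assumptionB I alpha Q B C b Bt xi sigma.
Hypothesis hGG : evolution_operator (system_operator Q B C) I GG.
Hypothesis hG : evolution_operator (scalar_operator Q b) I G.

Lemma sqnorm_bounded (V : 'cV[R]_m) P : `|V| <= P -> dotmx V V <= m%:R * P ^+ 2.
Proof.
move=> VP; apply: (le_trans (dotmx_le_norm _)); rewrite muln1 ler_wpM2l//.
by rewrite lerXn2r ?nnegrE// (le_trans _ VP).
Qed.

(** The comparison with the zero solution of the scalar equation, the data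
    entering through the constant. *)
Lemma system_solution_bound (s t M : R) : I s -> I t -> s < t -> 0 <= M ->
  exists2 M1, 0 <= M1 & forall f, Cb f -> (forall x, `|f x| <= M) ->
    forall u x, s <= u <= t -> dotmx (GG u s f x) (GG u s f x) <= M1.
Proof.
move=> sI tI st M0; have [H HH] := dissipative hI hstanding hB sI tI.
have [mu [phi lyap]] := strict_lyapunov_exists hI hB sI tI.
exists (expR (`|2 * H| * (t - s)) * (m%:R * M ^+ 2)).
  by rewrite mulr_ge0 ?expR_ge0// mulr_ge0// sqr_ge0.
move=> f fCb fM u x uin.
have sol := hGG sI fCb; have [P P0 HP] := classical_bounded sol st.
have [_ cw _ _ w0] := sol.
have zCb : Cb (fun _ : 'rV[R]_d => 0 : R).
  split; first exact: cst_continuous.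
  by exists 0; split=> // K K0 y _; rewrite /= normr0 ltW.
have diss v y : s < v <= t -> dissipative_at Q B C b H v y.
  by move=> /andP[sv vt]; apply: HH; rewrite ltW.
have wP v y : s <= v <= t -> dotmx (GG v s f y) (GG v s f y) <= m%:R * P ^+ 2.
  by move=> vin; apply: sqnorm_bounded; exact: HP.
have ws y : dotmx (GG s s f y) (GG s s f y) <= m%:R * M ^+ 2 + 0 * 0.
  by rewrite mul0r addr0 w0; exact: sqnorm_bounded.
apply: (le_trans (sqnorm_comparison d0 m0 st diss lyap (jet_solution_classical sol) cw wP
  (hG sI zCb) (lexx 0) ws x uin)).
have /andP[su ut] := uin.
rewrite mul0r addr0 ler_wpM2r ?mulr_ge0 ?sqr_ge0// ler_expR.
apply: (@le_trans _ _ (`|2 * H| * (u - s))).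
  by rewrite ler_wpM2r ?subr_ge0// ler_norm.
by rewrite ler_wpM2l// lerB.
Qed.

Lemma sqnorm3_le (u v w : 'cV[R]_m) :
  dotmx (u + v + w) (u + v + w) <= 3 * (dotmx u u + dotmx v v + dotmx w w).
Proof.
have := dotmx_ge0 (u - v); have := dotmx_ge0 (v - w); have := dotmx_ge0 (u - w).
rewrite !(dotmxDl, dotmxDr, dotmxNl, dotmxNr) (dotmxC v u) (dotmxC w u) (dotmxC w v); lra.
Qed.

(** The solutions with data in a bounded set are bounded and, at the
    intermediate time [r], equicontinuous on balls; so finitely many of them
    approximate all the others at time [r] on a ball of radius [rho]. Outside
    this ball their differences are merely bounded, but by comparison from [r]
    to [t] this part is multiplied by the evolution of a far cutoff, which
    tightness makes small at time [t], uniformly in space. *)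
Lemma tight_system_compact (s r t : R) : I s -> I r -> I t -> s < r -> r < t ->
  tight G t r -> compact_operator (GG t s).
Proof.
move=> sI rI tI sr rt tightG; have st := lt_trans sr rt.
split=> [f fCb|F FCb [M0 FM0]].
  have sol := hGG sI fCb; have [P P0 HP] := classical_bounded sol st.
  have [Cw _ _ _ _] := sol; split; first by case: (C12_after_C2 Cw st).
  exists P; split; first exact: num_real.
  move=> K PK x _; apply: (le_trans (HP t x _)); last exact: ltW.
  by rewrite lexx andbT ltW.
pose M := `|M0|.
have FM f x : F f -> `|f x| <= M by move=> Ff; apply: le_trans (FM0 f x Ff) (ler_norm _).
have [M1 M10 HM1] := system_solution_bound sI tI st (normr_ge0 M0).
have wM1 f u x : F f -> s <= u <= t -> dotmx (GG u s f x) (GG u s f x) <= M1.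
  by move=> Ff uin; apply: HM1 => //; [exact: FCb|move=> y; exact: FM].
apply: totally_bounded_precompact => [*|eps eps0]; first exact: cauchy_cvg.
have [H HH] := dissipative hI hstanding hB rI tI.
have [mu [phi lyap]] := strict_lyapunov_exists hI hB rI tI.
pose E := expR (`|2 * H| * (t - r)); have E0 : 0 < E by exact: expR_gt0.
(* [dl] is the admissible squared distance at time [r]; a second share [dl] is
   spent on the mass outside the ball, via [4 * M1 * e' <= dl]. *)
pose dl := eps ^+ 2 / (2 * E).
have dl0 : 0 < dl by rewrite divr_gt0 ?exprn_gt0// mulr_gt0.
have M41 : 0 < 4 * M1 + 1 by rewrite ltr_wpDl// mulr_ge0.
pose e' := dl / (4 * M1 + 1); have e'0 : 0 < e' by exact: divr_gt0.
have [N HN] := tightG _ e'0.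
pose rho := N + 1.
(* On the ball, [dl] is split into three increments of squared size [dl / 9],
   because |u + v + w|^2 <= 3 (|u|^2 + |v|^2 + |w|^2): from a point to a node
   of the net, between two solutions at the node, and back. *)
have e00 : 0 < dl / 9 by rewrite divr_gt0.
have [del del0 Hdel] := local_equicontinuity d0 m0 alpha01 hI hstanding rho sI rI sr M10 e00.
have d1 : 0 < (d%:R : R) by rewrite ltr0n.
have m1 : 0 < (m%:R : R) by rewrite ltr0n.
have dd0 : 0 < del / d%:R by exact: divr_gt0.
have [k [c Hc]] := rV_ball_net d rho dd0.
(* Two families of node values at distance [2 dv] for the maximum norm differ
   by [m (2 dv)^2 = dl / 9] at most at each node. *)
pose dv := Num.sqrt (dl / 9 / (4 * m%:R)).
have q0 : 0 < dl / 9 / (4 * m%:R) by apply: divr_gt0 => //; exact: mulr_gt0.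
have dv0 : 0 < dv by rewrite sqrtr_gt0.
have [n [e He]] := rV_ball_net (k * m)%N (Num.sqrt M1) dv0.
pose vec f : 'rV[R]_(k * m) := mxvec (\matrix_(i < k, h < m) GG r s f (c i) h 0).
have srt : s <= r <= t by rewrite !ltW.
have vecM f : F f -> `|vec f| <= Num.sqrt M1.
  move=> Ff; apply: mx_norm_le; first exact: sqrtr_ge0.
  move=> i p; rewrite (ord1 i); case/mxvec_indexP: p => a h; rewrite mxvecE mxE.
  apply: (le_trans (entry_le_enorm _ _ _)); rewrite ler_wsqrtr//.
  exact: wM1.
(* The centres of the net need not come from solutions: each nonempty cell
   gets a representative in the family. *)
have repP i : exists f0, forall f, F f -> `|vec f - e i| < dv -> F f0 /\ `|vec f0 - e i| < dv.
  have [[f0 [Ff0 f0e]]|none] := pselect (exists f0, F f0 /\ `|vec f0 - e i| < dv).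
    by exists f0.
  by exists (fun _ => 0) => f Ff fe; exfalso; apply: none; exists f.
have [rep Hrep] := choice repP.
exists n, (fun i => GG t s (rep i)) => _ [f Ff <-].
have [i fi] := He _ (vecM f Ff); exists i => x.
have [Fg gi] := Hrep i f Ff fi; set g := rep i in Fg gi *.
have solf := hGG sI (FCb _ Ff); have solg := hGG sI (FCb _ Fg).
have jf := jet_solution_classical solf; have jg := jet_solution_classical solg.
have [_ cf _ _ _] := solf; have [_ cg _ _ _] := solg.
have node a : dotmx (GG r s f (c a) - GG r s g (c a)) (GG r s f (c a) - GG r s g (c a)) <= dl / 9.
  have vfg : `|vec f - vec g| <= 2 * dv.
    rewrite -[vec f](subrK (e i)) -addrA (le_trans (ler_normD _ _))//.
    by rewrite [X in _ + X]distrC; lra.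
  rewrite dotmx_col.
  apply: (@le_trans _ _ (\sum_(h < m) (2 * dv) ^+ 2)).
    apply: ler_sum => h _; rewrite -expr2 -[leLHS]ger0_norm ?sqr_ge0// normrX.
    rewrite lerXn2r ?nnegrE ?mulr_ge0 ?(ltW dv0)//; apply: le_trans vfg.
    have := entry_le_norm (vec f - vec g) 0 (mxvec_index a h).
    by rewrite [in X in X -> _]mxE [in X in X -> _]mxE !mxvecE !mxE.
  rewrite sumr_const card_ord -mulr_natl exprMn sqr_sqrtr ?(ltW q0)//.
  by rewrite le_eqVlt; apply/orP; left; apply/eqP; field; rewrite gt_eqF.
have near_r y : enorm y <= rho ->
    dotmx (GG r s f y - GG r s g y) (GG r s f y - GG r s g y) <= dl.
  move=> yr; have ynorm := le_trans (norm_le_enorm y) yr.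
  have [a ya] := Hc y ynorm.
  have ydel : enorm (y - c a) <= del.
    apply: (@le_trans _ _ (d%:R * `|y - c a|)); last first.
      by rewrite mulrC -ler_pdivlMr// ltW.
    rewrite -[leRHS]ger0_norm ?mulr_ge0// -sqrtr_sqr ler_wsqrtr//.
    apply: (le_trans (dotmx_le_norm _)); rewrite mul1n exprMn ler_wpM2r ?sqr_ge0//.
    by rewrite -natrX ler_nat expnS expn1 leq_pmulr.
  have wb h : F h -> forall u x, s <= u <= r -> dotmx (GG u s h x) (GG u s h x) <= M1.
    by move=> Fh u z /andP[su ur]; apply: wM1 => //; rewrite su (le_trans ur)// ltW.
  have E1 := Hdel _ (jf r) cf (wb _ Ff) y (c a) ynorm ydel.
  have E2 := Hdel _ (jg r) cg (wb _ Fg) y (c a) ynorm ydel.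
  have -> : GG r s f y - GG r s g y = (GG r s f y - GG r s f (c a))
      + (GG r s f (c a) - GG r s g (c a)) + - (GG r s g y - GG r s g (c a)).
    by rewrite addrA subrK opprB addrA subrK.
  apply: (le_trans (sqnorm3_le _ _ _)); rewrite dotmxNl dotmxNr opprK.
  have := node a; lra.
have diss v y : r < v <= t -> dissipative_at Q B C b H v y.
  by move=> /andP[rv vt]; apply: HH; rewrite ltW.
have jw : jet_solution Q B C r t (fun u y => GG u s f y - GG u s g y).
  move=> u y /andP[ru ut]; apply: (jet_solutionB (jf t) (jg t)); rewrite ut andbT.
  exact: lt_trans ru.
have sub : [set p : R * 'rV[R]_d | r <= p.1] `<=` [set p : R * 'rV[R]_d | s <= p.1].
  by move=> p /=; apply: le_trans; exact: ltW.
have cw : {within [set p : R * 'rV[R]_d | r <= p.1],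
    continuous (fun p => GG p.1 s f p.2 - GG p.1 s g p.2)}.
  have cf' := continuous_subspaceW sub cf; have cg' := continuous_subspaceW sub cg.
  by move=> p; apply: cvgB; [exact: cf'|exact: cg'].
have wP u y : r <= u <= t -> dotmx (GG u s f y - GG u s g y) (GG u s f y - GG u s g y) <= 4 * M1.
  move=> /andP[ru ut]; have uin : s <= u <= t by rewrite ut andbT (le_trans _ ru)// ltW.
  apply: (le_trans (sqnormB_le _ _)); have := wM1 f u y Ff uin; have := wM1 g u y Fg uin; lra.
have M4 : 0 <= 4 * M1 by rewrite mulr_ge0.
have ws y : dotmx (GG r s f y - GG r s g y) (GG r s f y - GG r s g y) <= dl + 4 * M1 * cutoff N y.
  have [yr|/ltW yr] := leP (enorm y) rho.
    apply: (le_trans (near_r y yr)); rewrite lerDl mulr_ge0//.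
    by have /andP[] := cutoff_bounds N y.
  rewrite cutoff1// mulr1; apply: (le_trans (wP r y _)); first by rewrite lexx ltW.
  by rewrite lerDr ltW.
have tin : r <= t <= t by rewrite lexx andbT ltW.
have := sqnorm_comparison d0 m0 rt diss lyap jw cw wP (hG rI (Cb_cutoff N)) M4 ws x tin.
move=> final; apply: (le_trans (norm_le_enorm _)).
rewrite -[leRHS](ger0_norm (ltW eps0)) -sqrtr_sqr ler_wsqrtr//.
apply: (le_trans final); apply: (@le_trans _ _ (E * (2 * dl))).
  apply: (@le_trans _ _ (expR (2 * H * (t - r)) * (2 * dl))).
    rewrite ler_wpM2l ?expR_ge0//.
    have := ler_wpM2l M4 (HN x).
    have : 4 * M1 * e' <= dl.
      rewrite /e' mulrA ler_pdivrMr// [leRHS]mulrC ler_wpM2r ?(ltW dl0)//; lra.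
    lra.
  have dl2 : 0 <= 2 * dl by rewrite mulr_ge0// ltW.
  rewrite ler_wpM2r// ler_expR ler_wpM2r ?subr_ge0 ?(ltW rt)//; exact: ler_norm.
by rewrite le_eqVlt; apply/orP; left; apply/eqP; rewrite /dl; field; rewrite gt_eqF.
Qed.

End main.

Theorem theorem4p2 (R : realType) (d m : nat) (I : set R) (alpha : R)
    (Q : R -> 'rV[R]_d -> 'M[R]_d)
    (B : 'I_d -> R -> 'rV[R]_d -> 'M[R]_m)
    (C : R -> 'rV[R]_d -> 'M[R]_m)
    (b : 'I_d -> R -> 'rV[R]_d -> R)
    (Bt : 'I_d -> R -> 'rV[R]_d -> 'M[R]_m)
    (xi : R -> R) (sigma : R)
    (GG : R -> R -> ('rV[R]_d -> 'cV[R]_m) -> 'rV[R]_d -> 'cV[R]_m)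
    (G : R -> R -> ('rV[R]_d -> R) -> 'rV[R]_d -> R)
    (d_gt0 : (0 < d)%N) (m_gt0 : (0 < m)%N) (alpha01 : 0 < alpha < 1)
    (hI : open_right_halfline_or_line I)
    (hstanding : standing_assumption I alpha Q B C)
    (hB : assumptionB I alpha Q B C b Bt xi sigma)
    (hGG : evolution_operator (system_operator Q B C) I GG)
    (hG : evolution_operator (scalar_operator Q b) I G) :
  (forall J : set R, is_interval J -> bounded_set J -> J `<=` I ->
     (forall t s, J t -> J s -> s < t -> compact_operator (G t s)) ->
     forall t s, J t -> J s -> s < t -> compact_operator (GG t s)) /\
  ((exists (W : 'rV[R]_d -> R) (r : R) (g : R -> R),
      0 < r /\ lyapunov_superlinear I Q b W r g) ->
   forall t s, I t -> I s -> s < t -> compact_operator (GG t s)).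
Proof.
have mid (s t : R) : s < t -> s < (s + t) / 2 /\ (s + t) / 2 < t.
  by move=> st; split; lra.
split=> [J Jitv _ JI Gcompact t s tJ sJ st|[W [r [g [_ WP]]]] t s tI sI st].
  have [sr rt] := mid _ _ st.
  have rJ : J ((s + t) / 2) by apply: (Jitv _ _ sJ tJ); rewrite !ltW.
  apply: (tight_system_compact d_gt0 m_gt0 alpha01 hI hstanding hB hGG hG
    (JI _ sJ) (JI _ rJ) (JI _ tJ) sr rt).
  apply: (compact_tight hI hstanding hB hG (JI _ rJ) (JI _ tJ) rt).
  exact: Gcompact.
have [sr rt] := mid _ _ st.
have rI : I ((s + t) / 2).
  by apply: (segment_sub hI sI tI); rewrite /= in_itv/= !ltW.
apply: (tight_system_compact d_gt0 m_gt0 alpha01 hI hstanding hB hGG hG sI rI tI sr rt).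
exact: (lyapunov_tight hI hstanding hB hG WP rI tI rt).
Qed.
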